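(* Assume that $r>1$ and let $\mathbf s\in\mathbb R^r$ and $p,q\in(0,\infty]$. If property $(D')^{\mathbf s}_{p,q}$ holds, then $\mathbf s\le\mathbf 0$, that is, $s_j\le0$ for every $j=1,\dots,r$.
   Context: Setting. $E$ is a complex Hilbert space of finite dimension $n\ge0$, $F$ a real Hilbert space of finite dimension $m>0$, $F'$ its dual, $F_{\mathbb C}$ its complexification; $\mathbb R_+^*=(0,\infty)$. $\Omega\subset F$ is a homogeneous cone: a non-empty open convex cone containing no affine line on which $G(\Omega)=\{t\in GL(F):t\Omega=\Omega\}$ acts transitively. $T_+$ is a triangular Lie group (in some basis of $F$ all maps $x\mapsto t\cdot x$, $t\in T_+$, are upper triangular) acting linearly and simply transitively on $\Omega$; $\Delta\colon T_+\to(\mathbb R_+^* )^r$, $r\ge1$, is a homomorphism inducing an isomorphism of $T_+/[T_+,T_+]$ onto $(\mathbb R_+^* )^r$. $\Phi\colon E\times E\to F_{\mathbb C}$ is a non-degenerate hermitian map (linear in the first variable), $\overline\Omega$-positive (i.e. $\Phi(\zeta):=\Phi(\zeta,\zeta)\in\overline\Omega$), such that for every $t\in T_+$ there is $g\in GL(E)$ with $t\cdot\Phi=\Phi\circ(g\times g)$. $\mathcal N=E\times F$ is the group with product $(\zeta,x)(\zeta',x')=(\zeta+\zeta',x+x'+2\operatorname{Im}\Phi(\zeta,\zeta'))$, with Lebesgue measure as Haar measure; $(f*g)(y)=\int f(yz^{-1})g(z)\,dz$. $\mathcal S(\mathcal N)$ is the space of Schwartz functions. $\Omega'=\{\lambda\in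 F':\langle\lambda,h\rangle>0\ \forall h\in\overline\Omega\setminus\{0\}\}$; $T_+$ acts on $\Omega'$ on the right by transposition. Base points $e_\Omega\in\Omega$, $e_{\Omega'}\in\Omega'$ are fixed. For $\mathbf s\in\mathbb R^r$, $\Delta^{\mathbf s}(t)=\prod_j\Delta_j(t)^{s_j}$ and $\Delta_\Omega^{\mathbf s}(t\cdot e_\Omega)=\Delta^{\mathbf s}(t)=\Delta_{\Omega'}^{\mathbf s}(e_{\Omega'}\cdot t)$. $\mathbf d\in\mathbb R^r$ is such that $\nu_\Omega=\Delta_\Omega^{\mathbf d}$ times Lebesgue measure is $G(\Omega)$-invariant on $\Omega$, and $\nu_{\Omega'}=\Delta_{\Omega'}^{\mathbf d}$ times Lebesgue measure on $\Omega'$. Normalization of $\Delta$: $\Delta$ is chosen so that for some $\mathbf m,\mathbf m'\in\mathbb N^r$ the measures $\Delta_\Omega^{\mathbf s}\nu_\Omega$ and $\Delta_{\Omega'}^{\mathbf s}\nu_{\Omega'}$ extend to Radon measures on $\overline\Omega$ and $\overline{\Omega'}$ if and only if $\mathbf s\in\frac12\mathbf m+(\mathbb R_+^* )^r$ and $\mathbf s\in\frac12\mathbf m'+(\mathbb R_+^* )^r$, respectively, and so that $\Delta^{\mathbf s}(t)=\rho^{\sum_js_j}$ if $t\in T_+$ acts as the homothety of ratio $\rho>0$. $\Omega'$ carries the distance of a complete $T_+$-invariant Riemannian metric. A $(\delta,R)$-lattice ($\delta>0$, $R>1$) in a metric space is a family $(x_k)$ such that the balls $B(x_k,\delta)$ are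 pairwise disjoint and the balls $B(x_k,R\delta)$ cover the space. Representations. $W=\{\lambda\in F':\langle\lambda_{\mathbb C},\Phi\rangle\text{ is degenerate}\}$ ($\lambda_{\mathbb C}$ the complexification of $\lambda$). For $\lambda\in F'\setminus W$, $\pi_\lambda$ is the (unique up to equivalence) irreducible unitary representation of $\mathcal N$, in a Hilbert space $H_\lambda$, with $\pi_\lambda(0,x)=e^{-i\langle\lambda,x\rangle}I$; $\pi_\lambda(f)=\int f(y)\pi_\lambda(y)\,dy$. For $\lambda\in\Omega'$, $H_\lambda$ is the space of holomorphic functions on $E$ which are square integrable with respect to $e^{-2\langle\lambda,\Phi(\omega)\rangle}d\omega$, $[\pi_\lambda(\zeta,x)\varphi](\omega)=e^{\langle\lambda_{\mathbb C},-ix+2\Phi(\omega,\zeta)-\Phi(\zeta)\rangle}\varphi(\omega-\zeta)$, and $P_{\lambda,0}$ is the orthogonal projector onto the constants. Test functions. For $K\subset\Omega'$ compact, $\mathcal S_\Omega(\mathcal N,K)=\{\varphi\in\mathcal S(\mathcal N):\pi_\lambda(\varphi)=\chi_K(\lambda)P_{\lambda,0}\pi_\lambda(\varphi)P_{\lambda,0}\ \forall\lambda\in F'\setminus W\}$ (so $\pi_\lambda(\varphi)=0$ if $\lambda\notin K$) and $\mathcal S_{\Omega,L}(\mathcal N,K)=\mathcal S(\mathcal N)*\mathcal S_\Omega(\mathcal N,K)$; $\mathcal S_\Omega(\mathcal N)$ and $\mathcal S_{\Omega,L}(\mathcal N)$ are their inductive limits (unions) over $K$. $\mathcal F_{\mathcal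 N}\varphi(\lambda)=\operatorname{Tr}\pi_\lambda(\varphi)$, $\lambda\in\Omega'$, is an isomorphism of $\mathcal S_\Omega(\mathcal N)$ onto $C_c^\infty(\Omega')$. Property $(D')^{\mathbf s}_{p,q}$. For $\lambda\in F'$, let $J_\lambda$ be the $\mathbb C$-linear endomorphism of $E$ with $\langle\lambda_{\mathbb C},\Phi(\zeta,\zeta')\rangle=\langle\zeta|-iJ_\lambda\zeta'\rangle_E$, and $N(\lambda)=(\operatorname{Tr}|J_\lambda|)^2+|\lambda|^2$. Property $(D')^{\mathbf s}_{p,q}$ holds if there are a $(\delta,R)$-lattice $(\lambda_k)_{k\in K}$ on $\Omega'$ for some $\delta>0$, $R>1$, a bounded family $(\varphi_k)$ of non-negative elements of $C_c^\infty(\Omega')$ with $\sum_k\varphi_k(\,\cdot\,t_k^{-1})\ge1$ on $\Omega'$, where $t_k\in T_+$ and $\lambda_k=e_{\Omega'}\cdot t_k$, and constants $C>0$, $c>1$ such that $$\Big\|\sum_{k\in K_c}u_k*\psi_k\Big\|_{L^p(\mathcal N)}\le C\Big\|\Delta_{\Omega'}^{\mathbf s}(\lambda_k)\|u_k*\psi_k\|_{L^p(\mathcal N)}\Big\|_{\ell^q(K_c)}$$ for every finitely supported family $(u_k)_{k\in K_c}$ in $\mathcal S_{\Omega,L}(\mathcal N)$, where $\psi_k=\mathcal F_{\mathcal N}^{-1}(\varphi_k(\,\cdot\,t_k^{-1}))$ and $K_c=\{k\in K:\varphi_k(\,\cdot\,t_k^{-1})(\chi_{[1/c,c]}\circ N)\ne0\}$.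 *)

(* Defs.v *)
From HB Require Import structures.
From mathcomp Require Import all_boot all_order all_algebra.
From mathcomp Require Import all_classical all_reals all_analysis.
From mathcomp Require Import complex sesquilinear finmap.
Set Implicit Arguments.
Unset Strict Implicit.
Unset Printing Implicit Defensive.
Import Order.TTheory GRing.Theory Num.Theory.
Import numFieldNormedType.Exports.
Local Open Scope classical_set_scope.
Local Open Scope ring_scope.

(* E is C^n and F is R^m, in orthonormal coordinates.  Vectors of E and F are
   columns, elements of F' are rows; T_+ and G(Omega) are sets of matrices,
   acting on columns from the left and on rows from the right (transposition). *)

(* R[i], typed so that it carries the topology of a numFieldType. *)
Definition Cplx (R : realType) : numClosedFieldType := R[i].

Section lebesgue_step.
Context (R : realType) (d0 : measure_display) (T : measurableType d0) (d : nat).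
Variable nu : {sigma_finite_measure set T -> \bar R}.
Variable mu : {sigma_finite_measure set (d.-tuple T) -> \bar R}.

Definition tcons (x : T * d.-tuple T) :
  d.+1.-tuple T := [tuple of x.1 :: x.2].

Lemma behead_tcons z : [tuple of behead (tcons z)] = z.2.
Proof. exact/val_inj. Qed.

Lemma measurable_tcons : measurable_fun setT tcons.
Proof. by apply: measurable_cons; [exact: measurable_fst | exact: measurable_snd]. Qed.

Definition leb_step : set (d.+1.-tuple T) -> \bar R :=
  pushforward (nu \x mu)%E tcons.

Let leb_step_measure : {measure set (d.+1.-tuple T) -> \bar R} :=
  measure_function_pushforward__canonical__measure_function_Measure
    (nu \x mu)%E measurable_tcons.

HB.instance Definition _ := isMeasure.Build _ _ _ leb_step
  (measure0 leb_step_measure) (measure_ge0 leb_step_measure)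
  (@measure_semi_sigma_additive _ _ _ leb_step_measure).

Lemma leb_stepE (A : set T) B : measurable A -> measurable B ->
  leb_step [set x | A (thead x) /\ B [tuple of behead x]]
  = (nu A * mu B)%E.
Proof.
move=> mA mB; rewrite /leb_step /pushforward -product_measure1E//.
rewrite (_ : tcons @^-1` _ = A `*` B)//.
apply/seteqP; by split => z /=; rewrite behead_tcons.
Qed.

Lemma leb_step_sigma_finite : sigma_finite setT leb_step.
Proof.
have /sigma_finiteP[F [TF ndF Foo]] := sigma_finiteT nu.
have /sigma_finiteP[G [TG ndG Goo]] := sigma_finiteT mu.
exists (fun k => [set x | F k (thead x) /\ G k [tuple of behead x]]).
  apply/seteqP; split => // x _.
  have [i _ Fi] : (\bigcup_i F i) (thead x) by rewrite -TF.
  have [j _ Gj] : (\bigcup_i G i) [tuple of behead x] by rewrite -TG.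
  exists (maxn i j) => //; split.
  - by move: Fi; exact/subsetPset/ndF/leq_maxl.
  - by move: Gj; exact/subsetPset/ndG/leq_maxr.
move=> k; have [mF Fk] := Foo k; have [mG Gk] := Goo k; split.
  apply: measurableI.
  - rewrite -[X in measurable X]setTI; exact: (measurable_tnth ord0 measurableT).
  - by rewrite -[X in measurable X]setTI; exact: measurable_behead.
by rewrite leb_stepE// lte_mul_pinfty// ge0_fin_numE.
Qed.

HB.instance Definition _ :=
  Measure_isSigmaFinite.Build _ _ _ leb_step leb_step_sigma_finite.

End lebesgue_step.

(* Lebesgue measure on R^d (Borel sets of tuples); see [leb_box]. *)
Fixpoint leb (R : realType) (d : nat) :
    {sigma_finite_measure set (d.-tuple (measurableTypeR R)) -> \bar R} :=
  match d with
  | 0%N => dirac [tuple]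
  | d'.+1 => leb_step (@lebesgue_measure R) (leb R d')
  end.

Lemma leb_box (R : realType) d (A : 'I_d -> set (measurableTypeR R)) :
  (forall i, measurable (A i)) ->
  leb R d [set x | forall i, A i (tnth x i)]
  = (\prod_(i < d) lebesgue_measure (A i))%E.
Proof.
elim: d A => [|d IH] A mA.
  rewrite big_ord0 /= diracE mem_set// => -[]//.
rewrite big_ord_recl -IH// -leb_stepE//.
- congr (leb_step _ _); apply/seteqP; split => x /=.
  + move=> H; split; first exact: H.
    by move=> i; have := H (lift ord0 i); rewrite [in X in X -> _](tuple_eta x) tnthS.
  + move=> [H0 H] i; rewrite (tuple_eta x).
    by case: (unliftP ord0 i) => [j|] ->; rewrite ?tnthS ?tnth0.
- rewrite (_ : [set _ | _] = \bigcap_(i in setT)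
     ((fun x : d.-tuple (measurableTypeR R) => tnth x i) @^-1` A (lift ord0 i))).
    apply: fin_bigcap_measurable => // i _.
    by rewrite -[X in measurable X]setTI; exact: measurable_tnth.
  by apply/seteqP; split => x /= H i => [_|]; exact: H.
Qed.

Section coordinates.
Context {R : realType}.
Local Notation C := (Cplx R).

Definition row_of d (x : d.-tuple (measurableTypeR R)) : 'rV[R]_d :=
  \row_i (tnth x i : R).

Definition col_of d (x : d.-tuple (measurableTypeR R)) : 'cV[R]_d :=
  \col_i (tnth x i : R).

Definition E_of n (v : 'rV[R]_(n + n)) : 'cV[C]_n :=
  \col_j ((v 0 (lshift n j) +i* v 0 (rshift n j))%C : C).

Definition N_of n m (v : 'rV[R]_(n + n + m)) : 'cV[C]_n * 'cV[R]_m :=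
  (E_of (lsubmx v), (rsubmx v)^T).

Definition toC (x : R) : C := (x%:C)%C.

Definition cexp (z : C) : C :=
  ((expR (complex.Re z) * cos (complex.Im z))
    +i* (expR (complex.Re z) * sin (complex.Im z)))%C.

Definition cintegral d (T : measurableType d) (mu : {measure set T -> \bar R})
    (f : T -> C) : C :=
  ((\int[mu]_x complex.Re (f x)) +i* (\int[mu]_x complex.Im (f x)))%C.

Definition dotE n (z w : 'cV[C]_n) : C := \sum_j z j 0 * (w j 0)^*.

Definition pairing m (lam : 'rV[R]_m) (x : 'cV[R]_m) : R := (lam *m x) 0 0.

Definition pairingC m (lam : 'rV[R]_m) (z : 'cV[C]_m) : C :=
  (map_mx toC lam *m z) 0 0.

End coordinates.

Section smooth_functions.
Context {R : realType}.
Local Notation C := (Cplx R).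

Definition iterD (V : normedModType R) (vs : seq V) (f : V -> R) : V -> R :=
  foldr (fun v g x => 'D_v g x) f vs.

Definition smooth_on (V : normedModType R) (U : set V) (f : V -> R) : Prop :=
  forall vs x, U x -> {for x, continuous (iterD vs f)} /\
    forall v, derivable (iterD vs f) x v.

Definition schwartzR d (f : 'rV[R]_d -> R) : Prop :=
  smooth_on setT f /\
  forall vs k, exists M, forall x, (1 + `|x|) ^+ k * `|iterD vs f x| <= M.

Definition schwartz n m (f : 'cV[C]_n * 'cV[R]_m -> C) : Prop :=
  schwartzR (fun v : 'rV[R]_(n + n + m) => complex.Re (f (N_of v))) /\
  schwartzR (fun v : 'rV[R]_(n + n + m) => complex.Im (f (N_of v))).

(* Bounded subsets of the inductive limit C_c^infty(U): a common compact
   support and uniform bounds on every derivative. *)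
Definition bounded_Cc_infty (I : Type) (V : normedModType R) (U : set V)
    (phi : I -> V -> R) : Prop :=
  (forall k, smooth_on setT (phi k)) /\
  (exists H, [/\ compact H, H `<=` U & forall k x, ~ H x -> phi k x = 0]) /\
  (forall vs, exists M, forall k x, `|iterD vs (phi k) x| <= M).

Definition holomorphic n (f : 'cV[C]_n -> C) : Prop :=
  forall w, differentiable f w.

End smooth_functions.

Section cones.
Context {R : realType} {m : nat}.
Implicit Types (O : set 'cV[R]_m) (T : set 'M[R]_m).

Definition cone_group O : set 'M[R]_m :=
  [set g | g \in unitmx /\ mulmx g @` O = O].

Definition homogeneous_cone O : Prop :=
  [/\ O !=set0, open O,
      (forall x a, O x -> 0 < a -> O (a *: x)) &
      (forall x y a, O x -> O y -> 0 <= a <= 1 -> O (a *: x + (1 - a) *: y))] /\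
  (forall x v, v != 0 -> ~ (forall a, O (x + a *: v))) /\
  (forall x y, O x -> O y -> exists2 g, cone_group O g & g *m x = y).

Definition dual_cone O : set 'rV[R]_m :=
  [set lam | forall h, closure O h -> h != 0 -> 0 < pairing lam h].

Definition is_subgroup T : Prop :=
  [/\ T `<=` [set t | t \in unitmx], T 1%:M,
      (forall a b, T a -> T b -> T (a *m b)) & (forall a, T a -> T (invmx a))].

Definition commutator_subgroup T : set 'M[R]_m :=
  [set t | forall H, is_subgroup H ->
    (forall a b, T a -> T b -> H (a *m b *m invmx a *m invmx b)) -> H t].

(* A Lie group acting simply transitively on O is a closed subgroup of GL(F). *)
Definition triangular_simply_transitive O T : Prop :=
  [/\ is_subgroup T,
      (forall t, closure T t -> t \in unitmx -> T t),
      (exists2 P, P \in unitmx & forall t, T t ->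
         forall i j : 'I_m, (j < i)%N -> (P *m t *m invmx P) i j = 0),
      T `<=` cone_group O &
      (forall x y, O x -> O y -> exists! t, T t /\ t *m x = y)].

Definition abelianization r T (Delta : 'M[R]_m -> 'I_r -> R) : Prop :=
  (forall t, T t -> forall j, 0 < Delta t j) /\
  (forall t t', T t -> T t' -> forall j,
     Delta (t *m t') j = Delta t j * Delta t' j) /\
  (forall j, {within T, continuous (fun t => Delta t j)}) /\
  (forall a : 'I_r -> R, (forall j, 0 < a j) ->
     exists2 t, T t & forall j, Delta t j = a j) /\
  (forall t, T t ->
     ((forall j, Delta t j = 1) <-> commutator_subgroup T t)).

End cones.

(* The measure with density h on O extends to a Radon measure on the closure
   of O; c is the chart identifying R^d with V. *)
Definition extends_to_radon (R : realType) (V : topologicalType) d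
    (c : d.-tuple (measurableTypeR R) -> V) (O : set V) (h : V -> R) : Prop :=
  exists mu : {measure set (d.-tuple (measurableTypeR R)) -> \bar R},
    (forall K, compact K -> K `<=` closure O -> (mu (c @^-1` K) < +oo)%E) /\
    (forall A, measurable (c @^-1` A) -> A `<=` O ->
       mu (c @^-1` A) = (\int[leb R d]_(x in c @^-1` A) (h (c x))%:E)%E).

Section riemannian_distance.
Context {R : realType} {m : nat}.
Variables (O : set 'rV[R]_m) (g : 'rV[R]_m -> 'M[R]_m).

Definition riem_norm (x v : 'rV[R]_m) : R := Num.sqrt ((v *m g x *m v^T) 0 0).

Definition C1_curve (gam : R -> 'rV[R]_m) : Prop :=
  [/\ forall a, derivable gam a 1, continuous (derive1 gam) &
      forall a, 0 <= a <= 1 -> O (gam a)].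

Definition curve_length (gam : R -> 'rV[R]_m) : R :=
  \int[lebesgue_measure]_(a in `[0, 1]) riem_norm (gam a) (derive1 gam a).

(* [joined x y l]: some piecewise C^1 curve in O from x to y has length l. *)
Inductive joined (x : 'rV[R]_m) : 'rV[R]_m -> R -> Prop :=
| joined_refl : O x -> joined x x 0
| joined_step y l gam : joined x y l -> C1_curve gam -> gam 0 = y ->
    joined x (gam 1) (l + curve_length gam).

Definition riem_dist (x y : 'rV[R]_m) : R := inf [set l | joined x y l].

Definition riemannian_metric : Prop :=
  [/\ forall i j, smooth_on O (fun x => g x i j),
      forall x, O x -> (g x)^T = g x &
      forall x (v : 'rV_m), O x -> v != 0 -> 0 < (v *m g x *m v^T) 0 0].

Definition complete_metric : Prop :=
  forall u : nat -> 'rV[R]_m, (forall k, O (u k)) ->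
    (forall e, 0 < e -> exists k0, forall j k, (k0 <= j)%N -> (k0 <= k)%N ->
       riem_dist (u j) (u k) < e) ->
    exists2 l, O l & forall e, 0 < e -> exists k0, forall k, (k0 <= k)%N ->
       riem_dist (u k) l < e.

Definition invariant_metric (T : set 'M[R]_m) : Prop :=
  forall t, T t -> forall x v, O x ->
    riem_norm (x *m t) (v *m t) = riem_norm x v.

Definition lattice (delta rho : R) (K : Type) (x : K -> 'rV[R]_m) : Prop :=
  [/\ forall k, O (x k),
      forall j k, j <> k -> forall y, O y ->
        ~ (riem_dist (x j) y < delta /\ riem_dist (x k) y < delta) &
      forall y, O y -> exists k, riem_dist (x k) y < rho * delta].

End riemannian_distance.

Record siegel_data (R : realType) (n m r : nat) := SiegelData {
  Omega : set 'cV[R]_m;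
  Tplus : set 'M[R]_m;
  Delta : 'M[R]_m -> 'I_r -> R;
  Phi : 'cV[Cplx R]_n -> 'cV[Cplx R]_n -> 'cV[Cplx R]_m;
  e_Omega : 'cV[R]_m;
  e_Omega' : 'rV[R]_m;
  dexp : 'I_r -> R;
  metric : 'rV[R]_m -> 'M[R]_m }.

Section setting.
Context {R : realType} {n m r : nat}.
Variable D : siegel_data R n m r.
Local Notation C := (Cplx R).
Local Notation E := 'cV[C]_n.
Local Notation N := ('cV[C]_n * 'cV[R]_m)%type.
Local Notation Phi := (Phi D).
Local Notation Omega' := (dual_cone (Omega D)).
Implicit Types (lam : 'rV[R]_m) (s : 'I_r -> R).

Definition Delta_pow s (t : 'M[R]_m) : R := \prod_j Delta D t j `^ s j.

Definition Delta_Omega s (x : 'cV[R]_m) : R :=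
  Delta_pow s (xget 1%:M [set t | Tplus D t /\ t *m e_Omega D = x]).

Definition Delta_Omega' s lam : R :=
  Delta_pow s (xget 1%:M [set t | Tplus D t /\ e_Omega' D *m t = lam]).

Definition Phi_hermitian : Prop :=
  (forall a z z' w, Phi (a *: z + z') w = a *: Phi z w + Phi z' w) /\
  (forall z w, Phi w z = map_mx Num.conj (Phi z w)).

Definition Phi_nondegenerate : Prop :=
  forall z, (forall w, Phi z w = 0) -> z = 0.

Definition Phi_positive : Prop :=
  forall z, exists2 x, closure (Omega D) x & Phi z z = map_mx toC x.

Definition Phi_equivariant : Prop :=
  forall t, Tplus D t -> exists2 g : 'M[C]_n, g \in unitmx &
    forall z w, map_mx toC t *m Phi z w = Phi (g *m z) (g *m w).

Definition nu_Omega_invariant : Prop :=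
  let nu (A : set 'cV[R]_m) :=
    (\int[leb R m]_(x in @col_of R m @^-1` A)
       (Delta_Omega (dexp D) (col_of x))%:E)%E in
  forall g A, cone_group (Omega D) g -> A `<=` Omega D ->
    measurable (@col_of R m @^-1` A) -> nu (mulmx g @` A) = nu A.

Definition Delta_normalized : Prop :=
  (exists mm mm' : 'I_r -> nat, forall s,
    (extends_to_radon (@col_of R m) (Omega D)
       (Delta_Omega (fun j => s j + dexp D j))
     <-> forall j, (mm j)%:R / 2 < s j) /\
    (extends_to_radon (@row_of R m) Omega'
       (Delta_Omega' (fun j => s j + dexp D j))
     <-> forall j, (mm' j)%:R / 2 < s j)) /\
  (forall rho, 0 < rho -> Tplus D rho%:M ->
     forall s, Delta_pow s rho%:M = rho `^ (\sum_j s j)).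

Definition siegel_setting : Prop :=
  (homogeneous_cone (Omega D) /\
   triangular_simply_transitive (Omega D) (Tplus D) /\
   abelianization (Tplus D) (Delta D)) /\
  [/\ Phi_hermitian, Phi_nondegenerate, Phi_positive & Phi_equivariant] /\
  [/\ Omega D (e_Omega D), Omega' (e_Omega' D), nu_Omega_invariant &
      Delta_normalized] /\
  [/\ riemannian_metric Omega' (metric D), complete_metric Omega' (metric D) &
      invariant_metric Omega' (metric D) (Tplus D)].

Definition mulN (y y' : N) : N :=
  (y.1 + y'.1, y.2 + y'.2 + 2 *: map_mx (@complex.Im R) (Phi y.1 y'.1)).

Definition invN (y : N) : N := (- y.1, - y.2).

Definition integralN (f : N -> C) : C :=
  cintegral (leb R (n + n + m)) (fun x => f (N_of (row_of x))).

Definition convN (f g : N -> C) : N -> C :=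
  fun y => integralN (fun z => f (mulN y (invN z)) * g z).

Definition LpN (p : \bar R) (f : N -> C) : \bar R :=
  Lnorm (leb R (n + n + m)) p
    (fun x => (Normc.normc (f (N_of (row_of x)) : R[i]))%:E).

Definition W : set 'rV[R]_m :=
  [set lam | exists2 z, z != 0 & forall w, pairingC lam (Phi z w) = 0].

Definition weight lam (w : E) : R :=
  expR (- 2 * complex.Re (pairingC lam (Phi w w))).

Definition integralE (f : E -> C) : C :=
  cintegral (leb R (n + n)) (fun x => f (E_of (row_of x))).

Definition fock lam : set (E -> C) :=
  [set f | holomorphic f /\
    (\int[leb R (n + n)]_x (Normc.normc (f (E_of (row_of x)) : R[i]) ^+ 2
        * weight lam (E_of (row_of x)))%:E < +oo)%E].

Definition dotH lam (f g : E -> C) : C :=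
  integralE (fun w => f w * (g w)^* * toC (weight lam w)).

Definition pi_ lam (y : N) (f : E -> C) : E -> C :=
  let: (z, x) := y in
  fun w => cexp (pairingC lam
      (- ('i : C) *: map_mx toC x + 2 *: Phi w z - Phi z z)) * f (w - z).

Definition proj0 lam (f : E -> C) : E -> C :=
  fun=> dotH lam f (fun=> 1) / dotH lam (fun=> 1) (fun=> 1).

(* < pi_lam(phi) u | v > *)
Definition pi_coef lam (phi : N -> C) (u v : E -> C) : C :=
  integralN (fun y => phi y * dotH lam (pi_ lam y u) v).

Definition orthonormal_basis lam (I : choiceType) (e : I -> E -> C) : Prop :=
  [/\ forall i, fock lam (e i),
      forall i j, dotH lam (e i) (e j) = (i == j)%:R &
      forall f, fock lam f -> (forall i, dotH lam f (e i) = 0) -> f = fun=> 0].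

Definition has_trace lam (phi : N -> C) (a : C) : Prop :=
  forall (I : choiceType) (e : I -> E -> C), orthonormal_basis lam e ->
  forall eps : R, 0 < eps -> exists J0 : {fset I}, forall J : {fset I},
    (J0 `<=` J)%fset ->
    Normc.normc (\sum_(i <- J) pi_coef lam phi (e i) (e i) - a : R[i]) < eps.

Section abstract_representations.
Variables (H : lmodType C) (dot : {dot H for Num.conj}).

Definition sqnorm (u : H) : R := complex.Re (dot u u).

Definition hilbert : Prop :=
  forall u : nat -> H,
    (forall e, 0 < e -> exists k0, forall j k, (k0 <= j)%N -> (k0 <= k)%N ->
       sqnorm (u j - u k) < e) ->
    exists l, forall e, 0 < e -> exists k0, forall k, (k0 <= k)%N ->
       sqnorm (u k - l) < e.

Definition unitary_rep (rho : N -> H -> H) : Prop :=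
  [/\ forall y a u v, rho y (a *: u + v) = a *: rho y u + rho y v,
      forall y u v, dot (rho y u) (rho y v) = dot u v,
      rho (0, 0) = id,
      forall y y' u, rho (mulN y y') u = rho y (rho y' u) &
      forall u y e, 0 < e -> \forall y' \near y, sqnorm (rho y' u - rho y u) < e].

Definition closed_subspace (V : set H) : Prop :=
  [/\ V 0, forall a u v, V u -> V v -> V (a *: u + v) &
      forall u, (forall e, 0 < e -> exists2 v, V v & sqnorm (u - v) < e) -> V u].

Definition irreducible_rep (rho : N -> H -> H) : Prop :=
  (exists u : H, u != 0) /\
  forall V, closed_subspace V -> (forall y u, V u -> V (rho y u)) ->
    V = [set 0] \/ V = setT.

End abstract_representations.

(* pi_lam is unique up to equivalence, so that pi_lam(phi) = 0 is expressed
   on all of its realizations; the operator is given by matrix coefficients. *)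
Definition vanishes_at (phi : N -> C) lam : Prop :=
  forall (H : lmodType C) (dot : {dot H for Num.conj}) (rho : N -> H -> H),
    hilbert dot -> unitary_rep dot rho -> irreducible_rep dot rho ->
    (forall x u, rho (0, x) u = cexp (- ('i : C) * toC (pairing lam x)) *: u) ->
    forall u v, integralN (fun y => phi y * dot (rho y u) v) = 0.

Definition S_OmegaK (K : set 'rV[R]_m) : set (N -> C) :=
  [set phi | schwartz phi /\ forall lam, ~ W lam ->
    (Omega' lam -> forall u v, fock lam u -> fock lam v ->
       pi_coef lam phi u v
       = \1_K lam * pi_coef lam phi (proj0 lam u) (proj0 lam v)) /\
    (~ Omega' lam -> vanishes_at phi lam)].

Definition S_Omega : set (N -> C) :=
  [set phi | exists K, [/\ compact K, K `<=` Omega' & S_OmegaK K phi]].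

Definition S_OmegaL : set (N -> C) :=
  [set f | exists K, [/\ compact K, K `<=` Omega' &
    exists g h, [/\ schwartz g, S_OmegaK K h & f = convN g h]]].

(* psi = F_N^{-1}(h) *)
Definition is_inverse_FN (h : 'rV[R]_m -> R) (psi : N -> C) : Prop :=
  S_Omega psi /\ forall lam, Omega' lam -> has_trace lam psi (toC (h lam)).

Definition J_ lam : 'M[C]_n :=
  xget 0 [set J | forall z w,
    pairingC lam (Phi z w) = dotE z (- ('i : C) *: (J *m w))].

Definition adjoint (A : 'M[C]_n) : 'M[C]_n := (map_mx Num.conj A)^T.

(* |A| is the positive square root of A^* A. *)
Definition abs_mx (A : 'M[C]_n) : 'M[C]_n :=
  xget 0 [set B | [/\ adjoint B = B, forall z, 0 <= dotE (B *m z) z &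
                     B *m B = adjoint A *m A]].

Definition N_ lam : R :=
  complex.Re (\tr (abs_mx (J_ lam))) ^+ 2 + \sum_i lam 0 i ^+ 2.

Definition ell (q : \bar R) (K : choiceType) (A : set K) (a : K -> \bar R) :
    \bar R :=
  (match q with
   | q%:E => (\esum_(k in A) a k `^ q) `^ q^-1
   | _ => ereal_sup (0 |` a @` A)
   end)%E.

Definition property_D' s (p q : \bar R) : Prop :=
  exists (delta rho : R) (K : choiceType) (lamk : K -> 'rV[R]_m)
    (tk : K -> 'M[R]_m) (phi : K -> 'rV[R]_m -> R) (psi : K -> N -> C)
    (M c : R),
  let phit k lam := phi k (lam *m invmx (tk k)) in
  let Kc := [set k | exists lam, [/\ phit k lam != 0, c^-1 <= N_ lam &
                                    N_ lam <= c]] in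
  [/\ 0 < delta, 1 < rho, 0 < M & 1 < c] /\
  [/\ lattice Omega' (metric D) delta rho lamk,
      forall k, Tplus D (tk k) /\ lamk k = e_Omega' D *m tk k,
      bounded_Cc_infty Omega' phi,
      (forall k x, 0 <= phi k x) &
      (forall lam, Omega' lam ->
         (1 <= \esum_(k in [set: K]) (phit k lam)%:E)%E)] /\
  (forall k, is_inverse_FN (phit k) (psi k)) /\
  forall u : K -> N -> C,
    (forall k, Kc k -> S_OmegaL (u k)) ->
    finite_set [set k | Kc k /\ u k <> fun=> 0] ->
    (LpN p (fun y => (\sum_(k \in Kc) convN (u k) (psi k) y)%R)
     <= M%:E * ell q Kc (fun k =>
          (Delta_Omega' s (lamk k))%:E * LpN p (convN (u k) (psi k))))%E.

End setting.

(* Main.v *)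
From HB Require Import structures.
Require Import Defs.
From mathcomp Require Import all_boot all_order all_algebra.
From mathcomp Require Import all_classical all_reals all_analysis.
From mathcomp Require Import complex sesquilinear finmap perm ring lra.
From mathcomp Require Import measurable_realfun ess_sup_inf.
Set Implicit Arguments.
Unset Strict Implicit.
Unset Printing Implicit Defensive.
Import Order.TTheory GRing.Theory Num.Theory.
Import numFieldNormedType.Exports.
Local Open Scope classical_set_scope.
Local Open Scope ring_scope.

(* FILE A *)
Section lebesgue_tuples.
Context (R : realType).
Local Notation tup d := (d.-tuple (measurableTypeR R)).

Lemma ler_coord_norm m n (v : 'M[R]_(m, n)) i j : `|v i j| <= `|v|.
Proof.
rewrite [leRHS]/Num.norm /= mx_normrE; apply/bigmax_geP; right => /=.
by exists (i, j).
Qed.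

Lemma ler_norm_coord m n (v : 'M[R]_(m, n)) a : 0 <= a ->
  (forall i j, `|v i j| <= a) -> `|v| <= a.
Proof.
move=> a0 H; rewrite [leLHS]/Num.norm /= mx_normrE; by apply/bigmax_leP; split.
Qed.

Lemma measurable_row_of_open d (U : set 'rV[R]_d) : open U ->
  measurable (@row_of R d @^-1` U).
Proof.
move=> oU.
pose box (q : d.-tuple (rat * rat)) : set (tup d) :=
  [set x | forall i, `]ratr (tnth q i).1, ratr (tnth q i).2[%classic (tnth x i : R)].
pose F q := if `[< box q `<=` @row_of R d @^-1` U >] then box q else set0.
rewrite (_ : _ @^-1` _ = \bigcup_q F q); last first.
  apply/seteqP; split => x /=; last first.
    by move=> [q _]; rewrite /F; case: asboolP => // + bx; exact.
  move=> Ux; have /nbhs_ballP[e /= e0 eU] := open_nbhs_nbhs (conj oU Ux).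
  have H1 (i : 'I_d) : {q : rat | ratr q \in `](tnth x i : R) - e, (tnth x i : R)[}.
    by apply/cid/rat_in_itvoo; rewrite ltrBlDr ltrDl.
  have H2 (i : 'I_d) : {q : rat | ratr q \in `](tnth x i : R), (tnth x i : R) + e[}.
    by apply/cid/rat_in_itvoo; rewrite ltrDl.
  exists [tuple (sval (H1 i), sval (H2 i)) | i < d] => //.
  have bx : box [tuple (sval (H1 i), sval (H2 i)) | i < d] x.
    move=> i /=; rewrite tnth_mktuple /=; rewrite in_itv/=.
    by case: (H1 i) (H2 i) => q /=; rewrite in_itv/= => /andP[_ ->] [q' /=];
      rewrite in_itv/= => /andP[->].
  rewrite /F; case: asboolP => // -[y by_]; apply: eU; split => // i j.
  rewrite !mxE; have /= := by_ j; rewrite tnth_mktuple /= in_itv/=.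
  case: (H1 j) (H2 j) => q /=; rewrite in_itv/= => /andP[h1 h2] [q' /=].
  rewrite in_itv/= => /andP[h3 h4] /andP[h5 h6].
  rewrite /ball /= ltr_norml; apply/andP; split; lra.
apply: countable_bigcupT_measurable => [|q]; first exact: countableP.
rewrite /F; case: asboolP => // _.
rewrite (_ : box q = \bigcap_(i in setT) ((fun x : tup d => tnth x i) @^-1`
   `]ratr (tnth q i).1, ratr (tnth q i).2[%classic)).
  apply: fin_bigcap_measurable => // i _.
  by rewrite -[X in measurable X]setTI; apply: measurable_tnth => //; exact: measurable_itv.
by apply/seteqP; split => x /= H i => [_|]; exact: H.
Qed.

Lemma measurable_row_of_closed d (U : set 'rV[R]_d) : closed U ->
  measurable (@row_of R d @^-1` U).
Proof.
move=> cU; rewrite -[X in measurable X]setCK; apply: measurableC.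
by apply: (@measurable_row_of_open d (~` U)); exact: closed_openC.
Qed.

Lemma measurable_row_of_continuous d (f : 'rV[R]_d -> R) : continuous f ->
  measurable_fun setT (fun x : tup d => f (row_of x)).
Proof.
move=> /continuousP cf; apply: (measurability _ (RGenOpens.measurableE R)).
move=> _ [_ [a [b ->] <-]]; rewrite setTI.
apply: (@measurable_row_of_open d (f @^-1` `]a, b[%classic)).
exact/cf/interval_open.
Qed.

Lemma lebesgue_affine (rho c : R) (A : set (measurableTypeR R)) :
  0 < rho -> measurable A ->
  lebesgue_measure ((fun x : measurableTypeR R => rho * x + c : measurableTypeR R) @^-1` A) =
  ((rho^-1)%:E * lebesgue_measure A)%E.
Proof.
move=> rho0 mA; set f := fun x => _.
have mf : @measurable_fun _ _ (measurableTypeR R) (measurableTypeR R) setT f.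
  by apply: measurable_funD => //; exact: measurable_funM.
pose nu : {measure set (measurableTypeR R) -> \bar R} :=
  measure_function_pushforward__canonical__measure_function_Measure
    (@lebesgue_measure R) mf.
pose nu' : {measure set (measurableTypeR R) -> \bar R} :=
  mscale (NngNum (ltW rho0)) nu.
rewrite [in RHS](@lebesgue_measure_unique R nu' _ A mA); last first.
  move=> X [[a b] /= _ <-]; rewrite /mscale /= /pushforward.
  rewrite (_ : _ @^-1` _ = `](a - c) / rho, (b - c) / rho]%classic); last first.
    apply/seteqP; split=> x /=; rewrite !in_itv/= /f;
      by rewrite ltr_pdivrMr// ler_pdivlMr// ltrBlDr lerBrDr mulrC.
  rewrite !lebesgue_measure_itv /= !lte_fin ltr_pM2r ?invr_gt0// ltrD2r.
  case: ltP => _; last by rewrite mule0.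
  by rewrite -!EFinD -EFinM; congr (_%:E); field; rewrite gt_eqF.
by rewrite /nu' /mscale /= muleA -EFinM mulVf ?mul1e// gt_eqF.
Qed.


Lemma ge0_integral_affine (rho c : R) (g : measurableTypeR R -> \bar R) :
  0 < rho -> measurable_fun setT g -> (forall x, 0 <= g x)%E ->
  (\int[lebesgue_measure]_x g (rho * x + c)%R = (rho^-1)%:E * \int[lebesgue_measure]_x g x)%E.
Proof.
move=> rho0 mg g0; pose f := fun x : measurableTypeR R => rho * x + c.
have mf : @measurable_fun _ _ (measurableTypeR R) (measurableTypeR R) setT f.
  by apply: measurable_funD => //; exact: measurable_funM.
pose nu : {measure set (measurableTypeR R) -> \bar R} :=
  measure_function_pushforward__canonical__measure_function_Measure
    (@lebesgue_measure R) mf.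
have rV0 : 0 <= rho^-1 by rewrite invr_ge0 ltW.
pose nu' : {measure set (measurableTypeR R) -> \bar R} :=
  mscale (NngNum rV0) (@lebesgue_measure R).
have E1 : (\int[nu]_x g x = \int[nu']_x g x)%E.
  apply: (@eq_measure_integral _ _ R setT nu' nu g) => A mA _.
  exact: lebesgue_affine.
have := @ge0_integral_pushforward _ _ (measurableTypeR R) (measurableTypeR R) R f mf (@lebesgue_measure R) setT g measurableT mg.
rewrite preimage_setT => H; rewrite -[LHS]H; last by move=> y _; exact: g0.
etransitivity; first exact: E1.
exact: (@ge0_integral_mscale _ _ R lebesgue_measure setT measurableT (NngNum rV0)).
Qed.

Lemma measurable_tcons_pair d (x0 : measurableTypeR R) :
  measurable_fun setT (fun x : tup d => tcons (x0, x)).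
Proof. by apply: measurable_cons => //; exact: measurable_id. Qed.

Lemma tnth_tcons0 d (x0 : measurableTypeR R) (x : tup d) :
  tnth (tcons (x0, x)) ord0 = x0.
Proof. exact: tnth0. Qed.

Lemma tnth_tconsS d (x0 : measurableTypeR R) (x : tup d) i :
  tnth (tcons (x0, x)) (lift ord0 i) = tnth x i.
Proof. exact: tnthS. Qed.

Lemma leb_triangular (rho : R) d (T : tup d -> tup d) : 0 < rho ->
  measurable_fun setT T ->
  (forall (i : 'I_d) (x y : tup d), (forall j : 'I_d, (j < i)%N -> tnth x j = tnth y j :> R) ->
     (tnth (T x) i : R) - rho * tnth x i = (tnth (T y) i : R) - rho * tnth y i) ->
  forall A, measurable A ->
  leb R d (T @^-1` A) = (((rho^-1) ^+ d)%:E * leb R d A)%E.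
Proof.
move=> rho0; elim: d T => [|d IH] T mT hT A mA.
  rewrite expr0 mul1e; congr (leb R 0 _); apply/seteqP; split => x /=;
  by rewrite (tuple0 (T x)) (tuple0 x).
rewrite /= /leb_step /pushforward /product_measure1 /=.
set B := @tcons _ _ d @^-1` A.
have mB : measurable B.
  rewrite -[X in measurable X]setTI; exact: measurable_tcons.
pose z0 : measurableTypeR R := (0 : R).
pose c : R := tnth (T (tcons (z0, nseq_tuple d z0))) ord0.
pose T' x0 x : tup d := [tuple of behead (T (tcons (x0, x)))].
have TE x0 x : T (tcons (x0, x)) = tcons (rho * x0 + c, T' x0 x).
  rewrite (tuple_eta (T _)); congr [tuple of _ :: _].
  have := hT ord0 (tcons (x0, x)) (tcons (z0, nseq_tuple d z0)).
  rewrite !tnth_tcons0 mulr0 subr0 -/c => /(_ _)/= H.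
  by apply/eqP; rewrite addrC -subr_eq; apply/eqP/H.
transitivity (\int[lebesgue_measure]_x
    ((rho^-1 ^+ d)%:E * leb R d (xsection B (rho * x + c)%R)))%E.
  apply: eq_integral => x0 _ /=.
  rewrite -(IH (T' x0)) //; last first.
  - exact: measurable_xsection.
  - move=> i x y H.
    have := hT (lift ord0 i) (tcons (x0, x)) (tcons (x0, y)).
    rewrite !TE !tnth_tconsS; apply => j.
    case: (unliftP ord0 j) => [k ->|->]; last by rewrite !tnth_tcons0.
    by rewrite !tnth_tconsS /= /bump /= !add1n ltnS => /H.
  - apply: (@measurableT_comp _ _ _ _ _ _
      (fun x : tup d.+1 => [tuple of behead x] : tup d) _
      (fun x => T (tcons (x0, x)))); first exact: measurable_behead.
    by apply: (measurableT_comp mT); exact: measurable_tcons_pair.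
  congr (leb R d _); apply/seteqP; split => x /= /xsectionP.
    by rewrite /= TE => ?; exact/xsectionP.
  by move=> H; apply/xsectionP; rewrite /= TE.
rewrite ge0_integralZl//; last 2 first.
- have mg := measurable_fun_xsection (leb R d) mB.
  have mf : @measurable_fun _ _ (measurableTypeR R) (measurableTypeR R) setT
      (fun x => rho * x + c).
    by apply: measurable_funD => //; exact: measurable_funM.
  exact: (measurableT_comp mg mf).
- by rewrite lee_fin exprn_ge0// invr_ge0 ltW.
rewrite (ge0_integral_affine c (g := fun x => leb R d (xsection B x)))//.
- by rewrite muleA -EFinM exprSr.
- exact: measurable_fun_xsection.
Qed.

End lebesgue_tuples.

(* FILE B *)
Section decay.
Context (R : realType).
Local Notation tup d := (d.-tuple (measurableTypeR R)).

Lemma integral_oneDsqr_lty :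
  (\int[@lebesgue_measure R]_x ((1 + x ^+ 2)^-1)%:E < +oo)%E.
Proof.
rewrite (@ge0_symfun_integralT R (fun x => (1 + x ^+ 2)^-1)).
- by rewrite -set_itvcy [X in (_ * X)%E]integral0y_oneDsqr -EFinM ltry.
- by move=> x; rewrite invr_ge0 addr_ge0 // sqr_ge0.
- exact: (@continuous_oneDsqrV R).
- by move=> x /=; rewrite sqrrN.
Qed.

Lemma leb_prod_lty (h : R -> R) d : measurable_fun [set: measurableTypeR R] h ->
  (forall x, 0 <= h x) -> (\int[@lebesgue_measure R]_x (h x)%:E < +oo)%E ->
  (\int[leb R d]_x (\prod_(i < d) h (tnth x i))%:E < +oo)%E.
Proof.
move=> mh h0 hoo; elim: d => [|d IH].
  under eq_integral do rewrite big_ord0.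
  by rewrite integral_cst//= diracE mem_set//= mul1e ltry.
have mprod k : measurable_fun setT (fun x : tup k => (\prod_(i < k) h (tnth x i))%:E).
  apply/measurable_EFinP; apply: measurable_prod => i _.
  by apply: measurableT_comp => //; exact: measurable_tnth.
rewrite /= /leb_step ge0_integral_pushforward//; first last.
- by move=> x _; rewrite lee_fin prodr_ge0.
- exact: (mprod d.+1).
- exact: measurable_tcons.
rewrite preimage_setT.
rewrite fubini_tonelli1//=; last first.
- by move=> x /=; rewrite lee_fin prodr_ge0.
- by apply: (measurableT_comp (mprod d.+1)); exact: measurable_tcons.
set c := (\int[leb R d]_x (\prod_(i < d) h (tnth x i))%:E)%E in IH *.
have c0 : (0 <= c)%E by apply: integral_ge0 => x _; rewrite lee_fin prodr_ge0.
rewrite (_ : (\int[_]_x _ = \int[lebesgue_measure]_x ((h x)%:E * c))%E); last first.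
  apply: eq_integral => x _; rewrite /fubini_F /c -ge0_integralZl//.
  - apply: eq_integral => y _ /=; rewrite big_ord_recl tnth_tcons0.
    rewrite EFinM; congr (_ * (_)%:E)%E.
    by apply: eq_bigr => i _; rewrite tnth_tconsS.
  - exact: (mprod d).
  - by move=> y _; rewrite lee_fin prodr_ge0.
  - by rewrite lee_fin.
rewrite /= ge0_integralZr//=.
- have H0 : (0 <= \int[@lebesgue_measure R]_x (h x)%:E)%E.
    by apply: integral_ge0 => x _; rewrite lee_fin.
  by apply: lte_mul_pinfty => //; rewrite ge0_fin_numE.
- exact/measurable_EFinP.
- by move=> x _; rewrite lee_fin.
Qed.

Lemma decay_integrable d (f : tup d -> R) (M : R) : measurable_fun setT f ->
  (forall x, (1 + `|row_of x|) ^+ (2 * d) * `|f x| <= M) ->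
  (leb R d).-integrable setT (EFin \o f).
Proof.
move=> mf fM.
pose h (x : R) := (1 + x ^+ 2)^-1.
have h0 x : 0 <= h x by rewrite invr_ge0 addr_ge0 // sqr_ge0.
have mh : measurable_fun [set: measurableTypeR R] h.
  by apply: continuous_measurable_fun; exact: continuous_oneDsqrV.
have mprod : measurable_fun setT (fun x : tup d => \prod_(i < d) h (tnth x i)).
  apply: measurable_prod => i _.
  by apply: measurableT_comp => //; exact: measurable_tnth.
have M0 : 0 <= M.
  apply: le_trans (fM (nseq_tuple d (0 : R))).
  by rewrite mulr_ge0 // exprn_ge0 // addr_ge0.
apply: (@le_integrable _ _ _ _ _ measurableT _
    (fun x : tup d => M%:E * (\prod_(i < d) h (tnth x i))%:E)%E).
- exact/measurable_EFinP.
- move=> x _ /=; rewrite lee_fin [leRHS]ger0_norm ?mulr_ge0// ?prodr_ge0//.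
  rewrite -[leLHS]mul1r.
  have p0 : 0 < \prod_(i < d) (1 + (tnth x i : R) ^+ 2).
    by apply: prodr_gt0 => i _; rewrite ltr_wpDr // sqr_ge0.
  rewrite /h prodfV ler_pdivlMr // mul1r mulrC.
  apply: le_trans (fM x); rewrite ler_wpM2r //.
  have -> : (1 + `|row_of x|) ^+ (2 * d) = \prod_(i < d) (1 + `|row_of x|) ^+ 2.
    by rewrite exprM prodr_const card_ord.
  apply: ler_prod => i _; rewrite addr_ge0 ?sqr_ge0 //=.
  have : `|tnth x i : R| <= `|row_of x|.
    by have := ler_coord_norm (row_of x) 0 i; rewrite mxE.
  rewrite -[(tnth x i : R) ^+ 2]real_normK ?num_real//.
  move: `|_| (normr_ge0 (tnth x i : R)) => a a0 ab; nra.
- apply: integrableZl => //; apply/integrableP; split; first exact/measurable_EFinP.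
  apply: le_lt_trans (leb_prod_lty d mh h0 integral_oneDsqr_lty).
  by apply: ge0_le_integral => //=; [exact/measurable_EFinP/measurableT_comp |exact/measurable_EFinP|]
    => x _; rewrite lee_fin ger0_norm// prodr_ge0.
Qed.

Lemma open_leb_gt0 d (U : set 'rV[R]_d) v : open U -> U v ->
  (0 < leb R d (@row_of R d @^-1` U))%E.
Proof.
move=> oU Uv; have /nbhs_ballP[e /= e0 eU] := open_nbhs_nbhs (conj oU Uv).
pose A (i : 'I_d) : set (measurableTypeR R) := `](v 0 i - e), (v 0 i + e)[%classic.
have mA i : measurable (A i) by exact: measurable_itv.
apply: (@lt_le_trans _ _ (leb R d [set x | forall i, A i (tnth x i)])).
  rewrite leb_box//; rewrite (eq_bigr (fun=> (e *+ 2)%:E)); last first.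
    move=> i _; rewrite [LHS]lebesgue_measure_itv/= lte_fin ltrBlDr -addrA ltrDl addr_gt0//.
    by rewrite -EFinD; congr EFin; ring.
  by apply: (big_ind (fun x => 0 < x)%E) => // [x y|]; [exact: mule_gt0|rewrite lte_fin mulrn_wgt0].
apply: le_measure.
- apply/mem_set; rewrite (_ : [set _ | _] = \bigcap_(i in setT) ((fun x : tup d => tnth x i) @^-1` A i)).
    apply: fin_bigcap_measurable => // i _.
    by rewrite -[X in measurable X]setTI; exact: measurable_tnth.
  by apply/seteqP; split => x /= H i => [_|]; exact: H.
- by apply/mem_set; exact: measurable_row_of_open.
- move=> x /= H; apply: eU; split => // i j; rewrite (ord1 i).
  have := H j; rewrite /A /= in_itv/= /ball/= !mxE => /andP[h1 h2].
  by rewrite ltr_norml; apply/andP; split; lra.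
Qed.

Lemma continuous_integral_eq0 d (f : 'rV[R]_d -> R) : continuous f ->
  (forall v, 0 <= f v) -> (\int[leb R d]_x (f (row_of x))%:E = 0)%E ->
  forall v, f v = 0.
Proof.
move=> cf f0 I0 v; apply/eqP/negP => /negP fv; have {}fv : 0 < f v by rewrite lt0r fv f0.
have mf : measurable_fun setT (fun x : tup d => f (row_of x)).
  exact: measurable_row_of_continuous.
pose U := f @^-1` [set y | f v / 2 < y].
have oU : open U by move/continuousP: (cf); apply; exact: open_gt.
have mU : measurable (@row_of R d @^-1` U) by exact: measurable_row_of_open.
have : (0 < (f v / 2)%:E * leb R d (@row_of R d @^-1` U))%E.
  rewrite mule_gt0 ?lte_fin ?divr_gt0//; apply: (@open_leb_gt0 _ U v) => //.
  by rewrite /U/= ltr_pdivrMr// mulr2n mulrDr mulr1 ltrDl.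
rewrite ltNge => /negP; apply; rewrite -I0 -integral_cst//.
apply: (@le_trans _ _ (\int[leb R d]_(x in @row_of R d @^-1` U) (f (row_of x))%:E)%E).
  apply: ge0_le_integral => //=.
  - by move=> x _; rewrite lee_fin divr_ge0.
  - exact/measurable_EFinP/measurable_funTS.
  - by move=> x; rewrite lee_fin /U/= => /ltW.
apply: ge0_subset_integral => //=; first exact/measurable_EFinP.
by move=> x _; rewrite lee_fin.
Qed.

End decay.

(* FILE C *)
Section complex_numbers.
Context (R : realType).
Local Notation C := (Cplx R).
Local Notation Re := (@complex.Re R).
Local Notation Im := (@complex.Im R).
Local Notation normc := (@Normc.normc R).
Implicit Types (z w : C) (x y : R).

Lemma cplx_eq z w : Re z = Re w -> Im z = Im w -> z = w.
Proof. by case: z => a b; case: w => c d /= -> ->. Qed.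

Lemma cReD z w : Re (z + w) = Re z + Re w. Proof. by case: z; case: w. Qed.
Lemma cImD z w : Im (z + w) = Im z + Im w. Proof. by case: z; case: w. Qed.
Lemma cReN z : Re (- z) = - Re z. Proof. by case: z. Qed.
Lemma cImN z : Im (- z) = - Im z. Proof. by case: z. Qed.
Lemma cReM z w : Re (z * w) = Re z * Re w - Im z * Im w.
Proof. by case: z; case: w. Qed.
Lemma cImM z w : Im (z * w) = Re z * Im w + Im z * Re w.
Proof. by case: z; case: w. Qed.
Lemma cReJ z : Re (z^*) = Re z. Proof. by case: z. Qed.
Lemma cImJ z : Im (z^*) = - Im z. Proof. by case: z. Qed.
Lemma cReC x : Re (toC x) = x. Proof. by []. Qed.
Lemma cImC x : Im (toC x) = 0. Proof. by []. Qed.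
Lemma cRe0 : Re (0 : C) = 0. Proof. by []. Qed.
Lemma cIm0 : Im (0 : C) = 0. Proof. by []. Qed.
Lemma cRe1 : Re (1 : C) = 1. Proof. by []. Qed.
Lemma cIm1 : Im (1 : C) = 0. Proof. by []. Qed.
Lemma cRei : Re ('i : C) = 0. Proof. by rewrite -complexiE. Qed.
Lemma cImi : Im ('i : C) = 1. Proof. by rewrite -complexiE. Qed.
Lemma Re_cexp z : Re (cexp z) = expR (Re z) * cos (Im z). Proof. by []. Qed.
Lemma Im_cexp z : Im (cexp z) = expR (Re z) * sin (Im z). Proof. by []. Qed.
#[local] Opaque cexp toC.
Definition cE := (cReD, cImD, cReN, cImN, cReM, cImM, cReJ, cImJ, cReC, cImC, Re_cexp, Im_cexp,
  cRe0, cIm0, cRe1, cIm1, cRei, cImi).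

Lemma cRe_sum I (s : seq I) P (F : I -> C) :
  Re (\sum_(i <- s | P i) F i) = \sum_(i <- s | P i) Re (F i).
Proof. by elim/big_rec2: _ => // i x y _ <-; rewrite cReD. Qed.
Lemma cIm_sum I (s : seq I) P (F : I -> C) :
  Im (\sum_(i <- s | P i) F i) = \sum_(i <- s | P i) Im (F i).
Proof. by elim/big_rec2: _ => // i x y _ <-; rewrite cImD. Qed.

Lemma toCD x y : toC (x + y) = toC x + toC y :> C.
Proof. by apply: cplx_eq; rewrite !cE ?addr0. Qed.
Lemma toCM x y : toC (x * y) = toC x * toC y :> C.
Proof. by apply: cplx_eq; rewrite !cE; ring. Qed.
Lemma toC0 : toC 0 = 0 :> C. Proof. by []. Qed.
Lemma toC1 : toC 1 = 1 :> C. Proof. by []. Qed.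
Lemma toC_conj x : (toC x)^* = toC x :> C.
Proof. by apply: cplx_eq; rewrite !cE ?oppr0. Qed.

Lemma normcE z : normc z = Num.sqrt (Re z ^+ 2 + Im z ^+ 2).
Proof. by case: z. Qed.
Lemma normc_ge0 z : 0 <= normc z. Proof. by rewrite normcE sqrtr_ge0. Qed.
Lemma sqr_normc z : normc z ^+ 2 = Re z ^+ 2 + Im z ^+ 2.
Proof. by rewrite normcE sqr_sqrtr// addr_ge0// sqr_ge0. Qed.
Lemma ler_Re_normc z : `|Re z| <= normc z.
Proof. by rewrite normcE -sqrtr_sqr ler_wsqrtr// lerDl sqr_ge0. Qed.
Lemma ler_Im_normc z : `|Im z| <= normc z.
Proof. by rewrite normcE -sqrtr_sqr ler_wsqrtr// lerDr sqr_ge0. Qed.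
Lemma ler_normc_ReIm z : normc z <= `|Re z| + `|Im z|.
Proof.
rewrite -[leRHS]ger0_norm ?addr_ge0// -sqrtr_sqr normcE ler_wsqrtr//.
rewrite -[Re z ^+ 2]real_normK ?num_real// -[Im z ^+ 2]real_normK ?num_real//.
move: `|Re z| `|Im z| (normr_ge0 (Re z)) (normr_ge0 (Im z)) => a b a0 b0; nra.
Qed.
Lemma normc_conj z : normc (z^*) = normc z.
Proof. by rewrite !normcE !cE sqrrN. Qed.
Lemma normc_toC x : normc (toC x) = `|x|.
Proof. by rewrite normcE !cE expr0n addr0 sqrtr_sqr. Qed.
Lemma norm_cplx z : `|z| = toC (normc z). Proof. by []. Qed.
Lemma normc_eq0 z : normc z = 0 -> z = 0.
Proof. exact: Normc.eq0_normc. Qed.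
Lemma normcM z w : normc (z * w) = normc z * normc w.
Proof. exact: Normc.normcM. Qed.
Lemma ler_normcD z w : normc (z + w) <= normc z + normc w.
Proof. exact: le_normcD. Qed.
Lemma lec_toC x y : (toC x <= toC y :> C) = (x <= y). Proof. exact: lecR. Qed.
Lemma ltc_toC x y : (toC x < toC y :> C) = (x < y). Proof. exact: ltcR. Qed.
Lemma mul_conj z : z * z^* = toC (normc z ^+ 2).
Proof. by rewrite sqr_normc; apply: cplx_eq; rewrite !cE; ring. Qed.

Lemma cexpD z w : cexp (z + w) = cexp z * cexp w.
Proof.
by apply: cplx_eq; rewrite !cE expRD ?cosD ?sinD; ring.
Qed.
Lemma cexp0 : cexp (0 : C) = 1.
Proof.
by apply: cplx_eq; rewrite !cE expR0 ?cos0 ?sin0; ring.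
Qed.
Lemma cexp_conj z : cexp (z^*) = (cexp z)^*.
Proof.
by apply: cplx_eq; rewrite !cE ?cosN ?sinN; ring.
Qed.
Lemma cexp_toC x : cexp (toC x) = toC (expR x).
Proof.
by apply: cplx_eq; rewrite !cE ?cos0 ?sin0; ring.
Qed.
Lemma normc_cexp z : normc (cexp z) = expR (Re z).
Proof.
by rewrite normcE !cE !exprMn -mulrDr cos2Dsin2 mulr1 sqrtr_sqr ger0_norm//.
Qed.

End complex_numbers.

Section complex_integrals.
Context (R : realType).
Local Notation C := (Cplx R).
Local Notation Re := (@complex.Re R).
Local Notation Im := (@complex.Im R).
Local Notation normc := (@Normc.normc R).

Definition cmeasurable d (T : measurableType d) (f : T -> C) :=
  measurable_fun setT (fun x => Re (f x)) /\
  measurable_fun setT (fun x => Im (f x)).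

Definition cintegrable d (T : measurableType d) (mu : set T -> \bar R) (f : T -> C) :=
  mu.-integrable setT (EFin \o (fun x => Re (f x))) /\
  mu.-integrable setT (EFin \o (fun x => Im (f x))).

Section one_space.
Context d (T : measurableType d).
Implicit Types f g : T -> C.

Lemma cmeasurable_toC (h : T -> R) : measurable_fun setT h ->
  cmeasurable (fun x => toC (h x)).
Proof. by move=> mh; split => //=; exact: measurable_cst. Qed.
Lemma cmeasurable_cst (c : C) : cmeasurable (fun _ : T => c).
Proof. by split; exact: measurable_cst. Qed.
Lemma cmeasurableD f g : cmeasurable f -> cmeasurable g ->
  cmeasurable (fun x => f x + g x).
Proof.
move=> [f1 f2] [g1 g2]; split; [under eq_fun do rewrite cReD|under eq_fun do rewrite cImD];
  exact: measurable_funD.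
Qed.
Lemma cmeasurableN f : cmeasurable f -> cmeasurable (fun x => - f x).
Proof.
move=> [f1 f2]; split; [under eq_fun do rewrite cReN|under eq_fun do rewrite cImN];
  exact: measurable_funN.
Qed.
Lemma cmeasurableM f g : cmeasurable f -> cmeasurable g ->
  cmeasurable (fun x => f x * g x).
Proof.
move=> [f1 f2] [g1 g2]; split; [under eq_fun do rewrite cReM|under eq_fun do rewrite cImM].
  by apply: measurable_funB; exact: measurable_funM.
by apply: measurable_funD; exact: measurable_funM.
Qed.
Lemma cmeasurable_conj f : cmeasurable f -> cmeasurable (fun x => (f x)^*).
Proof.
move=> [f1 f2]; split; [under eq_fun do rewrite cReJ|under eq_fun do rewrite cImJ] => //.
exact: measurable_funN.
Qed.
Lemma cmeasurable_sum I (s : seq I) (F : I -> T -> C) :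
  (forall i, cmeasurable (F i)) -> cmeasurable (fun x => \sum_(i <- s) F i x).
Proof.
move=> mF; elim: s => [|i s IH].
  by under eq_fun do rewrite big_nil; exact: cmeasurable_cst.
by under eq_fun do rewrite big_cons; exact: cmeasurableD.
Qed.
Lemma cmeasurable_cexp f : cmeasurable f -> cmeasurable (fun x => cexp (f x)).
Proof.
move=> [f1 f2]; split => /=; apply: measurable_funM.
- exact: measurableT_comp.
- by apply: measurableT_comp => //; apply: continuous_measurable_fun; exact: continuous_cos.
- exact: measurableT_comp.
- by apply: measurableT_comp => //; apply: continuous_measurable_fun; exact: continuous_sin.
Qed.
Lemma measurable_normc f : cmeasurable f -> measurable_fun setT (fun x => normc (f x)).
Proof.
move=> [f1 f2]; under eq_fun do rewrite normcE.
apply: (measurableT_comp (f := @Num.sqrt R)).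
  by apply: continuous_measurable_fun; exact: sqrt_continuous.
by apply: measurable_funD; exact: measurable_funX.
Qed.

End one_space.

Section integrals_one.
Context d (T : measurableType d) (mu : {measure set T -> \bar R}).
Implicit Types f g : T -> C.

Lemma cintegrable_meas f : cintegrable mu f -> cmeasurable f.
Proof.
by move=> [/measurable_int/measurable_EFinP ? /measurable_int/measurable_EFinP].
Qed.

Lemma le_cintegrable f (g : T -> R) : cmeasurable f ->
  (forall x, normc (f x) <= g x) -> mu.-integrable setT (EFin \o g) ->
  cintegrable mu f.
Proof.
move=> [f1 f2] fg ig; split; apply: (le_integrable _ _ _ ig) => //;
  try (exact/measurable_EFinP); move=> x _ /=; rewrite lee_fin;
  apply: (le_trans _ (ler_norm _)); apply: (le_trans _ (fg x)).
- exact: ler_Re_normc.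
- exact: ler_Im_normc.
Qed.

Lemma integrable_normc f : cintegrable mu f ->
  mu.-integrable setT (EFin \o (fun x => normc (f x))).
Proof.
move=> cf; have [f1 f2] := cf.
apply: (@le_integrable _ _ _ mu _ measurableT _
  (EFin \o (fun x => `|Re (f x)| + `|Im (f x)|))).
- by apply/measurable_EFinP/measurable_normc; exact: cintegrable_meas.
- move=> x _ /=; rewrite lee_fin [leLHS]ger0_norm ?normc_ge0// [leRHS]ger0_norm ?addr_ge0//.
  exact: ler_normc_ReIm.
- exact: (integrableD measurableT (integrable_abse f1) (integrable_abse f2)).
Qed.

Lemma le_integrable_cplx f g : cmeasurable f ->
  (forall x, normc (f x) <= normc (g x)) -> cintegrable mu g -> cintegrable mu f.
Proof. by move=> mf fg /integrable_normc; exact: le_cintegrable. Qed.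

Lemma cintegrableZ a f : cintegrable mu f -> cintegrable mu (fun x => a * f x).
Proof.
move=> cf; apply: (@le_cintegrable _ (fun x => normc a * normc (f x))).
- by apply: cmeasurableM; [exact: cmeasurable_cst|exact: cintegrable_meas].
- by move=> x; rewrite normcM.
- exact: (integrableZl measurableT (normc a) (integrable_normc cf)).
Qed.

Lemma cintegrable_conj f : cintegrable mu f -> cintegrable mu (fun x => (f x)^*).
Proof.
move=> cf; apply: (@le_integrable_cplx _ f) => //.
- exact/cmeasurable_conj/cintegrable_meas.
- by move=> x; rewrite normc_conj.
Qed.

Lemma Re_cintegral f : Re (cintegral mu f) = \int[mu]_x Re (f x).
Proof. by []. Qed.
Lemma Im_cintegral f : Im (cintegral mu f) = \int[mu]_x Im (f x).
Proof. by []. Qed.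

#[local] Opaque cintegral cexp toC.

Lemma eq_cintegral f g : f =1 g -> cintegral mu f = cintegral mu g.
Proof. by move=> /funext ->. Qed.

Lemma cintegral0 : cintegral mu (fun=> 0) = 0.
Proof.
apply: cplx_eq; rewrite ?Re_cintegral ?Im_cintegral /=;
by rewrite /Rintegral (_ : (fun x : T => 0%R%:E) = cst 0%E) // integral0.
Qed.

Lemma cintegralZ a f : cintegrable mu f ->
  cintegral mu (fun x => a * f x) = a * cintegral mu f.
Proof.
move=> [f1 f2].
have Z (k : R) (g : T -> R) : mu.-integrable setT (EFin \o g) ->
    mu.-integrable setT (EFin \o (fun x => k * g x)).
  by move=> ig; exact: (integrableZl measurableT k ig).
apply: cplx_eq; rewrite ?cReM ?cImM !(Re_cintegral, Im_cintegral).
- rewrite (@eq_Rintegral _ _ _ _ _ (fun x => Re a * Re (f x) - Im a * Im (f x))).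
    by rewrite RintegralB ?RintegralZl//; exact: Z.
  by move=> x _; rewrite cReM.
- rewrite (@eq_Rintegral _ _ _ _ _ (fun x => Re a * Im (f x) + Im a * Re (f x))).
    by rewrite RintegralD ?RintegralZl//; exact: Z.
  by move=> x _; rewrite cImM.
Qed.

Lemma cintegral_conj f : cintegrable mu f ->
  cintegral mu (fun x => (f x)^*) = (cintegral mu f)^*.
Proof.
move=> [f1 f2]; apply: cplx_eq; rewrite ?cReJ ?cImJ !(Re_cintegral, Im_cintegral).
  by apply: eq_Rintegral => x _; rewrite cReJ.
rewrite -mulN1r -RintegralZl//; apply: eq_Rintegral => x _.
by rewrite cImJ mulN1r.
Qed.

Lemma ler_normc_cintegral f (g : T -> R) : cmeasurable f ->
  (forall x, normc (f x) <= g x) -> mu.-integrable setT (EFin \o g) ->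
  normc (cintegral mu f) <= 2 * \int[mu]_x g x.
Proof.
move=> mf fg ig; have [f1 f2] := le_cintegrable mf fg ig.
apply: le_trans (ler_normc_ReIm _) _; rewrite Re_cintegral Im_cintegral mulr2n mulrDl mul1r.
have H (h : T -> R) : mu.-integrable setT (EFin \o h) -> (forall x, `|h x| <= g x) ->
    `|\int[mu]_x h x| <= \int[mu]_x g x.
  move=> ih hg; apply: le_trans (le_normr_Rintegral _ ih) _ => //.
  by apply: le_Rintegral => //; exact: integrable_norm.
apply: lerD; apply: H => // x; apply: le_trans (fg x).
  exact: ler_Re_normc.
exact: ler_Im_normc.
Qed.

Lemma ge0_integral_preserving (phi : T -> T) (k : T -> \bar R) :
  measurable_fun setT phi ->
  (forall A, measurable A -> mu (phi @^-1` A) = mu A) ->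
  measurable_fun setT k -> (forall x, 0 <= k x)%E ->
  (\int[mu]_x k (phi x) = \int[mu]_x k x)%E.
Proof.
move=> mphi inv mk k0.
have := @ge0_integral_pushforward _ _ T T R phi mphi mu setT k measurableT mk.
rewrite preimage_setT => <-; last by move=> y _; exact: k0.
by apply: eq_measure_integral => A mA _; exact: inv.
Qed.

Lemma Rintegral_preserving (phi : T -> T) (h : T -> R) :
  measurable_fun setT phi ->
  (forall A, measurable A -> mu (phi @^-1` A) = mu A) ->
  measurable_fun setT h -> \int[mu]_x h (phi x) = \int[mu]_x h x.
Proof.
move=> mphi inv mh.
have G k := @ge0_integral_preserving phi k mphi inv.
rewrite /Rintegral; congr fine; rewrite integralE [in RHS]integralE.
congr (_ - _)%E.
- rewrite -(G (fun x => (h x)%:E)^\+%E) ; last 2 first.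
  by apply: measurable_funepos; exact/measurable_EFinP.
  by move=> x; exact: funepos_ge0.
  by apply: eq_integral => x _; rewrite !funeposE.
- rewrite -(G (fun x => (h x)%:E)^\-%E) ; last 2 first.
  by apply: measurable_funeneg; exact/measurable_EFinP.
  by move=> x; exact: funeneg_ge0.
  by apply: eq_integral => x _; rewrite !funenegE.
Qed.

Lemma cintegral_preserving (phi : T -> T) f :
  measurable_fun setT phi ->
  (forall A, measurable A -> mu (phi @^-1` A) = mu A) ->
  cmeasurable f -> cintegral mu (fun x => f (phi x)) = cintegral mu f.
Proof.
move=> mphi inv [f1 f2]; apply: cplx_eq; rewrite !(Re_cintegral, Im_cintegral).
  exact: (Rintegral_preserving mphi inv f1).
exact: (Rintegral_preserving mphi inv f2).
Qed.

End integrals_one.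

Section fubini_cplx.
Context d1 d2 (T1 : measurableType d1) (T2 : measurableType d2).
Variable m1 : {sigma_finite_measure set T1 -> \bar R}.
Variable m2 : {sigma_finite_measure set T2 -> \bar R}.
Variable F : T1 * T2 -> C.

Lemma cmeasurable_cintegral : cmeasurable F ->
  cmeasurable (fun x => cintegral m2 (fun y => F (x, y))).
Proof.
have H (h : T1 * T2 -> R) : measurable_fun setT h ->
    measurable_fun setT (fun x => \int[m2]_y h (x, y)).
  move=> mh; rewrite /Rintegral; apply: measurableT_comp => //.
  under eq_fun do rewrite integralE.
  have mh' : measurable_fun setT (EFin \o h) by exact/measurable_EFinP.
  apply: emeasurable_funB.
  - rewrite (_ : (fun x => _) = fubini_F m2 (EFin \o h)^\+%E); last first.
      apply/funext => x; apply: eq_integral => y _.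
      by rewrite !funeposE.
    apply: measurable_fun_fubini_tonelli_F; first exact: measurable_funepos.
    by move=> x; exact: funepos_ge0.
  - rewrite (_ : (fun x => _) = fubini_F m2 (EFin \o h)^\-%E); last first.
      apply/funext => x; apply: eq_integral => y _.
      by rewrite !funenegE.
    apply: measurable_fun_fubini_tonelli_F; first exact: measurable_funeneg.
    by move=> x; exact: funeneg_ge0.
move=> [F1 F2]; split; [under eq_fun do rewrite Re_cintegral|
  under eq_fun do rewrite Im_cintegral].
  exact: (H (fun z => Re (F z))).
exact: (H (fun z => Im (F z))).
Qed.

Lemma cFubini : cintegrable (m1 \x m2)%E F ->
  (forall x, cintegrable m2 (fun y => F (x, y))) ->
  (forall y, cintegrable m1 (fun x => F (x, y))) ->
  cintegral m1 (fun x => cintegral m2 (fun y => F (x, y))) =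
  cintegral m2 (fun y => cintegral m1 (fun x => F (x, y))).
Proof.
have H (h : T1 * T2 -> R) : (m1 \x m2)%E.-integrable setT (EFin \o h) ->
    (forall x, m2.-integrable setT (EFin \o (fun y => h (x, y)))) ->
    (forall y, m1.-integrable setT (EFin \o (fun x => h (x, y)))) ->
    \int[m1]_x (\int[m2]_y h (x, y)) = \int[m2]_y (\int[m1]_x h (x, y)).
  move=> ih i1 i2; rewrite /Rintegral; congr fine.
  transitivity (\int[m1]_x \int[m2]_y (EFin \o h) (x, y))%E.
    by apply: eq_integral => x _; rewrite fineK//; exact: (integrable_fin_num _ (i1 x)).
  rewrite Fubini//; apply: eq_integral => y _; rewrite fineK//.
  exact: (integrable_fin_num _ (i2 y)).
move=> [F1 F2] i1 i2; apply: cplx_eq; rewrite !(Re_cintegral, Im_cintegral).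
  by apply: (H _ F1) => [x|y]; [have [] := i1 x|have [] := i2 y].
by apply: (H _ F2) => [x|y]; [have [] := i1 x|have [] := i2 y].
Qed.

End fubini_cplx.

End complex_integrals.

(* FILE D *)
Section heisenberg.
Context (R : realType) (n m r : nat) (D : siegel_data R n m r).
Local Notation C := (Cplx R).
Local Notation Re := (@complex.Re R).
Local Notation Im := (@complex.Im R).
Local Notation normc := (@Normc.normc R).
Local Notation tup d := (d.-tuple (measurableTypeR R)).
Local Notation N := ('cV[C]_n * 'cV[R]_m)%type.
Hypothesis hPhi : Phi_hermitian D.
Local Notation Phi := (Phi D).

Definition tup_of d (v : 'rV[R]_d) : tup d := [tuple (v 0 i : measurableTypeR R) | i < d].

Lemma row_ofK d (v : 'rV[R]_d) : row_of (tup_of v) = v.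
Proof. by apply/rowP => i; rewrite mxE tnth_mktuple. Qed.

Lemma tup_ofK d (x : tup d) : tup_of (row_of x) = x.
Proof. by apply/eq_from_tnth => i; rewrite tnth_mktuple mxE. Qed.

Definition vecE (z : 'cV[C]_n) : 'rV[R]_(n + n) :=
  row_mx (\row_j Re (z j 0)) (\row_j Im (z j 0)).

Lemma E_ofE (v : 'rV[R]_(n + n)) j :
  E_of v j 0 = (v 0 (lshift n j) +i* v 0 (rshift n j))%C.
Proof. by rewrite mxE. Qed.

Lemma E_ofK (v : 'rV[R]_(n + n)) : vecE (E_of v) = v.
Proof.
apply/rowP => i; rewrite mxE; case: split_ordP => j ->; by rewrite !mxE.
Qed.

Lemma vecEK z : E_of (vecE z) = z.
Proof.
apply/colP => j; rewrite E_ofE; apply: cplx_eq => /=.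
  by rewrite row_mxEl mxE.
by rewrite row_mxEr mxE.
Qed.

Definition vecN (y : N) : 'rV[R]_(n + n + m) := row_mx (vecE y.1) y.2^T.

Lemma vecNK y : N_of (vecN y) = y.
Proof.
by case: y => z x; rewrite /N_of /vecN /= row_mxKl row_mxKr vecEK trmxK.
Qed.

Lemma N_ofK v : vecN (N_of v) = v.
Proof. by rewrite /vecN /N_of /= E_ofK trmxK hsubmxK. Qed.

Lemma PhiDl z z' w : Phi (z + z') w = Phi z w + Phi z' w.
Proof. by case: hPhi => H _; rewrite -[z]scale1r H !scale1r. Qed.
Lemma Phi0l w : Phi 0 w = 0.
Proof. by apply: (addIr (Phi 0 w)); rewrite -PhiDl !add0r. Qed.
Lemma PhiZl a z w : Phi (a *: z) w = a *: Phi z w.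
Proof. by case: hPhi => H _; rewrite -[_ *: z]addr0 H Phi0l addr0. Qed.
Lemma PhiC z w : Phi w z = map_mx Num.conj (Phi z w).
Proof. by case: hPhi. Qed.
Lemma PhiDr z w w' : Phi z (w + w') = Phi z w + Phi z w'.
Proof. by rewrite PhiC PhiDl map_mxD -!PhiC. Qed.
Lemma PhiZr a z w : Phi z (a *: w) = a^* *: Phi z w.
Proof. by rewrite PhiC PhiZl map_mxZ -!PhiC. Qed.
Lemma PhiNl z w : Phi (- z) w = - Phi z w.
Proof. by rewrite -scaleN1r PhiZl scaleN1r. Qed.
Lemma Phi0r w : Phi w 0 = 0.
Proof. by apply: (addIr (Phi w 0)); rewrite -PhiDr !add0r. Qed.
Lemma PhiNr z w : Phi z (- w) = - Phi z w.
Proof. by apply/eqP; rewrite -addr_eq0 -PhiDr addNr Phi0r. Qed.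

Lemma Phi_suml I (s : seq I) (F : I -> 'cV[C]_n) w :
  Phi (\sum_(i <- s) F i) w = \sum_(i <- s) Phi (F i) w.
Proof.
elim: s => [|i s IH]; first by rewrite !big_nil Phi0l.
by rewrite !big_cons PhiDl IH.
Qed.
Lemma Phi_sumr I (s : seq I) (F : I -> 'cV[C]_n) w :
  Phi w (\sum_(i <- s) F i) = \sum_(i <- s) Phi w (F i).
Proof.
elim: s => [|i s IH]; first by rewrite !big_nil Phi0r.
by rewrite !big_cons PhiDr IH.
Qed.

Lemma cV_delta (z : 'cV[C]_n) : z = \sum_j z j 0 *: delta_mx j 0.
Proof. by rewrite [LHS]matrix_sum_delta; apply: eq_bigr => i _; rewrite big_ord1. Qed.

Lemma PhiE z w i : Phi z w i 0 =
  \sum_j \sum_k (z j 0 * (w k 0)^*) * Phi (delta_mx j 0) (delta_mx k 0) i 0.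
Proof.
rewrite {1}(cV_delta z) Phi_suml summxE; apply: eq_bigr => j _.
rewrite {1}(cV_delta w) Phi_sumr summxE; apply: eq_bigr => k _.
by rewrite PhiZl PhiZr !mxE mulrA.
Qed.

Definition Nmeasurable d (T : measurableType d) (F : T -> N) :=
  (forall j, cmeasurable (fun t => (F t).1 j 0)) /\
  (forall k, measurable_fun setT (fun t => (F t).2 k 0)).

Lemma Nmeasurable_tup d (T : measurableType d) (F : T -> N) : Nmeasurable F ->
  measurable_fun setT (fun t => tup_of (vecN (F t))).
Proof.
move=> [F1 F2]; apply/measurable_fun_tnthP => i /=.
rewrite (_ : _ \o _ = fun t => vecN (F t) 0 i); last first.
  by apply/funext => t /=; rewrite tnth_mktuple.
case: (split_ordP i) => j ->; last first.
  by under eq_fun do rewrite row_mxEr mxE; exact: F2.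
under eq_fun do rewrite row_mxEl.
case: (split_ordP j) => k ->.
  under eq_fun do rewrite row_mxEl mxE; exact: (F1 k).1.
under eq_fun do rewrite row_mxEr mxE; exact: (F1 k).2.
Qed.

Lemma Nmeasurable_comp d (T : measurableType d) (F : T -> N) (f : N -> C) :
  Nmeasurable F -> cmeasurable (fun x : tup (n + n + m) => f (N_of (row_of x))) ->
  cmeasurable (fun t => f (F t)).
Proof.
move=> mF [f1 f2]; have mt := Nmeasurable_tup mF; split.
- have := measurableT_comp f1 mt; congr measurable_fun.
  by apply/funext => t /=; rewrite row_ofK vecNK.
- have := measurableT_comp f2 mt; congr measurable_fun.
  by apply/funext => t /=; rewrite row_ofK vecNK.
Qed.

Lemma cmeasurable_E_of d (T : measurableType d) (F : T -> tup (n + n)) j :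
  measurable_fun setT F -> cmeasurable (fun t => E_of (row_of (F t)) j 0).
Proof.
move=> mF; split; under eq_fun do rewrite E_ofE /= mxE;
  by apply: (measurableT_comp (f := fun x : tup _ => tnth x _)) => //; exact: measurable_tnth.
Qed.

Lemma Nmeasurable_N_of d (T : measurableType d) (F : T -> tup (n + n + m)) :
  measurable_fun setT F -> Nmeasurable (fun t => N_of (row_of (F t))).
Proof.
have mx i : measurable_fun setT (fun x : tup (n + n + m) => tnth x i).
  exact: measurable_tnth.
move=> mF; split => [j|k] /=.
- by split; under eq_fun do rewrite E_ofE /= !mxE; exact: (measurableT_comp (mx _) mF).
- by under eq_fun do rewrite !mxE; exact: (measurableT_comp (mx _) mF).
Qed.

Lemma cmeasurable_Phi d (T : measurableType d) (F G : T -> 'cV[C]_n) i :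
  (forall j, cmeasurable (fun t => F t j 0)) ->
  (forall j, cmeasurable (fun t => G t j 0)) ->
  cmeasurable (fun t => Phi (F t) (G t) i 0).
Proof.
move=> mF mG; under eq_fun do rewrite PhiE.
apply: cmeasurable_sum => j; apply: cmeasurable_sum => k.
apply: cmeasurableM; last exact: cmeasurable_cst.
by apply: cmeasurableM => //; exact: cmeasurable_conj.
Qed.

Lemma cmeasurable_pairingC d (T : measurableType d) lam (F : T -> 'cV[C]_m) :
  (forall i, cmeasurable (fun t => F t i 0)) ->
  cmeasurable (fun t => pairingC lam (F t)).
Proof.
move=> mF; rewrite /pairingC; under eq_fun do rewrite mxE.
apply: cmeasurable_sum => j; apply: cmeasurableM => //; exact: cmeasurable_cst.
Qed.

Lemma Nmeasurable_mul d (T : measurableType d) (F G : T -> N) :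
  Nmeasurable F -> Nmeasurable G -> Nmeasurable (fun t => mulN D (F t) (G t)).
Proof.
move=> [F1 F2] [G1 G2]; split => [j|k] /=.
  by under eq_fun do rewrite mxE; exact: cmeasurableD.
under eq_fun do rewrite !mxE.
apply: measurable_funD; first exact: measurable_funD.
apply: measurable_funM => //; exact: (cmeasurable_Phi k F1 G1).2.
Qed.

Lemma Nmeasurable_inv d (T : measurableType d) (F : T -> N) :
  Nmeasurable F -> Nmeasurable (fun t => invN (F t)).
Proof.
move=> [F1 F2]; split => [j|k] /=; under eq_fun do rewrite mxE.
  exact: cmeasurableN.
exact: measurable_funN.
Qed.


Lemma mulNVK y z : mulN D (mulN D y (invN z)) z = y.
Proof.
case: y => a x; case: z => b x'; rewrite /mulN /invN /=; congr pair; first by rewrite addrNK.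
have I z : map_mx Im (Phi z z) = 0.
  apply/matrixP => i j; rewrite !mxE.
  have := congr1 (fun M : 'cV[C]_m => Im (M i j)) (PhiC z z).
  rewrite mxE cImJ => H; lra.
have E : map_mx Im (Phi (a - b) b) = map_mx Im (Phi a b).
  rewrite PhiDl PhiNl; apply/matrixP => i j; rewrite !mxE cImD cImN.
  by move/matrixP: (I b) => /(_ i j); rewrite !mxE => ->; rewrite subr0.
have E' : map_mx Im (Phi a (- b)) = - map_mx Im (Phi a b).
  by rewrite PhiNr; apply/matrixP => i j; rewrite !mxE cImN.
by rewrite E E'; apply/matrixP => i j; rewrite !mxE; ring.
Qed.

Lemma invNK (z : N) : invN (invN z) = z.
Proof. by case: z => a b; rewrite /invN /= !opprK. Qed.

Lemma mulNK y z : mulN D (mulN D y z) (invN z) = y.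
Proof. by rewrite -{1}[z]invNK mulNVK. Qed.

Definition rtrans (w : N) (x : tup (n + n + m)) : tup (n + n + m) :=
  tup_of (vecN (mulN D (N_of (row_of x)) w)).

Lemma N_of_rtrans w x : N_of (row_of (rtrans w x)) = mulN D (N_of (row_of x)) w.
Proof. by rewrite row_ofK vecNK. Qed.

Lemma measurable_rtrans w : measurable_fun setT (rtrans w).
Proof.
apply: Nmeasurable_tup; apply: Nmeasurable_mul.
  by apply: (@Nmeasurable_N_of _ _ (fun x => x)); exact: measurable_id.
split => [j|k]; [exact: cmeasurable_cst|exact: measurable_cst].
Qed.

Lemma leb_rtrans w A : measurable A -> leb R _ (rtrans w @^-1` A) = leb R _ A.
Proof.
move=> mA; rewrite (@leb_triangular R 1 _ (rtrans w))//.
- by rewrite invr1 expr1n mul1e.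
- exact: measurable_rtrans.
move=> i x y xy; rewrite !mul1r !tnth_mktuple.
case: (split_ordP i) xy => j -> xy; last first.
  rewrite !row_mxEr !mxE.
  have -> : (N_of (row_of x)).1 = (N_of (row_of y)).1.
    rewrite /=; apply/colP => k; rewrite !E_ofE !mxE !(xy (lshift m _))//=;
    by rewrite -addnA ?ltn_add2l ltn_addr.
  by rewrite /=; ring.
rewrite !row_mxEl; case: (split_ordP j) => k ->.
  by rewrite !row_mxEl !mxE !cReD /=; ring.
by rewrite !row_mxEr !mxE !cImD /=; ring.
Qed.

Lemma integralN_rtrans w (f : N -> C) :
  cmeasurable (fun x : tup (n + n + m) => f (N_of (row_of x))) ->
  Defs.integralN (fun y => f (mulN D y w)) = Defs.integralN f.
Proof.
move=> mf; rewrite /Defs.integralN.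
rewrite -(@cintegral_preserving R _ _ (leb R _) (rtrans w) _ (measurable_rtrans w) (@leb_rtrans w) mf).
by apply: eq_cintegral => x /=; rewrite N_of_rtrans.
Qed.

Lemma vecE_norm (z : 'cV[C]_n) j : normc (z j 0) <= 2 * `|vecE z|.
Proof.
apply: le_trans (ler_normc_ReIm _) _; rewrite mulr2n mulrDl mul1r; apply: lerD.
  by have := ler_coord_norm (vecE z) 0 (lshift n j); rewrite row_mxEl mxE.
by have := ler_coord_norm (vecE z) 0 (rshift n j); rewrite row_mxEr mxE.
Qed.

Lemma vecN_norm1 (y : N) : `|vecE y.1| <= `|vecN y|.
Proof.
apply: ler_norm_coord => // i j; rewrite ord1.
by have := ler_coord_norm (vecN y) 0 (lshift m j); rewrite row_mxEl.
Qed.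

Lemma vecN_norm2 (y : N) k : `|y.2 k 0| <= `|vecN y|.
Proof.
by have := ler_coord_norm (vecN y) 0 (rshift (n + n) k); rewrite row_mxEr mxE.
Qed.

Lemma Phi_bound : exists2 K, 0 <= K & forall z w i,
  normc (Phi z w i 0) <= K * `|vecE z| * `|vecE w|.
Proof.
pose K := \sum_i \sum_j \sum_k 4 * normc (Phi (delta_mx j 0) (delta_mx k 0) i 0).
have p0 i : 0 <= \sum_j \sum_k 4 * normc (Phi (delta_mx j 0) (delta_mx k 0) i 0).
  by do 2 (apply: sumr_ge0 => ? _); rewrite mulr_ge0// normc_ge0.
exists K; first by apply: sumr_ge0 => i _.
move=> z w i; rewrite PhiE.
have S (I : finType) (F : I -> C) : normc (\sum_i F i) <= \sum_i normc (F i).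
  elim/big_ind2: _ => //; first by rewrite Normc.normc0.
  by move=> a b c e h1 h2; apply: le_trans (ler_normcD _ _) _; exact: lerD.
apply: le_trans (S _ _) _.
apply: (@le_trans _ _ (\sum_j \sum_k (4 * normc (Phi (delta_mx j 0) (delta_mx k 0) i 0)) * `|vecE z| * `|vecE w|)).
  apply: ler_sum => j _; apply: le_trans (S _ _) _; apply: ler_sum => k _.
  rewrite !normcM normc_conj; have := vecE_norm z j; have := vecE_norm w k.
  move=> hw hz; have hzw := ler_pM (normc_ge0 _) (normc_ge0 _) hz hw.
  apply: le_trans (ler_wpM2r (normc_ge0 _) hzw) _.
  by rewrite le_eqVlt; apply/orP; left; apply/eqP; ring.
under eq_bigr do rewrite -mulr_suml -mulr_suml.
rewrite -mulr_suml -mulr_suml; do 2 apply: ler_wpM2r => //.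
by rewrite /K (bigD1 i) //= lerDl sumr_ge0.
Qed.

Definition japN (y : N) : R := 1 + `|vecN y|.

Lemma japN_ge1 y : 1 <= japN y. Proof. by rewrite lerDl. Qed.
Lemma japN_gt0 y : 0 < japN y. Proof. exact: lt_le_trans (japN_ge1 y). Qed.

Lemma japN_mul : exists2 B, 0 < B & forall y z, japN (mulN D y z) <= B * japN y * japN z.
Proof.
have [K K0 HK] := Phi_bound; exists (1 + 2 * K); first by rewrite ltr_wpDr// mulr_ge0.
move=> y z; rewrite /japN.
have : `|vecN (mulN D y z)| <= `|vecN y| + `|vecN z| + 2 * K * `|vecN y| * `|vecN z|.
  have a0 := normr_ge0 (vecN y); have b0 := normr_ge0 (vecN z).
  have p0 : 0 <= 2 * K * `|vecN y| * `|vecN z| by rewrite !mulr_ge0.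
  apply: ler_norm_coord; first by rewrite !addr_ge0.
  move=> i j; rewrite (ord1 i); case: (split_ordP j) => k ->.
    rewrite row_mxEl; have -> : vecE (mulN D y z).1 = vecE y.1 + vecE z.1.
      apply/rowP => l; rewrite [RHS]mxE; case: (split_ordP l) => q ->.
        by rewrite !row_mxEl !mxE cReD.
      by rewrite !row_mxEr !mxE cImD.
    apply: le_trans (ler_coord_norm _ _ _) _; apply: le_trans (ler_normD _ _) _.
    have := vecN_norm1 y; have := vecN_norm1 z; lra.
  rewrite row_mxEr !mxE; apply: le_trans (ler_normD _ _) _.
  apply: lerD; first by apply: le_trans (ler_normD _ _) _; apply: lerD; exact: vecN_norm2.
  rewrite normrM ger0_norm// -!mulrA ler_pM2l//.
  apply: le_trans (ler_Im_normc _) _; apply: le_trans (HK _ _ _) _.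
  rewrite -mulrA; apply: ler_wpM2l => //; apply: ler_pM => //; exact: vecN_norm1.
move: (normr_ge0 (vecN y)) (normr_ge0 (vecN z)); move: `|vecN y| `|vecN z| => a b a0 b0 H.
apply: (@le_trans _ _ (1 + (a + b + 2 * K * a * b))); first by rewrite lerD2l.
rewrite -subr_ge0 (_ : _ - _ = a * b + 2 * K * (1 + a + b)); last by ring.
by rewrite addr_ge0 ?mulr_ge0 // !addr_ge0.
Qed.

End heisenberg.

(* FILE E *)
Section rapid.
Context (R : realType) (n m r : nat) (D : siegel_data R n m r).
Local Notation C := (Cplx R).
Local Notation normc := (@Normc.normc R).
Local Notation tup d := (d.-tuple (measurableTypeR R)).
Local Notation N := ('cV[C]_n * 'cV[R]_m)%type.
Hypothesis hPhi : Phi_hermitian D.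
Local Notation Phi := (Phi D).
Local Notation dd := (n + n + m)%N.
Implicit Types (f g : N -> C) (y z : N).

Definition Nlift T (f : N -> T) := fun x : tup dd => f (N_of (row_of x)).

Definition rapid f := cmeasurable (Nlift f) /\
  forall k, exists M, forall y, japN y ^+ k * normc (f y) <= M.

Lemma japN_ge0 y : 0 <= japN y. Proof. exact/ltW/japN_gt0. Qed.

Lemma japN_lift (x : tup dd) : japN (N_of (row_of x)) = 1 + `|row_of x|.
Proof. by rewrite /japN N_ofK. Qed.

Lemma measurable_japN k : measurable_fun setT (Nlift (fun y => japN y ^+ k)).
Proof.
apply: measurable_funX; rewrite (_ : (fun x => _) = fun x : tup dd => 1 + `|row_of x|); last first.
  by apply/funext => x; rewrite japN_lift.
apply: measurable_funD => //; apply: measurable_row_of_continuous.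
exact: norm_continuous.
Qed.

Lemma rapid_integrable f k : rapid f ->
  (leb R dd).-integrable setT (EFin \o Nlift (fun y => japN y ^+ k * normc (f y))).
Proof.
move=> [mf fM]; have [M HM] := fM (2 * dd + k)%N.
apply: (@decay_integrable R dd _ M) => [|x].
  by apply: measurable_funM; [exact: measurable_japN|exact: measurable_normc].
rewrite /Nlift -japN_lift ger0_norm ?mulr_ge0 ?normc_ge0 ?exprn_ge0 ?japN_ge0//.
rewrite mulrA -exprD; exact: HM.
Qed.

Lemma rapid_cintegrable f : rapid f -> cintegrable (leb R dd) (Nlift f).
Proof.
move=> rf; apply: (le_cintegrable rf.1 _ (rapid_integrable 0 rf)) => x.
by rewrite /Nlift expr0 mul1r.
Qed.

Lemma Nmeasurable_div d (T : measurableType d) (F G : T -> N) :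
  Nmeasurable F -> Nmeasurable G -> Nmeasurable (fun t => mulN D (F t) (invN (G t))).
Proof. by move=> mF mG; apply: Nmeasurable_mul => //; exact: Nmeasurable_inv. Qed.

Lemma cmeasurable_conv_integrand f g y : rapid f -> rapid g ->
  cmeasurable (Nlift (fun z => f (mulN D y (invN z)) * g z)).
Proof.
move=> [mf _] [mg _]; apply: cmeasurableM => //.
apply: (@Nmeasurable_comp _ _ _ _ _ (fun t => mulN D y (invN (N_of (row_of t)))) f _ mf).
apply: Nmeasurable_div; first by split => j; [exact: cmeasurable_cst|exact: measurable_cst].
by apply: (@Nmeasurable_N_of _ _ _ _ _ (fun x => x)); exact: measurable_id.
Qed.

Lemma rapid_conv f g : rapid f -> rapid g -> rapid (Defs.convN D f g).
Proof.
move=> rf rg; split.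
  rewrite /Nlift /Defs.convN /Defs.integralN.
  apply: (@cmeasurable_cintegral R _ _ _ _ (leb R dd)
    (fun p : tup dd * tup dd => f (mulN D (N_of (row_of p.1)) (invN (N_of (row_of p.2)))) *
      g (N_of (row_of p.2)))).
  have m1 : Nmeasurable (fun p : tup dd * tup dd => N_of (row_of p.1) : N).
    exact: Nmeasurable_N_of.
  have m2 : Nmeasurable (fun p : tup dd * tup dd => N_of (row_of p.2) : N).
    exact: Nmeasurable_N_of.
  apply: cmeasurableM.
    by apply: (Nmeasurable_comp _ rf.1); exact: Nmeasurable_div.
  by apply: (Nmeasurable_comp _ rg.1).
move=> k; have [B B0 HB] := japN_mul hPhi.
have [M HM] := rf.2 k.
set G := Nlift (fun y => japN y ^+ k * normc (g y)).
exists (2 * (B ^+ k * M * \int[leb R dd]_x G x)) => y.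
have jk0 : 0 < japN y ^+ k by rewrite exprn_gt0 ?japN_gt0.
rewrite mulrC -ler_pdivlMr//.
have ig : (leb R dd).-integrable setT (EFin \o (fun x => B ^+ k * M / japN y ^+ k * G x)).
  exact: (integrableZl measurableT (B ^+ k * M / japN y ^+ k) (rapid_integrable k rg)).
apply: le_trans (ler_normc_cintegral (cmeasurable_conv_integrand y rf rg) _ ig) _.
  move=> x; rewrite normcM /G /Nlift; move: (N_of (row_of x)) => z.
  rewrite mulrA; apply: ler_wpM2r; first exact: normc_ge0.
  rewrite mulrAC ler_pdivlMr//.
  have h1 : japN y ^+ k <= B ^+ k * japN (mulN D y (invN z)) ^+ k * japN z ^+ k.
    rewrite -!exprMn; apply: lerXn2r; rewrite ?nnegrE ?mulr_ge0 ?japN_ge0// ?(ltW B0)//.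
    by have := HB (mulN D y (invN z)) z; rewrite mulNVK.
  apply: le_trans (ler_wpM2l (normc_ge0 _) h1) _.
  have h3 : 0 <= B ^+ k * japN z ^+ k by rewrite mulr_ge0 ?exprn_ge0 ?japN_ge0 ?ltW.
  have h2 := ler_wpM2l h3 (HM (mulN D y (invN z))).
  have -> : normc (f (mulN D y (invN z))) * (B ^+ k * japN (mulN D y (invN z)) ^+ k * japN z ^+ k) =
    B ^+ k * japN z ^+ k * (japN (mulN D y (invN z)) ^+ k * normc (f (mulN D y (invN z)))) by ring.
  apply: le_trans h2 _.
  by rewrite [leLHS](_ : _ = B ^+ k * M * japN z ^+ k) //; ring.
rewrite RintegralZl//; last exact: rapid_integrable.
by rewrite le_eqVlt; apply/orP; left; apply/eqP; field; rewrite gt_eqF ?japN_gt0.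
Qed.

Lemma rapid0 : rapid (fun=> 0).
Proof.
split; first exact: cmeasurable_cst.
by move=> k; exists 0 => y; rewrite Normc.normc0 mulr0.
Qed.

Lemma rapid_LpN_lty f (p : \bar R) : rapid f -> (0 < p)%E -> (LpN p f < +oo)%E.
Proof.
move=> rf; rewrite /LpN unlock; case: p => [p||//].
- rewrite lte_fin => p0; apply: poweR_lty.
  pose k := Num.truncn ((2 * dd)%:R / p)%R.
  have kp : ((2 * dd)%:R <= p * k.+1%:R)%R.
    by rewrite mulrC -ler_pdivrMr// ltW// truncnS_gt.
  have [M HM] := rf.2 k.+1.
  have M0 : 0 <= M.
    by apply: le_trans (HM (0, 0)); rewrite mulr_ge0 ?normc_ge0 ?exprn_ge0 ?japN_ge0.
  have mp : measurable_fun setT (fun x : tup dd => normc (f (N_of (row_of x))) `^ p).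
    exact: (measurableT_comp (measurable_powR p) (measurable_normc rf.1)).
  have bd (x : tup dd) : (1 + `|row_of x|) ^+ (2 * dd) *
      `|normc (f (N_of (row_of x))) `^ p| <= M `^ p.
    rewrite ger0_norm ?powR_ge0// -japN_lift; move: (N_of (row_of x)) => y.
    apply: (@le_trans _ _ ((japN y ^+ k.+1 * normc (f y)) `^ p)); last first.
      by apply: ge0_ler_powR => //; rewrite ?nnegrE ?mulr_ge0 ?normc_ge0 ?exprn_ge0 ?japN_ge0 ?ltW.
    rewrite powRM ?normc_ge0 ?exprn_ge0 ?japN_ge0//; apply: ler_wpM2r; first exact: powR_ge0.
    rewrite -!powR_mulrn ?japN_ge0// -powRrM ler_powR ?japN_ge1//.
    by rewrite mulrC.
  have /integrableP[_] := decay_integrable mp bd.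
  apply: le_lt_trans => //=.
  rewrite le_eqVlt; apply/orP; left; apply/eqP; apply: eq_integral => x _ /=.
  by rewrite !ger0_norm ?powR_ge0 ?normc_ge0.
- move=> _; case: ifPn => // _.
  have [M HM] := rf.2 0%N.
  apply: (@le_lt_trans _ _ M%:E); last exact: ltry.
  apply/ess_supP; apply: nearW => x /=; rewrite lee_fin ger0_norm ?normc_ge0//.
  by have := HM (N_of (row_of x)); rewrite expr0 mul1r.
Qed.

Lemma LpN_gt0 f (kf : N -> C) (p : \bar R) : rapid f -> cmeasurable (Nlift kf) ->
  (0 < p)%E -> Defs.integralN (fun y => f y * kf y) != 0 -> (0 < LpN p f)%E.
Proof.
move=> rf mk p0 I0; rewrite lt0e Lnorm_ge0 andbT; apply/eqP => L0.
move/eqP: I0; apply.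
have mn : measurable_fun setT (fun x : tup dd => (normc (f (N_of (row_of x))))%:E).
  by apply/measurable_EFinP; exact: (measurable_normc rf.1).
have := Lnorm_eq0_eq0 mn p0 L0 => ae0.
have H (h : tup dd -> R) : measurable_fun setT h ->
    (forall x, f (N_of (row_of x)) = 0 -> h x = 0) -> \int[leb R dd]_x h x = 0.
  move=> mh hf; rewrite /Rintegral (_ : (\int[_]_x _)%E = (\int[leb R dd]_x 0)%E).
    by rewrite integral0.
  apply: ae_eq_integral => //; first exact/measurable_EFinP.
  by apply: filterS ae0 => x /= H0 _; have [] := H0 I => /normc_eq0 /hf ->.
have [m1 m2] := cmeasurableM rf.1 mk.
rewrite /Defs.integralN; apply: cplx_eq; rewrite (Re_cintegral, Im_cintegral).
  by rewrite H// => x ->; rewrite mul0r.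
by rewrite H// => x ->; rewrite mul0r.
Qed.

End rapid.

(* FILE F *)
Section fock.
Context (R : realType) (n m r : nat) (D : siegel_data R n m r).
Local Notation C := (Cplx R).
Local Notation Re := (@complex.Re R).
Local Notation Im := (@complex.Im R).
Local Notation normc := (@Normc.normc R).
Local Notation tup d := (d.-tuple (measurableTypeR R)).
Local Notation E := 'cV[C]_n.
Local Notation N := ('cV[C]_n * 'cV[R]_m)%type.
Hypothesis hPhi : Phi_hermitian D.
Local Notation Phi := (Phi D).
Local Notation dd := (n + n + m)%N.
Variable lam : 'rV[R]_m.
Implicit Types (z w : E) (y : N) (u v : E -> C).

Lemma pairingCD a b : pairingC lam (a + b) = pairingC lam a + pairingC lam b.
Proof. by rewrite /pairingC mulmxDr mxE. Qed.
Lemma pairingCZ c a : pairingC lam (c *: a) = c * pairingC lam a.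
Proof. by rewrite /pairingC -scalemxAr mxE. Qed.
Lemma pairingCN a : pairingC lam (- a) = - pairingC lam a.
Proof. by rewrite /pairingC mulmxN mxE. Qed.
Lemma pairingC_toC x : pairingC lam (map_mx toC x) = toC (pairing lam x) :> C.
Proof.
rewrite /pairingC /pairing !mxE (big_morph (toC : R -> C) (@toCD R) (@toC0 R)).
by apply: eq_bigr => j _; rewrite !mxE toCM.
Qed.
Lemma pairingC_conj a : pairingC lam (map_mx Num.conj a) = (pairingC lam a)^* :> C.
Proof.
rewrite /pairingC !mxE rmorph_sum; apply: eq_bigr => j _.
by rewrite !mxE rmorphM /= toC_conj.
Qed.

Lemma cconjM (a b : C) : (a * b)^* = a^* * b^*.
Proof. by rewrite rmorphM. Qed.

Definition L w z : C := pairingC lam (Phi w z).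
Definition q z : R := Re (L z z).

Lemma LDl w w' z : L (w + w') z = L w z + L w' z.
Proof. by rewrite /L PhiDl// pairingCD. Qed.
Lemma LDr w z z' : L w (z + z') = L w z + L w z'.
Proof. by rewrite /L PhiDr// pairingCD. Qed.
Lemma LNl w z : L (- w) z = - L w z.
Proof. by rewrite /L PhiNl// pairingCN. Qed.
Lemma LNr w z : L w (- z) = - L w z.
Proof. by rewrite /L PhiNr// pairingCN. Qed.
Lemma LC w z : L z w = (L w z)^*.
Proof. by rewrite /L PhiC// pairingC_conj. Qed.
Lemma Lzz z : L z z = toC (q z).
Proof.
apply: cplx_eq => //; have := congr1 Im (LC z z); rewrite cImJ cImC => H; lra.
Qed.
Lemma qN z : q (- z) = q z. Proof. by rewrite /q LNl LNr opprK. Qed.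
Lemma qD w z : q (w + z) = q w + q z + 2 * Re (L w z).
Proof.
have H : L (w + z) (w + z) = L w w + L w z + (L w z)^* + L z z.
  by rewrite -LC LDl !LDr addrA.
rewrite /q H !cReD cReJ; move: (Re _) (Re _) (Re _) => a b c; ring.
Qed.
Lemma weightE w : weight D lam w = expR (- 2 * q w). Proof. by []. Qed.

Lemma toC_weight w : toC (weight D lam w) = cexp (toC (- 2 * q w)) :> C.
Proof. by rewrite weightE cexp_toC. Qed.

(** The exponent of the cocycle of [pi_]. *)
Definition pi_exp y w : C :=
  ((2 * Re (L w y.1) - q y.1) +i* (2 * Im (L w y.1) - pairing lam y.2))%C.

Lemma two_toC : (2 : C) = toC 2.
Proof. by rewrite -[2%:R]/(1 + 1) toCD toC1. Qed.

Lemma pi_expE y w :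
  - ('i : C) * toC (pairing lam y.2) + 2 * L w y.1 - toC (q y.1) = pi_exp y w.
Proof.
rewrite two_toC /pi_exp; move: (L w y.1) (q _) (pairing _ _) => a b c.
have E (z : C) (e f : R) : Re z = e -> Im z = f -> z = (e +i* f)%C by case: z => ? ? /= -> ->.
by apply: E; rewrite !cE; ring.
Qed.

Lemma Re_pi_exp y w : Re (pi_exp y w) = 2 * Re (L w y.1) - q y.1.
Proof. by []. Qed.
Lemma Im_pi_exp y w : Im (pi_exp y w) = 2 * Im (L w y.1) - pairing lam y.2.
Proof. by []. Qed.

#[local] Opaque weight cexp toC expR sin cos q pi_exp.

Lemma piE y u w : pi_ D lam y u w = cexp (pi_exp y w) * u (w - y.1).
Proof.
rewrite -pi_expE; case: y => z x.
rewrite /pi_ !pairingCD pairingCN !pairingCZ pairingC_toC.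
by rewrite -[pairingC lam (Phi w z)]/(L w z) -[pairingC lam (Phi z z)]/(L z z) Lzz.
Qed.

Lemma pairing_mul (x x' : 'cV[R]_m) z w :
  pairing lam (x + x' + 2 *: map_mx Im (Phi z w)) =
  pairing lam x + pairing lam x' + 2 * Im (L z w).
Proof.
rewrite /pairing !mulmxDr -scalemxAr !mxE; congr (_ + _ * _).
rewrite /L /pairingC !mxE cIm_sum; apply: eq_bigr => j _.
by rewrite !mxE cImM cImC cReC mul0r addr0.
Qed.

#[local] Opaque L.

Lemma pi_expM y y' w : pi_exp (mulN D y y') w = pi_exp y w + pi_exp y' (w - y.1).
Proof.
apply: cplx_eq; rewrite ?cReD ?cImD !(Re_pi_exp, Im_pi_exp) LDl LNl.
  rewrite LDr qD !cReD cReN.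
  by move: (Re _) (Re _) (Re _) (q _) (q _) => a b c d e; ring.
rewrite pairing_mul LDr !cImD cImN.
by move: (Im _) (Im _) (Im _) (pairing _ _) (pairing _ _) => a b c d e; ring.
Qed.

Lemma piM y y' u : pi_ D lam (mulN D y y') u = pi_ D lam y (pi_ D lam y' u).
Proof.
apply/funext => w; rewrite !piE pi_expM cexpD.
have -> : w - (mulN D y y').1 = w - y.1 - y'.1 by rewrite opprD addrA.
by rewrite mulrA.
Qed.

(* The translation by [y.1] turns the cocycle into its conjugate inverse. *)
Lemma pi_exp_trans y w : pi_exp y (w + y.1) + toC (- 2 * q (w + y.1)) =
  (pi_exp (invN y) w)^* + toC (- 2 * q w).
Proof.
apply: cplx_eq; rewrite ?cReD ?cImD ?cReJ ?cImJ !(Re_pi_exp, Im_pi_exp) ?cReC ?cImC.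
  rewrite LDl LNr qD qN !cReD cReN Lzz cReC.
  by move: (Re _) (q _) (q _) => a b c; ring.
rewrite LDl LNr cImD cImN Lzz cImC.
have -> : pairing lam (invN y).2 = - pairing lam y.2 by rewrite /pairing mulmxN mxE.
by move: (Im _) (pairing _ _) => a b; ring.
Qed.

Definition Etrans (z : E) (x : tup (n + n)) : tup (n + n) := tup_of (row_of x + vecE z).

Lemma vecED z w : vecE (z + w) = vecE z + vecE w.
Proof.
apply/rowP => l; rewrite [RHS]mxE; case: (split_ordP l) => k ->.
  by rewrite !row_mxEl !mxE cReD.
by rewrite !row_mxEr !mxE cImD.
Qed.

Lemma E_of_Etrans z x : E_of (row_of (Etrans z x)) = E_of (row_of x) + z.
Proof.
by rewrite row_ofK -[z in RHS]vecEK -[LHS]vecEK -[RHS]vecEK vecED !E_ofK.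
Qed.

Lemma measurable_Etrans z : measurable_fun setT (Etrans z).
Proof.
apply/measurable_fun_tnthP => i /=.
rewrite (_ : _ \o _ = fun t => (tnth t i : R) + vecE z 0 i); last first.
  by apply/funext => t /=; rewrite tnth_mktuple !mxE.
by apply: measurable_funD => //; exact: measurable_tnth.
Qed.

Lemma leb_Etrans z A : measurable A -> leb R (n + n) (Etrans z @^-1` A) = leb R _ A.
Proof.
move=> mA; rewrite (@leb_triangular R 1 _ (Etrans z))//.
- by rewrite invr1 expr1n mul1e.
- exact: measurable_Etrans.
by move=> i x y _; rewrite !tnth_mktuple !mxE; ring.
Qed.

Definition Elift T (f : E -> T) := fun x : tup (n + n) => f (E_of (row_of x)).

Lemma integralE_trans z (f : E -> C) : cmeasurable (Elift f) ->
  Defs.integralE (fun w => f (w + z)) = Defs.integralE f.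
Proof.
move=> mf; rewrite /Defs.integralE.
rewrite -(@cintegral_preserving R _ _ (leb R _) (Etrans z) _ (measurable_Etrans z) (@leb_Etrans z) mf).
by apply: eq_cintegral => x /=; rewrite /Elift E_of_Etrans.
Qed.

Lemma cmeasurable_L d (T : measurableType d) (F G : T -> E) :
  (forall j, cmeasurable (fun t => F t j 0)) ->
  (forall j, cmeasurable (fun t => G t j 0)) ->
  cmeasurable (fun t => L (F t) (G t)).
Proof.
by move=> mF mG; apply: cmeasurable_pairingC => i; exact: cmeasurable_Phi.
Qed.

Lemma measurable_q d (T : measurableType d) (F : T -> E) :
  (forall j, cmeasurable (fun t => F t j 0)) ->
  measurable_fun setT (fun t => q (F t)).
Proof. by move=> mF; exact: (cmeasurable_L mF mF).1. Qed.

Lemma measurable_weight d (T : measurableType d) (F : T -> E) :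
  (forall j, cmeasurable (fun t => F t j 0)) ->
  measurable_fun setT (fun t => weight D lam (F t)).
Proof.
move=> mF; apply: measurableT_comp => //; apply: measurable_funM => //.
exact: measurable_q.
Qed.

Lemma cmeasurable_E d (T : measurableType d) (F : T -> tup (n + n)) j :
  measurable_fun setT F -> cmeasurable (fun t => E_of (row_of (F t)) j 0).
Proof. exact: cmeasurable_E_of. Qed.

Lemma cmeasurable_pi_exp d (T : measurableType d) (F : T -> N) (G : T -> E) :
  Nmeasurable F -> (forall j, cmeasurable (fun t => G t j 0)) ->
  cmeasurable (fun t => cexp (pi_exp (F t) (G t))).
Proof.
move=> [F1 F2] mG; apply: cmeasurable_cexp.
have mL := cmeasurable_L mG F1.
split; [under eq_fun do rewrite Re_pi_exp|under eq_fun do rewrite Im_pi_exp].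
  apply: measurable_funB; last exact: measurable_q.
  by apply: measurable_funM => //; exact: mL.1.
apply: measurable_funB; first by apply: measurable_funM => //; exact: mL.2.
rewrite /pairing; under eq_fun do rewrite mxE.
by apply: measurable_sum => j; exact: measurable_funM.
Qed.

Lemma Nmeasurable_cst d (T : measurableType d) y : Nmeasurable (fun _ : T => y).
Proof. by split => j; [exact: cmeasurable_cst|exact: measurable_cst]. Qed.

Lemma cmeasurable_idE j : cmeasurable (Elift (fun w => w j 0)).
Proof. by apply: (@cmeasurable_E _ _ (fun x => x)); exact: measurable_id. Qed.

Lemma cmeasurable_pi y u : cmeasurable (Elift u) -> cmeasurable (Elift (pi_ D lam y u)).
Proof.
move=> mu; rewrite /Elift; under eq_fun do rewrite piE; apply: cmeasurableM.
  by apply: (@cmeasurable_pi_exp _ _ (fun _ => y)); [exact: Nmeasurable_cst|exact: cmeasurable_idE].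
have mt := measurable_Etrans (- y.1).
have E0 x : Elift u (Etrans (- y.1) x) = u (E_of (row_of x) - y.1).
  by rewrite /Elift E_of_Etrans.
by split; under eq_fun do rewrite -E0; [exact: (measurableT_comp mu.1 mt)|exact: (measurableT_comp mu.2 mt)].
Qed.

Definition dot_integrand u v := fun w => u w * (v w)^* * toC (weight D lam w).

Lemma dot_integrandE u v w :
  dot_integrand u v w = u w * (v w)^* * cexp (toC (- 2 * q w)).
Proof. by rewrite -toC_weight. Qed.

Lemma cmeasurable_dot u v : cmeasurable (Elift u) -> cmeasurable (Elift v) ->
  cmeasurable (Elift (dot_integrand u v)).
Proof.
move=> mu mv; apply: cmeasurableM; first by apply: cmeasurableM => //; exact: cmeasurable_conj.
by apply: cmeasurable_toC; apply: measurable_weight; exact: cmeasurable_idE.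
Qed.

(* unitarity of pi_lam *)
Lemma dotH_pi y u v : cmeasurable (Elift u) -> cmeasurable (Elift v) ->
  dotH D lam (pi_ D lam y u) v = dotH D lam u (pi_ D lam (invN y) v).
Proof.
move=> mu mv.
have E1 u' v' : dotH D lam u' v' = Defs.integralE (dot_integrand u' v') by [].
rewrite !E1 -(integralE_trans y.1 (cmeasurable_dot (cmeasurable_pi y mu) mv)).
apply: eq_cintegral => x.
move: (E_of _) => w.
rewrite !dot_integrandE.
rewrite !piE.
rewrite addrK.
have -> : w - (invN y).1 = w + y.1 by rewrite opprK.
rewrite cconjM -cexp_conj.
have := pi_exp_trans y w.
move: (pi_exp y _) (pi_exp (invN y) w)^* (toC _) (toC _) => a b c d H.
transitivity (u w * (v (w + y.1))^* * (cexp a * cexp d)); last first.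
  rewrite -cexpD H cexpD; move: (cexp _) (cexp _) (u w) (v _)^* => e f g h; ring.
move: (cexp _) (cexp _) (u w) (v _)^* => e f g h; ring.
Qed.

End fock.

(* FILE F2 *)
Section cexp_holomorphic.
Context (R : realType).
Local Notation C := (Cplx R).
Local Notation Re := (@complex.Re R).
Local Notation Im := (@complex.Im R).
Local Notation normc := (@Normc.normc R).

Lemma MVT0 (f df : R -> R) (x : R) : (forall t : R, is_derive t 1 f (df t)) ->
  exists2 t, `|t| <= `|x| & f x - f 0 = df t * x.
Proof.
move=> fdf.
have cf : continuous f.
  by move=> t; apply: differentiable_continuous; apply/derivable1_diffP; have [] := fdf t.
have [x0|x0|->] := ltgtP x 0.
- have [t] := MVT x0 (fun t _ => fdf t) (continuous_subspaceT cf).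
  rewrite in_itv /= => /andP[xt t0] H; exists t.
    by rewrite !ler0_norm ?lerN2 ?ltW.
  by rewrite -opprB H; ring.
- have [t] := MVT x0 (fun t _ => fdf t) (continuous_subspaceT cf).
  rewrite in_itv /= => /andP[xt t0] H; exists t.
    by rewrite !ger0_norm ?ltW.
  by rewrite H; ring.
- by exists 0 => //; rewrite subrr mulr0.
Qed.

Lemma ler_sin (x : R) : `|sin x| <= `|x| :> R.
Proof.
have [t _] := @MVT0 (@sin R) (@cos R) x (fun t => is_derive_sin t).
rewrite sin0 subr0 => ->; rewrite normrM ler_piMl//.
by rewrite ler_norml cos_le1 cos_geN1.
Qed.

Lemma ler_cos1 (x : R) : `|cos x - 1| <= x ^+ 2 :> R.
Proof.
have [t tx] := @MVT0 (@cos R) (fun t => - sin t) x (fun t => is_derive_cos t).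
rewrite cos0 => ->; rewrite normrM normrN -[x ^+ 2]real_normK ?num_real//.
by rewrite expr2 ler_wpM2r// (le_trans (ler_sin t)).
Qed.

Lemma ler_sinB (x : R) : `|x| <= 1 -> `|sin x - x| <= x ^+ 2 :> R.
Proof.
move=> x1.
have [t tx] := @MVT0 (fun t => sin t - t) (fun t => cos t - 1) x
  (fun t => is_deriveB (is_derive_sin t) (is_derive_id _ _)).
rewrite sin0 !subr0 => ->; rewrite normrM -[x ^+ 2]real_normK ?num_real//.
rewrite expr2 ler_wpM2r//; apply: le_trans (ler_cos1 t) _.
rewrite -[t ^+ 2]real_normK ?num_real// expr2.
by apply: (le_trans _ tx); rewrite ler_piMl// (le_trans tx).
Qed.

Lemma ler_expR2 (x : R) : `|x| <= 1 / 2 -> `|expR x - 1 - x| <= 2 * x ^+ 2 :> R.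
Proof.
rewrite ler_norml => /andP[x1 x2].
have h1 := expR_ge1Dx x; have h2 := expR_ge1Dx (- x).
have h3 : expR x * expR (- x) = 1 by rewrite -expRD subrr expR0.
rewrite ger0_norm; last by lra.
have e0 : 0 < expR x by exact: expR_gt0.
have : expR x * (1 - x) <= 1 by rewrite -[leRHS]h3 ler_pM2l.
nra.
Qed.

Lemma ler_cexp (h : C) : normc h <= 1 / 2 ->
  normc (cexp h - 1 - h) <= 8 * normc h ^+ 2.
Proof.
move=> t2; have ha := ler_Re_normc h; have hb := ler_Im_normc h.
have tge0 := normc_ge0 h.
apply: le_trans (ler_normc_ReIm _) _; rewrite !cE.
move: (Re h) (Im h) (normc h) ha hb tge0 t2 => a b t ha hb t0 t2.
have a2 : a ^+ 2 <= t ^+ 2.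
  by rewrite -[a ^+ 2]real_normK ?num_real// lerXn2r// nnegrE.
have b2 : b ^+ 2 <= t ^+ 2.
  by rewrite -[b ^+ 2]real_normK ?num_real// lerXn2r// nnegrE.
have e1 := ler_expR2 (le_trans ha t2).
have b1 : `|b| <= 1 by apply: le_trans hb _; lra.
have c1 := ler_cos1 b; have s1 := ler_sinB b1.
have ea : expR a <= 2.
  move: e1; rewrite ler_norml => /andP[_ e1].
  have := le_trans (ler_norm _) ha; nra.
have e0 := expR_ge0 a.
have -> : expR a * cos b + - 1 + - a = expR a * (cos b - 1) + (expR a - 1 - a) by ring.
have -> : expR a * sin b + - 0 + - b = expR a * (sin b - b) + (expR a - 1 - a) * b + a * b by ring.
have n1 : `|expR a * (cos b - 1)| <= 2 * t ^+ 2.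
  rewrite normrM ger0_norm//; apply: ler_pM => //; exact: le_trans c1 b2.
have n2 : `|expR a * (sin b - b)| <= 2 * t ^+ 2.
  rewrite normrM ger0_norm//; apply: ler_pM => //; exact: le_trans s1 b2.
have n3 : `|(expR a - 1 - a) * b| <= t ^+ 2.
  rewrite normrM; apply: le_trans (ler_pM (normr_ge0 _) (normr_ge0 _) e1 hb) _; nra.
have n4 : `|a * b| <= t ^+ 2 by rewrite normrM expr2 ler_pM.
have h1 := ler_normD (expR a * (cos b - 1)) (expR a - 1 - a).
have h2 := ler_normD (expR a * (sin b - b) + (expR a - 1 - a) * b) (a * b).
have h3 := ler_normD (expR a * (sin b - b)) ((expR a - 1 - a) * b).
lra.
Qed.

Lemma lt0_toC (e : C) : 0 < e -> e = toC (Re e) /\ 0 < Re e.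
Proof.
rewrite ltcE => /andP[/eqP e0 re0]; split => //.
by apply: cplx_eq; rewrite ?cReC ?cImC.
Qed.

Lemma diff_quotient (c g h d : C) : h != 0 -> d = h^-1 * (g * c - c) ->
  normc (g - 1 - h) <= 8 * normc h ^+ 2 -> normc (c - d) <= normc c * 8 * normc h.
Proof.
move=> h0 -> H.
have -> : c - h^-1 * (g * c - c) = (- c * h^-1) * (g - 1 - h) by field.
rewrite !normcM normcN; apply: le_trans (ler_wpM2l _ H) _.
  by rewrite mulr_ge0 // normc_ge0.
rewrite Normc.normcV le_eqVlt; apply/orP; left; apply/eqP.
have : normc h != 0 by apply: contra h0 => /eqP/normc_eq0 ->.
by move: (normc h) (normc c) => t s t0; field.
Qed.

#[local] Opaque cexp toC.

Lemma differentiable_cexp (z : C) : differentiable (cexp : C -> C) z.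
Proof.
apply/derivable1_diffP; rewrite /derivable; apply/cvg_ex; exists (cexp z).
apply/cvgrPdist_le => e /lt0_toC[eE re0].
pose A := 8 * (normc (cexp z) + 1).
have A0 : 0 < A by rewrite mulr_gt0// ltr_wpDl// normc_ge0.
pose del := Num.min (1 / 2) (Re e / A).
have del0 : 0 < del by rewrite lt_min divr_gt0// divr_gt0.
have del0' : (0 : C) < toC del by rewrite -toC0 ltc_toC.
near=> h.
have h0 : h != 0 by near: h; exact: nbhs_dnbhs_neq.
have : `|h| < toC del by near: h; exact: dnbhs0_lt.
rewrite norm_cplx ltc_toC lt_min => /andP[/ltW h1 /ltW h2].
rewrite norm_cplx eE lec_toC.
apply: le_trans (diff_quotient h0 _ (ler_cexp h1)) _.
  by rewrite /= scaler1 cexpD.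
move: h2; rewrite ler_pdivlMr// => h2.
apply: le_trans h2.
rewrite [leRHS]mulrC /A; have := normc_ge0 h; have := normc_ge0 (cexp z).
move: (normc _) (normc _) => a b a0 b0; nra.
Unshelve. all: by end_near.
Qed.

End cexp_holomorphic.

(* FILE G *)
#[local] Opaque weight cexp toC expR sin cos L q pi_exp cintegral.

Lemma exp_decay (R : realType) (c : R) k : 0 < c ->
  exists M, forall x, 0 <= x -> (1 + x) ^+ k * expR (- (c * x ^+ 2)) <= M.
Proof.
move=> c0; pose c' := c / k.+1%:R.
have c'0 : 0 < c' by rewrite divr_gt0.
pose A := 2 + c'^-1; have A0 : 0 < A by rewrite addr_gt0// invr_gt0.
exists (A ^+ k.+1) => x x0.
have e1 : 1 + x <= A * (1 + c' * x ^+ 2).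
  have -> : A * (1 + c' * x ^+ 2) = 2 + c'^-1 + 2 * (c' * x ^+ 2) + x ^+ 2.
    by rewrite /A; field; rewrite gt_eqF.
  have h1 : 0 < c'^-1 by rewrite invr_gt0.
  have h2 : 0 <= c' * x ^+ 2 by rewrite mulr_ge0 ?sqr_ge0 ?ltW.
  nra.
rewrite expRN ler_pdivrMr ?expR_gt0//.
apply: (@le_trans _ _ ((1 + x) ^+ k.+1)).
  by rewrite exprS ler_peMl ?exprn_ge0 ?addr_ge0// lerDl.
apply: (@le_trans _ _ ((A * (1 + c' * x ^+ 2)) ^+ k.+1)).
  by apply: lerXn2r => //; rewrite nnegrE ?addr_ge0// mulr_ge0 ?(ltW A0)// addr_ge0// mulr_ge0 ?sqr_ge0 ?(ltW c'0).
rewrite exprMn ler_pM2l ?exprn_gt0//.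
have -> : c * x ^+ 2 = k.+1%:R * (c' * x ^+ 2) by rewrite /c'; field.
rewrite expRM_natl; apply: lerXn2r; rewrite ?nnegrE ?expR_ge0//.
  by rewrite addr_ge0// mulr_ge0 ?sqr_ge0 ?(ltW c'0).
exact: expR_ge1Dx.
Qed.

Section fock_space.
Context (R : realType) (n m r : nat) (D : siegel_data R n m r).
Local Notation C := (Cplx R).
Local Notation Re := (@complex.Re R).
Local Notation Im := (@complex.Im R).
Local Notation normc := (@Normc.normc R).
Local Notation tup d := (d.-tuple (measurableTypeR R)).
Local Notation E := 'cV[C]_n.
Local Notation N := ('cV[C]_n * 'cV[R]_m)%type.
Hypothesis hPhi : Phi_hermitian D.
Local Notation Phi := (Phi D).
Local Notation dd := (n + n + m)%N.
Variable lam : 'rV[R]_m.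
Local Notation q := (q D lam).
Local Notation L := (L D lam).
Local Notation pi_exp := (pi_exp D lam).
Local Notation mu := (leb R (n + n)).
Hypothesis hco : exists2 c, 0 < c & forall z, c * `|vecE z| ^+ 2 <= q z.
Implicit Types (z w : E) (y : N) (u v : E -> C).

Definition sw w : R := expR (- q w).

Lemma q_ge0 z : 0 <= q z.
Proof. by have [c c0 H] := hco; apply: le_trans (H z); rewrite mulr_ge0 ?sqr_ge0 ?ltW. Qed.

Lemma sw_ge0 w : 0 <= sw w. Proof. exact: expR_ge0. Qed.
Lemma sw_gt0 w : 0 < sw w. Proof. exact: expR_gt0. Qed.
Lemma sw_le1 w : sw w <= 1.
Proof. by rewrite /sw expR_le1 oppr_le0 q_ge0. Qed.

Lemma weight_sw w : weight D lam w = sw w ^+ 2.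
Proof. by rewrite weightE /sw expr2 -expRD; congr expR; ring. Qed.

Lemma weight_le_sw w : weight D lam w <= sw w.
Proof. by rewrite weight_sw expr2 ler_piMl ?sw_ge0 ?sw_le1. Qed.

Lemma weight_gt0 w : 0 < weight D lam w.
Proof. by rewrite weight_sw exprn_gt0 ?sw_gt0. Qed.

Lemma measurable_sw : measurable_fun setT (Elift sw).
Proof.
apply: measurableT_comp => //; apply: measurable_funN.
by apply: measurable_q => // j; exact: cmeasurable_idE.
Qed.

Lemma integrable_sw : mu.-integrable setT (EFin \o Elift sw).
Proof.
have [c c0 H] := hco; have [M HM] := @exp_decay R c (2 * (n + n)) c0.
apply: (@decay_integrable R _ _ M measurable_sw) => x.
rewrite /Elift ger0_norm ?sw_ge0//; apply: le_trans (HM `|row_of x| _) => //.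
apply: ler_wpM2l; first by rewrite exprn_ge0// addr_ge0.
rewrite /sw ler_expR lerN2; have := H (E_of (row_of x)).
by rewrite E_ofK.
Qed.

Lemma measurable_weightE : measurable_fun setT (Elift (weight D lam)).
Proof. by apply: measurable_weight => // j; exact: cmeasurable_idE. Qed.

Lemma integrable_weight : mu.-integrable setT (EFin \o Elift (weight D lam)).
Proof.
apply: (le_integrable _ _ _ integrable_sw) => //.
  by apply/measurable_EFinP; exact: measurable_weightE.
move=> x _ /=; rewrite lee_fin /Elift [leLHS]ger0_norm ?(ltW (weight_gt0 _))//.
by rewrite [leRHS]ger0_norm ?sw_ge0// weight_le_sw.
Qed.

Local Notation one := (fun _ : E => 1 : C).

Lemma cmeasurable_one : cmeasurable (Elift one).
Proof. exact: cmeasurable_cst. Qed.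

Lemma normc_pi1 y w : normc (pi_ D lam y one w) = expR (2 * Re (L w y.1) - q y.1).
Proof. by rewrite piE// mulr1 normc_cexp. Qed.

Lemma normc_pi1_weight y w :
  normc (pi_ D lam y one w) * weight D lam w = sw (w - y.1) * sw w.
Proof.
rewrite normc_pi1 weightE /sw -!expRD; congr expR.
rewrite qD// qN// LNr// cReN; move: (Re _) (q _) (q _) => a b c; ring.
Qed.

Lemma normc_pi1_weight2 y w :
  normc (pi_ D lam y one w) ^+ 2 * weight D lam w = weight D lam (w - y.1).
Proof.
rewrite normc_pi1 !weightE expr2 -!expRD; congr expR.
rewrite qD// qN// LNr// cReN; move: (Re _) (q _) (q _) => a b c; ring.
Qed.

Lemma differentiable_L z w : differentiable (fun w => L w z : C) w.
Proof.
rewrite (_ : (fun w => _) = \sum_j ((fun w : E => w j 0 * L (delta_mx j 0) z))); last first.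
  apply/funext => w'; rewrite fct_sumE.
  have LZ a w1 : L (a *: w1) z = a * L w1 z.
    by rewrite -[LHS]/(pairingC lam (Phi (a *: w1) z)) PhiZl// pairingCZ.
  rewrite {1}[w']cV_delta (big_morph (fun w => L w z) (id1 := 0) (op1 := +%R)).
  - by apply: eq_bigr => j _; rewrite LZ.
  - by move=> a b; rewrite LDl.
  - by rewrite -[LHS]/(pairingC lam (Phi 0 z)) Phi0l// /pairingC mulmx0 mxE.
apply: differentiable_sum => j.
by apply: differentiableM => //; exact: differentiable_coord.
Qed.

Lemma holomorphic_pi1 y : holomorphic (pi_ D lam y one).
Proof.
pose a : E -> C := cst (- ('i : C) * toC (pairing lam y.2)).
pose b : E -> C := cst (toC (q y.1)).
pose g : E -> C := a + cst (2 : C) * (fun w => L w y.1) - b.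
move=> w; rewrite (_ : pi_ _ _ _ _ = cexp \o g); last first.
  by apply/funext => w'; rewrite piE// mulr1 -pi_expE.
apply: differentiable_comp; last exact: differentiable_cexp.
apply: differentiableB; last exact: differentiable_cst.
apply: differentiableD; first exact: differentiable_cst.
apply: differentiableM; first exact: differentiable_cst.
exact: differentiable_L.
Qed.

Lemma fock_pi1 y : fock D lam (pi_ D lam y one).
Proof.
split; first exact: holomorphic_pi1.
have mw : measurable_fun setT (EFin \o Elift (weight D lam)).
  by apply/measurable_EFinP; exact: measurable_weightE.
have w0 x : (0 <= (EFin \o Elift (weight D lam)) x)%E.
  by rewrite lee_fin ltW// weight_gt0.
have E1 := ge0_integral_preserving (measurable_Etrans (- y.1)) (@leb_Etrans R n (- y.1)) mw w0.
have /integrableP[_] := integrable_weight; apply: le_lt_trans.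
rewrite (_ : (\int[mu]_x `|(EFin \o Elift (weight D lam)) x|)%E =
  (\int[mu]_x (EFin \o Elift (weight D lam)) x)%E); last first.
  by apply: eq_integral => x _; rewrite gee0_abs.
rewrite -E1 le_eqVlt; apply/orP; left; apply/eqP; apply: eq_integral => x _.
by rewrite normc_pi1_weight2 -E_of_Etrans.
Qed.

Lemma continuous_Re : continuous (Re : C -> R).
Proof.
move=> z A /nbhs_ballP[e /= e0 eA]; apply/nbhs_ballP; exists (toC e).
  by rewrite /= -toC0 ltc_toC.
move=> w zw; apply: eA; move: zw; rewrite -!ball_normE /= norm_cplx ltc_toC.
by apply: le_lt_trans; rewrite -cReN -cReD ler_Re_normc.
Qed.

Lemma continuous_Im : continuous (Im : C -> R).
Proof.
move=> z A /nbhs_ballP[e /= e0 eA]; apply/nbhs_ballP; exists (toC e).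
  by rewrite /= -toC0 ltc_toC.
move=> w zw; apply: eA; move: zw; rewrite -!ball_normE /= norm_cplx ltc_toC.
by apply: le_lt_trans; rewrite -cImN -cImD ler_Im_normc.
Qed.

Lemma continuous_E_of : continuous (@E_of R n).
Proof.
move=> v A /nbhs_ballP[e /= /lt0_toC[eE re0] eA]; apply/nbhs_ballP.
exists (Re e / 2); first by rewrite /= divr_gt0.
move=> v'; rewrite -ball_normE /= => vv'; apply: eA; split.
  by rewrite eE -toC0 ltc_toC.
move=> i j; rewrite (ord1 j) -ball_normE /= eE norm_cplx ltc_toC.
apply: le_lt_trans (ler_normc_ReIm _) _.
have h1 := le_lt_trans (ler_coord_norm (v - v') 0 (lshift n i)) vv'.
have h2 := le_lt_trans (ler_coord_norm (v - v') 0 (rshift n i)) vv'.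
rewrite cReD cImD cReN cImN !E_ofE /=.
rewrite !mxE in h1 h2; lra.
Qed.

Lemma holomorphic_Re u : holomorphic u -> continuous (fun v : 'rV[R]_(n + n) => Re (u (E_of v))).
Proof.
move=> hu v A nA.
exact: (continuous_E_of (differentiable_continuous (hu (E_of v)) (continuous_Re nA))).
Qed.

Lemma holomorphic_Im u : holomorphic u -> continuous (fun v : 'rV[R]_(n + n) => Im (u (E_of v))).
Proof.
move=> hu v A nA.
exact: (continuous_E_of (differentiable_continuous (hu (E_of v)) (continuous_Im nA))).
Qed.

Lemma holomorphic_cmeasurable u : holomorphic u -> cmeasurable (Elift u).
Proof.
move=> hu; split.
  exact: (measurable_row_of_continuous (holomorphic_Re hu)).
exact: (measurable_row_of_continuous (holomorphic_Im hu)).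
Qed.

Lemma fock_cmeasurable u : fock D lam u -> cmeasurable (Elift u).
Proof. by move=> [/holomorphic_cmeasurable]. Qed.

Lemma fock_integrable u : fock D lam u ->
  mu.-integrable setT (EFin \o Elift (fun w => normc (u w) ^+ 2 * weight D lam w)).
Proof.
move=> fu; have mu' := fock_cmeasurable fu; apply/integrableP; split.
  apply/measurable_EFinP; apply: measurable_funM; last exact: measurable_weightE.
  by apply: measurable_funX; exact: measurable_normc.
have [_] := fu; apply: le_lt_trans.
rewrite le_eqVlt; apply/orP; left; apply/eqP; apply: eq_integral => x _.
by rewrite /= ger0_norm// mulr_ge0 ?sqr_ge0// ltW// weight_gt0.
Qed.

Definition dotint u v := cintegrable mu (Elift (dot_integrand D lam u v)).

Lemma normc_dot_integrand u v w :
  normc (dot_integrand D lam u v w) = normc (u w) * normc (v w) * weight D lam w.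
Proof.
rewrite /dot_integrand !normcM normc_conj normc_toC.
by rewrite (ger0_norm (ltW (weight_gt0 w))).
Qed.

Lemma fock_dotint u v : fock D lam u -> fock D lam v -> dotint u v.
Proof.
move=> fu fv.
have iu := fock_integrable fu; have iv := fock_integrable fv.
apply: (le_cintegrable _ _ (integrableD measurableT iu iv)).
  by apply: cmeasurable_dot => //; exact: fock_cmeasurable.
move=> x; rewrite /Elift normc_dot_integrand -mulrDl.
apply: ler_wpM2r; first exact/ltW/weight_gt0.
have := normc_ge0 (u (E_of (row_of x))); have := normc_ge0 (v (E_of (row_of x))).
move: (normc _) (normc _) => a b; nra.
Qed.

Lemma dotH_Zl b u v : dotint u v -> dotH D lam (fun w => b * u w) v = b * dotH D lam u v.
Proof.
move=> iuv; rewrite -[RHS](cintegralZ b iuv); apply: eq_cintegral => x.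
by rewrite /Elift /dot_integrand !mulrA.
Qed.

Lemma dotH_Zr b u v : dotint u v -> dotH D lam u (fun w => b * v w) = b^* * dotH D lam u v.
Proof.
move=> iuv; rewrite -[RHS](cintegralZ b^* iuv); apply: eq_cintegral => x.
rewrite /Elift /dot_integrand cconjM.
by move: (u _) (v _)^* b^* (toC _) => a c d e; ring.
Qed.

Lemma dotH_conj u v : dotint u v -> dotH D lam v u = (dotH D lam u v)^*.
Proof.
move=> iuv; rewrite -[RHS](cintegral_conj iuv); apply: eq_cintegral => x.
rewrite /Elift /dot_integrand !cconjM toC_conj conjCK.
by move: (u _)^* (v _) (toC _) => a c d; ring.
Qed.

End fock_space.

(* FILE G2 *)
#[local] Opaque weight cexp toC expR sin cos L q pi_exp cintegral dotH.

Section coefficients.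
Context (R : realType) (n m r : nat) (D : siegel_data R n m r).
Local Notation C := (Cplx R).
Local Notation Re := (@complex.Re R).
Local Notation Im := (@complex.Im R).
Local Notation normc := (@Normc.normc R).
Local Notation tup d := (d.-tuple (measurableTypeR R)).
Local Notation E := 'cV[C]_n.
Local Notation N := ('cV[C]_n * 'cV[R]_m)%type.
Hypothesis hPhi : Phi_hermitian D.
Local Notation dd := (n + n + m)%N.
Variable lam : 'rV[R]_m.
Local Notation q := (q D lam).
Local Notation pi_exp := (pi_exp D lam).
Local Notation mu := (leb R (n + n)).
Hypothesis hco : exists2 c, 0 < c & forall z, c * `|vecE z| ^+ 2 <= q z.
Implicit Types (z w : E) (y : N) (u v : E -> C).
Local Notation one := (fun _ : E => 1 : C).
Local Notation dotH := (dotH D lam).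
Local Notation pi_ := (pi_ D lam).
Local Notation convN := (Defs.convN D).
Local Notation rapid := (@rapid R n m).

Lemma dotHE u v : dotH u v = cintegral mu (Elift (dot_integrand D lam u v)).
Proof. by []. Qed.

Lemma fock_Z b u : fock D lam u -> fock D lam (fun w => b * u w).
Proof.
move=> fu; have [hu _] := fu; split.
  by move=> w; exact: (differentiableM (differentiable_cst b w) (hu w)).
have /integrableP[_] := integrableZl measurableT (normc b ^+ 2) (fock_integrable hPhi fu).
apply: le_lt_trans; rewrite le_eqVlt; apply/orP; left; apply/eqP; apply: eq_integral => x _.
rewrite /= ger0_norm; last by rewrite mulr_ge0 ?sqr_ge0// mulr_ge0 ?sqr_ge0// ltW ?weight_gt0.
by rewrite normcM exprMn -mulrA.
Qed.

Lemma pi0 : pi_ (0, 0) one = one.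
Proof.
apply/funext => w; rewrite piE// mulr1.
rewrite (_ : pi_exp (0, 0) w = 0) ?cexp0// -pi_expE/= .
have -> : pairing lam (0 : 'cV[R]_m) = 0 by rewrite /pairing mulmx0 mxE.
have L0 w' : L D lam w' 0 = 0.
  by rewrite -[LHS]/(pairingC lam (Phi D w' 0)) Phi0r// /pairingC mulmx0 mxE.
have -> : q 0 = 0 by rewrite -[LHS]/(Re (L D lam 0 0)) L0.
rewrite L0 toC0 !mulr0 addr0.
exact: subr0.
Qed.

Lemma fock_one : fock D lam one.
Proof. by rewrite -pi0; exact: fock_pi1. Qed.

Lemma fock_cst b : fock D lam (fun=> b).
Proof.
by have := fock_Z b fock_one; congr (fock _ _ _); apply/funext => w; rewrite mulr1.
Qed.

Lemma dotH_eq0 u : fock D lam u -> dotH u u = 0 -> u = fun=> 0.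
Proof.
move=> fu u0; have mu' := fock_cmeasurable fu.
have iu := fock_integrable hPhi fu.
pose g : tup (n + n) -> R := Elift (fun w => normc (u w) ^+ 2 * weight D lam w).
have g0 x : 0 <= g x by rewrite /g /Elift mulr_ge0 ?sqr_ge0// ltW ?weight_gt0.
have I0 : (\int[mu]_x (g x)%:E = 0)%E.
  have := congr1 Re u0; rewrite dotHE Re_cintegral cRe0 /Rintegral.
  rewrite (_ : (\int[mu]_x _)%E = (\int[mu]_x (g x)%:E)%E); last first.
    apply: eq_integral => x _; rewrite /g /Elift /dot_integrand mul_conj cReM cReC cReC cImC.
    by rewrite mul0r subr0.
  by move=> H; rewrite -(fineK (integrable_fin_num measurableT iu)) H.
have mg : measurable_fun setT (EFin \o g) by have /measurable_int := iu.
have ae0 : ae_eq mu setT (EFin \o Elift (fun w => normc (u w))) (cst 0%E).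
  have I0' : (\int[mu]_x `|(EFin \o g) x| = 0)%E.
    by rewrite -[RHS]I0; apply: eq_integral => x _; rewrite gee0_abs// lee_fin.
  have := (ae_eq_integral_abs mu measurableT mg).1 I0'.
  apply: filterS => x /= + _ => /(_ I) [] /eqP.
  rewrite mulf_eq0 (gt_eqF (weight_gt0 _ _ _)) orbF sqrf_eq0 => /eqP H0.
  by rewrite /Elift H0.
have I1 : (\int[mu]_x ((fun v : 'rV[R]_(n + n) => normc (u (E_of v))) (row_of x))%:E = 0)%E.
  rewrite (_ : (\int[mu]_x _)%E = (\int[mu]_x 0)%E); first by rewrite integral0.
  apply: ae_eq_integral => //; apply/measurable_EFinP; exact: measurable_normc.
have cn : continuous (fun x : 'rV[R]_(n + n) => normc (u (E_of x))).
  pose G := fun x : 'rV[R]_(n + n) =>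
    Re (u (E_of x)) * Re (u (E_of x)) + Im (u (E_of x)) * Im (u (E_of x)).
  have -> : (fun x : 'rV[R]_(n + n) => normc (u (E_of x))) = Num.sqrt \o G.
    by apply/funext => x'; rewrite normcE !expr2.
  move=> x; apply: continuous_comp; last exact: sqrt_continuous.
  have cR := holomorphic_Re fu.1 (x := x); have cI := holomorphic_Im fu.1 (x := x).
  exact: (cvgD (cvgM cR cR) (cvgM cI cI)).
apply/funext => w; apply: normc_eq0.
by have := continuous_integral_eq0 cn (fun x => normc_ge0 _) I1 (vecE w); rewrite vecEK.
Qed.

Lemma dotH11_neq0 : dotH one one != 0.
Proof.
apply/eqP => /(dotH_eq0 fock_one) /(congr1 (fun f => f 0)) /eqP.
by rewrite oner_eq0.
Qed.

(** the matrix coefficient of pi_lam along the vacuum vector *)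
Definition vac y := dotH (pi_ y one) one.

Lemma cmeasurable_vac : cmeasurable (Nlift vac).
Proof.
pose F (p : tup dd * tup (n + n)) : C :=
  cexp (pi_exp (N_of (row_of p.1)) (E_of (row_of p.2))) * 1^* * toC (weight D lam (E_of (row_of p.2))).
rewrite (_ : Nlift vac = fun x => cintegral mu (fun t => F (x, t))); last first.
  apply/funext => x; rewrite /Nlift /vac dotHE; apply: eq_cintegral => w.
  by rewrite /Elift /dot_integrand piE// mulr1.
have mE j : cmeasurable (fun p : tup dd * tup (n + n) => E_of (row_of p.2) j 0).
  exact: cmeasurable_E_of.
apply: cmeasurable_cintegral; apply: cmeasurableM.
  apply: cmeasurableM; last exact: cmeasurable_cst.
  apply: cmeasurable_pi_exp => //.
  exact: Nmeasurable_N_of.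
by apply: cmeasurable_toC; exact: measurable_weight.
Qed.

Lemma vac_bound : exists K, forall y, normc (vac y) <= K.
Proof.
have cm1 : cmeasurable (Elift one) by exact: cmeasurable_cst.
exists (2 * \int[mu]_x Elift (sw D lam) x) => y.
rewrite /vac dotHE; apply: ler_normc_cintegral => [|x|].
- exact: (cmeasurable_dot hPhi lam (cmeasurable_pi hPhi lam y cm1) cm1).
- rewrite /Elift normc_dot_integrand// Normc.normc1 mulr1 normc_pi1_weight//.
  by rewrite ler_piMl ?sw_ge0 ?sw_le1.
- exact: integrable_sw.
Qed.

Lemma pi_cst y b : pi_ y (fun=> b) = fun w => b * pi_ y one w.
Proof. by apply/funext => w; rewrite !piE// mulr1 mulrC. Qed.

Lemma dot_pi_cst y b b' :
  dotH (pi_ y (fun=> b)) (fun=> b') = b * b'^* * vac y.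
Proof.
have f1 := fock_pi1 hPhi hco y.
rewrite pi_cst dotH_Zl; last exact: fock_dotint (fock_cst _).
rewrite (_ : (fun=> b') = fun w => b' * one w); last by apply/funext => w; rewrite mulr1.
by rewrite dotH_Zr ?mulrA//; exact: fock_dotint fock_one.
Qed.

Lemma vac_mul y (z : N) : vac (mulN D y z) = dotH (pi_ z one) (pi_ (invN y) one).
Proof.
have cm1 : cmeasurable (Elift one) by exact: cmeasurable_cst.
by rewrite /vac piM// (dotH_pi hPhi lam y (cmeasurable_pi hPhi lam z cm1) cm1).
Qed.

Lemma vac_inv y : vac y = dotH one (pi_ (invN y) one).
Proof.
have cm1 : cmeasurable (Elift one) by exact: cmeasurable_cst.
by rewrite /vac (dotH_pi hPhi lam y cm1 cm1).
Qed.

End coefficients.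

(* FILE G3 *)
#[local] Opaque weight cexp toC expR sin cos L q pi_exp cintegral dotH vac.

Section convolution.
Context (R : realType) (n m r : nat) (D : siegel_data R n m r).
Local Notation C := (Cplx R).
Local Notation Re := (@complex.Re R).
Local Notation normc := (@Normc.normc R).
Local Notation tup d := (d.-tuple (measurableTypeR R)).
Local Notation E := 'cV[C]_n.
Local Notation N := ('cV[C]_n * 'cV[R]_m)%type.
Hypothesis hPhi : Phi_hermitian D.
Local Notation dd := (n + n + m)%N.
Variable lam : 'rV[R]_m.
Local Notation mu := (leb R dd).
Local Notation muE := (leb R (n + n)).
Hypothesis hco : exists2 c, 0 < c & forall z : E, c * `|vecE z| ^+ 2 <= q D lam z.
Local Notation one := (fun _ : E => 1 : C).
Local Notation dotH := (dotH D lam).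
Local Notation pi_ := (pi_ D lam).
Local Notation vac := (vac D lam).
Local Notation convN := (Defs.convN D).
Local Notation rapid := (@rapid R n m).
Local Notation pi_coef := (pi_coef D lam).

(* the operator pi_lam(psi) is x P_lam pi_lam(psi) P_lam *)
Definition vacuum_type (chi : C) (psi : N -> C) := forall u v : E -> C,
  fock D lam u -> fock D lam v ->
  pi_coef psi u v = chi * pi_coef psi (proj0 D lam u) (proj0 D lam v).

Definition vcoef (psi : N -> C) : C := Defs.integralN (fun y => psi y * vac y).

Lemma vac_cintegrable psi : rapid psi ->
  cintegrable mu (Nlift (fun y => psi y * vac y)).
Proof.
move=> rp; have [K HK] := vac_bound hPhi hco.
apply: (le_cintegrable _ _ (integrableZl measurableT K (rapid_integrable 0 rp))).
  by apply: cmeasurableM; [exact: rp.1|exact: cmeasurable_vac].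
move=> x; rewrite /Nlift normcM expr0 mul1r mulrC.
by apply: ler_wpM2r; [exact: normc_ge0|exact: HK].
Qed.

Lemma pi_coef_cst psi b b' : rapid psi ->
  pi_coef psi (fun=> b) (fun=> b') = b * b'^* * vcoef psi.
Proof.
move=> rp; rewrite /vcoef /Defs.integralN -(cintegralZ _ (vac_cintegrable rp)).
apply: eq_cintegral => x; rewrite dot_pi_cst//.
rewrite /Nlift; move: (psi _) (vac _) (b'^*) => a c d; ring.
Qed.

Lemma pi_coef_vac psi v chi : rapid psi -> vacuum_type chi psi ->
  fock D lam v -> pi_coef psi one v = (dotH v one / dotH one one)^* * vcoef psi.
Proof.
move=> rp hpsi fv; have f1 := fock_one hPhi hco.
have d0 := dotH11_neq0 hPhi hco.
have P1 : proj0 D lam one = one by apply/funext => w; rewrite /proj0 divff.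
have e1 : vcoef psi = chi * vcoef psi.
  have := hpsi _ _ f1 f1; rewrite P1 pi_coef_cst//.
  by rewrite conjC1 !mul1r.
rewrite (hpsi _ _ f1 fv) P1 /proj0 pi_coef_cst//.
rewrite [in RHS]e1; move: (_^*) (vcoef _) => a c; ring.
Qed.

Lemma prod_integrable (g p : tup dd -> R) (S : tup dd -> tup dd -> tup dd) :
  mu.-integrable setT (EFin \o g) -> mu.-integrable setT (EFin \o p) ->
  (forall x, 0 <= g x) -> (forall x, 0 <= p x) ->
  measurable_fun setT (fun z : tup dd * tup dd => S z.1 z.2) ->
  (forall y, measurable_fun setT (fun x => S x y)) ->
  (forall y A, measurable A -> mu ((fun x => S x y) @^-1` A) = mu A) ->
  (mu \x mu)%E.-integrable setT (EFin \o (fun z => g (S z.1 z.2) * p z.2)).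
Proof.
move=> ig ip g0 p0 mS mSy Sinv.
have mg : measurable_fun setT g by apply/measurable_EFinP; have /measurable_int := ig.
have mp : measurable_fun setT p by apply/measurable_EFinP; have /measurable_int := ip.
apply/integrable21ltyP.
  apply/measurable_EFinP; apply: measurable_funM.
    exact: (measurableT_comp mg mS).
  exact: (measurableT_comp mp).
set G := (\int[mu]_x (g x)%:E)%E.
have Gfin : G \is a fin_num by exact: (integrable_fin_num measurableT ig).
rewrite (_ : (\int[mu]_y _)%E = (\int[mu]_y (G * (p y)%:E))%E); last first.
  apply: eq_integral => y _.
  have mg' : measurable_fun setT (EFin \o g) by exact/measurable_EFinP.
  have g0' x : (0 <= (EFin \o g) x)%E by rewrite lee_fin.
  rewrite /G -[X in (X * _)%E](ge0_integral_preserving (mSy y) (Sinv y) mg' g0').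
  rewrite -ge0_integralZr//.
  + by apply: eq_integral => x _; rewrite gee0_abs ?lee_fin ?mulr_ge0.
  + exact: (measurableT_comp mg' (mSy y)).
  + by rewrite lee_fin.
rewrite ge0_integralZl//.
- apply: lte_mul_pinfty => //; first by apply: integral_ge0 => x _; rewrite lee_fin.
  have /integrableP[_] := ip; apply: le_lt_trans.
  rewrite le_eqVlt; apply/orP; left; apply/eqP; apply: eq_integral => x _.
  by rewrite gee0_abs ?lee_fin.
- exact/measurable_EFinP.
- by move=> x _; rewrite lee_fin.
- by apply: integral_ge0 => x _; rewrite lee_fin.
Qed.

Lemma rapid_norm_integrable f : rapid f ->
  mu.-integrable setT (EFin \o Nlift (fun y => normc (f y))).
Proof.
by move=> rf; exact: (integrable_normc (rapid_cintegrable rf)).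
Qed.

Lemma vcoef_conv f psi chi : rapid f -> rapid psi -> vacuum_type chi psi ->
  vcoef (convN f psi) * dotH one one = vcoef f * vcoef psi.
Proof.
move=> rf rp hpsi.
have [K HK] := vac_bound hPhi hco.
have K0 : 0 <= K by apply: le_trans (HK (0, 0)); exact: normc_ge0.
have mv := cmeasurable_vac hPhi lam.
have nf := rapid_norm_integrable rf; have np := rapid_norm_integrable rp.
pose T2 : Type := tup dd * tup dd.
have n1 : Nmeasurable (fun p : tup dd * tup dd => N_of (row_of p.1) : N).
  exact: Nmeasurable_N_of.
have n2 : Nmeasurable (fun p : tup dd * tup dd => N_of (row_of p.2) : N).
  exact: Nmeasurable_N_of.
pose F (p : tup dd * tup dd) : C := f (mulN D (N_of (row_of p.1)) (invN (N_of (row_of p.2)))) *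
  psi (N_of (row_of p.2)) * vac (N_of (row_of p.1)).
pose G (p : tup dd * tup dd) : C := f (N_of (row_of p.1)) *
  psi (N_of (row_of p.2)) * vac (mulN D (N_of (row_of p.1)) (N_of (row_of p.2))).
have mF : cmeasurable F.
  apply: cmeasurableM; last exact: (Nmeasurable_comp n1 mv).
  apply: cmeasurableM; last exact: (Nmeasurable_comp n2 rp.1).
  by apply: (Nmeasurable_comp _ rf.1); exact: Nmeasurable_div.
have mG : cmeasurable G.
  apply: cmeasurableM; last by apply: (Nmeasurable_comp _ mv); exact: Nmeasurable_mul.
  apply: cmeasurableM; first exact: (Nmeasurable_comp n1 rf.1).
  exact: (Nmeasurable_comp n2 rp.1).
(* domination *)
pose nF (y z : tup dd) := K * (normc (f (mulN D (N_of (row_of y)) (invN (N_of (row_of z))))) * normc (psi (N_of (row_of z)))).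
pose nG (y z : tup dd) := K * (normc (f (N_of (row_of y))) * normc (psi (N_of (row_of z)))).
have bF y z : normc (F (y, z)) <= nF y z.
  rewrite /F /nF /= !normcM mulrC; apply: ler_wpM2r; last exact: HK.
  by rewrite mulr_ge0// normc_ge0.
have bG y z : normc (G (y, z)) <= nG y z.
  rewrite /G /nG /= !normcM mulrC; apply: ler_wpM2r; last exact: HK.
  by rewrite mulr_ge0// normc_ge0.
have p0 (h : N -> C) x : 0 <= Nlift (fun y => normc (h y)) x by exact: normc_ge0.
pose S1 (y z : tup dd) : tup dd := rtrans D (invN (N_of (row_of z))) y.
have mS1 : measurable_fun setT (fun z : tup dd * tup dd => S1 z.1 z.2).
  by apply: Nmeasurable_tup; exact: Nmeasurable_div.
have inF : (mu \x mu)%E.-integrable setT (EFin \o (fun p => nF p.1 p.2)).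
  have := prod_integrable nf np (p0 f) (p0 psi) mS1
    (fun y => measurable_rtrans hPhi _) (fun y => @leb_rtrans _ _ _ _ _ hPhi _).
  move=> /(integrableZl measurableT K); apply: eq_integrable => // x _.
  by rewrite /nF /Nlift /= /S1 N_of_rtrans.
have mid (y : tup dd) : measurable_fun setT (fun x : tup dd => x) by exact: measurable_id.
have inG : (mu \x mu)%E.-integrable setT (EFin \o (fun p => nG p.1 p.2)).
  have := prod_integrable (S := fun y _ => y) nf np (p0 f) (p0 psi) measurable_fst
    mid (fun y A _ => erefl).
  by move=> /(integrableZl measurableT K).
have iF : cintegrable (mu \x mu)%E F by apply: (le_cintegrable mF _ inF) => -[y z]; exact: bF.
have iG : cintegrable (mu \x mu)%E G by apply: (le_cintegrable mG _ inG) => -[y z]; exact: bG.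
have sl1 (H : tup dd * tup dd -> C) x : cmeasurable H -> cmeasurable (fun y => H (x, y)).
  move=> [H1 H2]; have mp : measurable_fun setT (fun y : tup dd => (x, y)).
    exact: (measurable_fun_pair (measurable_cst x) (mid x)).
  by split; [exact: (measurableT_comp H1 mp)|exact: (measurableT_comp H2 mp)].
have sl2 (H : tup dd * tup dd -> C) y : cmeasurable H -> cmeasurable (fun x => H (x, y)).
  move=> [H1 H2]; have mp : measurable_fun setT (fun x : tup dd => (x, y)).
    exact: (measurable_fun_pair (mid y) (measurable_cst y)).
  by split; [exact: (measurableT_comp H1 mp)|exact: (measurableT_comp H2 mp)].
have [M HM] := rf.2 0%N; have [M' HM'] := rp.2 0%N.
have fM y : normc (f y) <= M by have := HM y; rewrite expr0 mul1r.
have pM y : normc (psi y) <= M' by have := HM' y; rewrite expr0 mul1r.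
have iF1 x : cintegrable mu (fun y => F (x, y)).
  apply: (le_cintegrable (sl1 F x mF) _ (integrableZl measurableT (K * M) np)) => z.
  apply: le_trans (bF x z) _; rewrite /nF /Nlift -mulrA; apply: ler_wpM2l => //.
  by apply: ler_wpM2r => //; exact: normc_ge0.
have iG1 x : cintegrable mu (fun y => G (x, y)).
  apply: (le_cintegrable (sl1 G x mG) _ (integrableZl measurableT (K * M) np)) => z.
  apply: le_trans (bG x z) _; rewrite /nG /Nlift -mulrA; apply: ler_wpM2l => //.
  by apply: ler_wpM2r => //; exact: normc_ge0.
have iG2 y : cintegrable mu (fun x => G (x, y)).
  apply: (le_cintegrable (sl2 G y mG) _ (integrableZl measurableT (K * M') nf)) => z.
  apply: le_trans (bG z y) _; rewrite /nG /Nlift -mulrA; apply: ler_wpM2l => //.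
  by rewrite mulrC; apply: ler_wpM2r => //; exact: normc_ge0.
have iF2 y : cintegrable mu (fun x => F (x, y)).
  have mfn : measurable_fun setT (Nlift (fun y => normc (f y))).
    exact: (measurable_normc rf.1).
  have ifr : mu.-integrable setT (EFin \o (fun x => Nlift (fun y => normc (f y)) (S1 x y))).
    have mr := measurable_rtrans hPhi (invN (N_of (row_of y))).
    apply/integrableP; split; first by apply/measurable_EFinP; exact: (measurableT_comp mfn mr).
    have mfn' : measurable_fun setT (EFin \o Nlift (fun y => normc (f y))) by exact/measurable_EFinP.
    have fn0 x : (0 <= (EFin \o Nlift (fun y => normc (f y))) x)%E by rewrite lee_fin normc_ge0.
    have e1 := ge0_integral_preserving mr (@leb_rtrans _ _ _ _ _ hPhi _) mfn' fn0.
    have /integrableP[_] := nf; apply: le_lt_trans.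
    rewrite (_ : (\int[mu]_x `|(EFin \o Nlift (fun y => normc (f y))) x|)%E = (\int[mu]_x (EFin \o Nlift (fun y => normc (f y))) x)%E); last first.
      by apply: eq_integral => x _; rewrite gee0_abs.
    rewrite -e1 le_eqVlt; apply/orP; left; apply/eqP; apply: eq_integral => x _.
    exact: (gee0_abs (fn0 _)).
  apply: (le_cintegrable (sl2 F y mF) _ (integrableZl measurableT (K * M') ifr)) => z.
  apply: le_trans (bF z y) _; rewrite /nF /Nlift /S1 N_of_rtrans// -mulrA; apply: ler_wpM2l => //.
  by rewrite mulrC; apply: ler_wpM2r => //; exact: normc_ge0.
have d0 := dotH11_neq0 hPhi hco.
have f1 := fock_one hPhi hco.
have dJ : (dotH one one)^* = dotH one one by rewrite -dotH_conj//; exact: fock_dotint.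
have step1 : vcoef (convN f psi) = cintegral mu (fun x => cintegral mu (fun y => F (x, y))).
  apply: eq_cintegral => x; rewrite mulrC -cintegralZ.
    apply: eq_cintegral => y; rewrite /F /=.
    move: (f _) (psi _) (vac _) => a b c; ring.
  apply: (le_cintegrable (cmeasurable_conv_integrand hPhi _ rf rp) _ (integrableZl measurableT M np)) => z.
  by rewrite /Nlift normcM; apply: ler_wpM2r => //; exact: normc_ge0.
have step2 y : cintegral mu (fun x => F (x, y)) = cintegral mu (fun x => G (x, y)).
  pose w : N := N_of (row_of y).
  pose h (a : N) := f (mulN D a (invN w)) * psi w * vac a.
  have mh : cmeasurable (Nlift h) by exact: (sl2 F y mF).
  have := integralN_rtrans hPhi w mh.
  rewrite /Defs.integralN => H; rewrite -[LHS]H; apply: eq_cintegral => x.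
  by rewrite /h mulNK.
have step3 x : cintegral mu (fun y => G (x, y)) =
    (vcoef psi / dotH one one) * (f (N_of (row_of x)) * vac (N_of (row_of x))).
  have fv := fock_pi1 hPhi hco (invN (N_of (row_of x))).
  have := pi_coef_vac rp hpsi fv.
  have -> : (dotH (pi_ (invN (N_of (row_of x))) one) one / dotH one one)^* =
      vac (N_of (row_of x)) / dotH one one.
    rewrite cconjM -dotH_conj; last exact: fock_dotint.
    rewrite -(vac_inv hPhi lam) -[in RHS]dJ; congr (_ * _).
    by rewrite fmorphV.
  rewrite /Defs.pi_coef /Defs.integralN => H.
  have H' : cintegral mu (fun y => psi (N_of (row_of y)) * vac (mulN D (N_of (row_of x)) (N_of (row_of y)))) =
      vac (N_of (row_of x)) / dotH one one * vcoef psi.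
    rewrite -H; apply: eq_cintegral => y; congr (_ * _).
    exact: (vac_mul hPhi lam).
  have iv : cintegrable mu (fun y => psi (N_of (row_of y)) * vac (mulN D (N_of (row_of x)) (N_of (row_of y)))).
    apply: (le_cintegrable _ _ (integrableZl measurableT K np)) => [|y].
      apply: cmeasurableM; first exact: rp.1.
      have nz : Nmeasurable (fun y : tup dd => N_of (row_of y) : N).
        by apply: (@Nmeasurable_N_of _ _ _ _ _ (fun y => y)); exact: measurable_id.
      have nc : Nmeasurable (fun _ : tup dd => N_of (row_of x) : N).
        by split => j; [exact: cmeasurable_cst|exact: measurable_cst].
      exact: (Nmeasurable_comp (Nmeasurable_mul hPhi nc nz) mv).
    rewrite /Nlift normcM mulrC; apply: ler_wpM2r => //; exact: normc_ge0.
  transitivity (f (N_of (row_of x)) * (vac (N_of (row_of x)) / dotH one one * vcoef psi)).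
    rewrite -H'.
    rewrite -(cintegralZ _ iv).
    apply: eq_cintegral => z.
    rewrite /G.
    move: (f _) (psi _) (vac _) => a b c.
    ring.
  move: (f _) (vac _) (dotH _ _)^-1 (vcoef _) => a b c d; ring.
rewrite step1.
rewrite (cFubini iF iF1 iF2).
rewrite (eq_cintegral mu step2).
rewrite -(cFubini iG iG1 iG2).
rewrite (eq_cintegral mu step3).
rewrite (cintegralZ _ (vac_cintegrable rf)).
rewrite -[cintegral mu (Nlift _)]/(vcoef f).
move: (vcoef f) (vcoef psi) d0 => a b; move: (dotH _ _) => d d0.
by field.
Qed.

End convolution.

(* FILE G4 *)
#[local] Opaque weight cexp toC expR sin cos L q pi_exp cintegral dotH vac vcoef.

Section trace.
Context (R : realType) (n m r : nat) (D : siegel_data R n m r).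
Local Notation C := (Cplx R).
Local Notation Re := (@complex.Re R).
Local Notation normc := (@Normc.normc R).
Local Notation tup d := (d.-tuple (measurableTypeR R)).
Local Notation E := 'cV[C]_n.
Local Notation N := ('cV[C]_n * 'cV[R]_m)%type.
Hypothesis hPhi : Phi_hermitian D.
Local Notation dd := (n + n + m)%N.
Variable lam : 'rV[R]_m.
Hypothesis hco : exists2 c, 0 < c & forall z : E, c * `|vecE z| ^+ 2 <= q D lam z.
Local Notation one := (fun _ : E => 1 : C).
Local Notation dotH := (dotH D lam).
Local Notation vcoef := (vcoef D lam).
Local Notation convN := (Defs.convN D).
Local Notation rapid := (@rapid R n m).
Local Notation pi_coef := (pi_coef D lam).
Local Notation fock := (fock D lam).

Definition orthonormal_set (B : set (E -> C)) := B `<=` fock /\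
  forall u v, B u -> B v -> dotH u v = (`[< u = v >])%:R.

Lemma dotH_normalize u : fock u -> dotH u u != 0 ->
  exists2 b : C, b != 0 & dotH (fun w => b * u w) (fun w => b * u w) = 1.
Proof.
move=> fu u0; have iu := fock_dotint hPhi fu fu.
have rl : dotH u u = toC (Re (dotH u u)).
  have := dotH_conj iu; case: (dotH u u) => a b [] h.
  by apply: cplx_eq; rewrite ?cReC ?cImC //=; lra.
have pos : 0 < Re (dotH u u).
  rewrite lt_neqAle; apply/andP; split.
    by apply: contra u0 => /eqP h; rewrite rl -h toC0.
  rewrite dotHE Re_cintegral; apply: Rintegral_ge0 => x _.
  rewrite /Elift /dot_integrand mul_conj cReM !cReC !cImC mul0r subr0.
  by rewrite mulr_ge0 ?sqr_ge0// ltW ?weight_gt0.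
move: pos rl; move: (Re _) => a a0 ea.
have s0 : 0 < Num.sqrt a by rewrite sqrtr_gt0.
exists (toC (Num.sqrt a)^-1).
  apply/eqP => /(congr1 Re); rewrite cReC cRe0 => /eqP; rewrite invr_eq0.
  by rewrite (gt_eqF s0).
have fb := fock_Z hPhi (toC (Num.sqrt a)^-1) fu.
rewrite dotH_Zl ?dotH_Zr ?toC_conj//; last exact: fock_dotint.
rewrite ea -!toCM (_ : _ * (_ * a) = 1) ?toC1//.
rewrite -[X in _ * (_ * X)](sqr_sqrtr (ltW a0)); move: (Num.sqrt a) s0 => t t0.
by field; rewrite gt_eqF.
Qed.

Lemma orthonormal_basis_exists :
  exists (I : choiceType) (e : I -> E -> C), orthonormal_basis D lam e.
Proof.
have [|B [[BF Bo] Bmax]] := @Zorn_bigcup (E -> C) orthonormal_set.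
  move=> F FP tF; split.
    by move=> u [X FX Xu]; exact: (FP _ FX).1.
  move=> u v [X FX Xu] [Y FY Yv].
  have [XY|YX] := tF _ _ FX FY.
    by apply: (FP _ FY).2 => //; exact: XY.
  by apply: (FP _ FX).2 => //; exact: YX.
exists ({classic {u : E -> C | B u}}), (fun i => sval i); split.
- by move=> [u Bu]; exact: BF.
- move=> [u Bu] [v Bv] /=; rewrite Bo//; congr (_%:R); congr nat_of_bool.
  apply/asboolP/eqP => [uv|[]//]; exact: eq_exist.
move=> f ff f0; apply: contrapT => fN0.
have ff0 : dotH f f != 0 by apply/eqP => /(dotH_eq0 hPhi ff).
have [b b0 fb1] := dotH_normalize ff ff0.
set f' := fun w => b * f w in fb1.
have ff' : fock f' by exact: fock_Z.
have orth u : B u -> dotH f' u = 0.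
  move=> Bu; rewrite dotH_Zl; last by apply: fock_dotint => //; exact: BF.
  by rewrite (f0 (exist _ u Bu)) mulr0.
have orth' u : B u -> dotH u f' = 0.
  move=> Bu; rewrite (@dotH_conj _ _ _ _ _ _ f' u) ?orth ?rmorph0//.
  by apply: fock_dotint => //; exact: BF.
have Bf' u : B u -> u <> f'.
  move=> Bu uf; have := orth u Bu; rewrite uf fb1 => /eqP; by rewrite oner_eq0.
apply: (Bmax (B `|` [set f'])).
  split; first by left.
  by move=> sub; have := sub f' (or_intror erefl) => /Bf'; apply.
split; first by move=> u [/BF//|->].
move=> u v [Bu|->] [Bv|->].
- exact: Bo.
- by rewrite orth'//; case: asboolP => // /(Bf' u Bu).
- by rewrite orth//; case: asboolP => // /esym/(Bf' v Bv).
- by rewrite fb1 asboolT.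
Qed.

Lemma trace_neq0 psi chi a : rapid psi -> vacuum_type D lam chi psi ->
  has_trace D lam psi a -> a != 0 -> vcoef psi != 0.
Proof.
move=> rp hpsi htr a0; apply/eqP => v0.
have [I [e oe]] := orthonormal_basis_exists.
have na : 0 < normc a.
  by rewrite lt_neqAle normc_ge0 andbT; apply: contra a0 => /eqP/esym/normc_eq0 ->.
have [J HJ] := htr I e oe (normc a) na.
have := HJ J (fsubset_refl _); rewrite big1; last first.
  move=> i _; have [fe _ _] := oe.
  by rewrite (hpsi _ _ (fe i) (fe i)) /proj0 (pi_coef_cst hPhi hco)// v0 !mulr0.
by rewrite sub0r normcN ltxx.
Qed.

End trace.

(* FILE G5 *)
#[local] Opaque weight cexp toC expR sin cos L q pi_exp cintegral dotH vac vcoef.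

Section key.
Context (R : realType) (n m r : nat) (D : siegel_data R n m r).
Local Notation C := (Cplx R).
Local Notation Re := (@complex.Re R).
Local Notation Im := (@complex.Im R).
Local Notation normc := (@Normc.normc R).
Local Notation tup d := (d.-tuple (measurableTypeR R)).
Local Notation E := 'cV[C]_n.
Local Notation N := ('cV[C]_n * 'cV[R]_m)%type.
Local Notation dd := (n + n + m)%N.
Local Notation convN := (Defs.convN D).
Local Notation rapid := (@rapid R n m).

Lemma schwartz_rapid (f : N -> C) : schwartz f -> rapid f.
Proof.
move=> [[s1 d1] [s2 d2]]; split.
  split.
    exact: (@measurable_row_of_continuous R dd (fun v => Re (f (N_of v)))
      (fun v => (s1 [::] v I).1)).
  exact: (@measurable_row_of_continuous R dd (fun v => Im (f (N_of v)))
    (fun v => (s2 [::] v I).1)).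
move=> k; have [M1 H1] := d1 [::] k; have [M2 H2] := d2 [::] k.
exists (M1 + M2) => y; rewrite -[y]vecNK /japN N_ofK; move: (vecN y) => v.
have := H1 v; have := H2 v; rewrite /Defs.iterD /= => h2 h1.
apply: le_trans (lerD h1 h2); rewrite -mulrDr; apply: ler_wpM2l.
  by rewrite exprn_ge0// addr_ge0.
exact: ler_normc_ReIm.
Qed.

Lemma schwartz0 : schwartz (fun _ : N => 0 : C).
Proof.
suff : @schwartzR R dd (fun _ : 'rV[R]_dd => 0 : R) by move=> S; split.
have E0 vs : Defs.iterD vs (fun _ : 'rV[R]_dd => 0 : R) = fun=> 0.
  elim: vs => // v vs IH; rewrite /Defs.iterD /= -/(Defs.iterD vs _) IH.
  by apply/funext => x; rewrite derive_cst.
split.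
  move=> vs x _; rewrite E0; split; first exact: cst_continuous.
  by move=> v; exact: derivable_cst.
by move=> vs k; exists 0 => x; rewrite E0 normr0 mulr0.
Qed.

Lemma S_OmegaL_neq0 psi : Phi_hermitian D -> S_Omega D psi ->
  S_OmegaL D (convN psi psi) /\ S_OmegaL D (fun=> 0).
Proof.
move=> hPhi [K [cK KO hK]]; split; exists K; split => //.
  by exists psi, psi; split => //; exact: hK.1.
exists (fun=> 0), psi; split => //; first exact: schwartz0.
apply/funext => y; rewrite /Defs.convN /Defs.integralN -[LHS](cintegral0 (leb R dd)).
by apply: eq_cintegral => x; rewrite mul0r.
Qed.

Lemma convolution_cube psi lam a (p : \bar R) : Phi_hermitian D -> S_Omega D psi ->
  (exists2 c, 0 < c & forall z : E, c * `|vecE z| ^+ 2 <= q D lam z) ->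
  dual_cone (Omega D) lam -> ~ W D lam ->
  has_trace D lam psi a -> a != 0 -> (0 < p)%E ->
  (0 < LpN p (convN (convN psi psi) psi) < +oo)%E.
Proof.
move=> hPhi [K [cK KO [sp hK]]] hco hl hW htr a0 p0.
have rp := schwartz_rapid sp.
have hpsi : vacuum_type D lam (\1_K lam) psi by exact: (hK lam hW).1 hl.
have v0 := trace_neq0 hPhi hco rp hpsi htr a0.
have rpp := rapid_conv hPhi rp rp.
have rppp := rapid_conv hPhi rpp rp.
have e1 := vcoef_conv hPhi hco rp rp hpsi.
have e2 := vcoef_conv hPhi hco rpp rp hpsi.
have d0 := dotH11_neq0 hPhi hco.
rewrite rapid_LpN_lty// andbT.
apply: (LpN_gt0 rppp (cmeasurable_vac hPhi lam) p0).
rewrite -[X in X != 0]/(vcoef D lam (convN (convN psi psi) psi)).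
apply/eqP => v30; move/eqP: e2; rewrite v30 mul0r eq_sym mulf_eq0 (negPf v0) orbF => /eqP v20.
by move/eqP: e1; rewrite v20 mul0r eq_sym mulf_eq0 (negPf v0).
Qed.

End key.

#[local] Transparent weight cexp toC expR sin cos L q pi_exp cintegral dotH vac vcoef.

(* FILE H1 *)
Section matrix_topology.
Context (R : realType).

Lemma mx_continuous (T : topologicalType) p q (F : T -> 'M[R]_(p, q)) :
  (forall i j, continuous (fun t => F t i j)) -> continuous F.
Proof.
move=> cF t A [P HP sPA]; rewrite nbhs_simpl /=.
have H : \forall s \near t, forall i j, P i j (F s i j).
  by apply: filter_forall => i; apply: filter_forall => j; exact: (cF i j t _ (HP i j)).
by apply: filterS H => s Hs; exact: sPA.
Qed.

Lemma mx_coord_continuous (T : topologicalType) p q (F : T -> 'M[R]_(p, q)) i j :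
  continuous F -> continuous (fun t => F t i j).
Proof.
move=> cF t; apply: (@continuous_comp _ _ _ F (fun M : 'M[R]_(p, q) => M i j)).
  exact: cF.
exact: coord_continuous.
Qed.

Lemma sum_continuous (T : topologicalType) I (s : seq I) (F : I -> T -> R) :
  (forall i, continuous (F i)) -> continuous (fun t => \sum_(i <- s) F i t).
Proof.
move=> cF; elim: s => [|i s IH] t.
  by under eq_fun do rewrite big_nil; exact: cvg_cst.
under eq_fun do rewrite big_cons.
by apply: cvgD; [exact: cF|exact: IH].
Qed.

Lemma prod_continuous (T : topologicalType) I (s : seq I) (F : I -> T -> R) :
  (forall i, continuous (F i)) -> continuous (fun t => \prod_(i <- s) F i t).
Proof.
move=> cF; elim: s => [|i s IH] t.
  by under eq_fun do rewrite big_nil; exact: cvg_cst.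
under eq_fun do rewrite big_cons.
by apply: cvgM; [exact: cF|exact: IH].
Qed.

Lemma det_continuous n : continuous (fun A : 'M[R]_n => \det A).
Proof.
apply: sum_continuous => s t.
have cp : continuous (fun A : 'M[R]_n => \prod_i A i (s i)).
  by apply: prod_continuous => i; exact: coord_continuous.
have cc : continuous (fun _ : 'M[R]_n => (-1) ^+ s : R) by exact: cst_continuous.
exact: (cvgM (cc t) (cp t)).
Qed.

Lemma mulmx_continuous (T : topologicalType) p q l (F : T -> 'M[R]_(p, q)) (G : T -> 'M[R]_(q, l)) :
  continuous F -> continuous G -> continuous (fun t => F t *m G t).
Proof.
move=> cF cG; apply: mx_continuous => i j.
under eq_fun do rewrite mxE; apply: sum_continuous => k t.
exact: (cvgM (@mx_coord_continuous _ _ _ F i k cF t) (@mx_coord_continuous _ _ _ G k j cG t)).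
Qed.

Lemma compact_mx p q (A : set 'M[R]_(p, q)) M : closed A ->
  (forall x, A x -> `|x| <= M) -> compact A.
Proof.
move=> cA bA; pose B := vec_mx @^-1` A.
have cv : continuous (@vec_mx R p q).
  apply: mx_continuous => i j; rewrite (_ : (fun t => _) = fun t : 'rV[R]_(p * q) => t 0 (mxvec_index i j)).
    exact: coord_continuous.
  by apply/funext => t; rewrite mxE.
have cB : compact B.
  apply: bounded_closed_compact.
    exists M; split; first exact: num_real.
    move=> x Mx v Bv; apply: le_trans (ltW Mx); apply: le_trans (bA _ Bv).
    apply: ler_norm_coord => // i j; rewrite (ord1 i); case/mxvec_indexP: j => k l.
    by have := ler_coord_norm (vec_mx v) k l; rewrite mxE.
  by apply: preimage_closed => // x _; exact: cv.
have -> : A = vec_mx @` B.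
  apply/seteqP; split => x /=; last by move=> [v Bv <-].
  by move=> Ax; exists (mxvec x); rewrite /B /= ?mxvecK.
by apply: continuous_compact => //; exact: continuous_subspaceT.
Qed.

Lemma ler_norm_mulmx p q l (A : 'M[R]_(p, q)) (B : 'M[R]_(q, l)) :
  `|A *m B| <= q%:R * `|A| * `|B|.
Proof.
apply: ler_norm_coord => [|i j]; first by rewrite !mulr_ge0.
rewrite mxE; apply: le_trans (ler_norm_sum _ _ _) _.
have -> : q%:R * `|A| * `|B| = \sum_(k < q) `|A| * `|B|.
  by rewrite sumr_const card_ord -mulrA mulr_natl.
apply: ler_sum => k _.
by rewrite normrM; apply: ler_pM => //; exact: ler_coord_norm.
Qed.

Lemma closure_normP p q (A : set 'M[R]_(p, q)) x :
  closure A x <-> forall e, 0 < e -> exists2 y, A y & `|x - y| < e.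
Proof.
split=> [cx e e0|H B /nbhs_ballP[e /= e0 eB]].
  have [y [Ay]] := cx _ (nbhsx_ballx x e e0).
  by rewrite -ball_normE /= => xy; exists y.
have [y Ay xy] := H e e0; exists y; split => //; apply: eB.
by rewrite -ball_normE.
Qed.

Lemma compact_sublevel (T : topologicalType) (K : set T) (f : T -> R) c :
  compact K -> {within K, continuous f} -> compact (K `&` [set x | f x <= c]).
Proof.
move=> cK cf F PF FK.
have [p [Kp clp]] := cK F PF (filterS (@subIsetl _ _ _) FK).
exists p; split => //; split => //=; rewrite leNgt; apply/negP => cp.
have := cf p; rewrite /prop_for /continuous_at => /(_ [set y | c < y]) H.
have : nbhs (f p) [set y | c < y] by apply: open_nbhs_nbhs; split => //; exact: open_gt.
move=> /H; rewrite /nbhs /= -nbhs_subspace_in// => W.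
have [y [[Ky fy] /= yW]] := clp _ _ FK W.
by have := yW Ky; rewrite /= ltNge fy.
Qed.

End matrix_topology.

(* FILE H2 *)
Section cone.
Context (R : realType) (m : nat) (O : set 'cV[R]_m) (T : set 'M[R]_m).
Hypothesis hO : homogeneous_cone O.
Hypothesis hT : triangular_simply_transitive O T.
Local Notation O' := (dual_cone O).

Lemma cone_scale x a : O x -> 0 < a -> O (a *: x).
Proof. by case: hO => [[_ _ H _] _] Ox a0; exact: H. Qed.

Lemma closure_scale x a : closure O x -> 0 < a -> closure O (a *: x).
Proof.
move=> /closure_normP cx a0; apply/closure_normP => e e0.
have [y Oy xy] := cx (e / a) (divr_gt0 e0 a0).
exists (a *: y); first exact: cone_scale.
by rewrite -scalerBr normrZ gtr0_norm// mulrC -ltr_pdivlMr.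
Qed.

Lemma closure_group g x : cone_group O g -> closure O x -> closure O (g *m x).
Proof.
move=> [gu gO] /closure_normP cx; apply/closure_normP => e e0.
pose K := m%:R * `|g| + 1; have K0 : 0 < K by rewrite ltr_wpDl// mulr_ge0.
have [y Oy xy] := cx (e / K) (divr_gt0 e0 K0).
exists (g *m y); first by rewrite -gO; exists y.
rewrite -mulmxBr; apply: le_lt_trans (ler_norm_mulmx _ _) _.
rewrite ltr_pdivlMr// in xy; apply: le_lt_trans xy.
by rewrite mulrC ler_wpM2l// lerDl.
Qed.

Lemma Omega_closure x : O x -> closure O x.
Proof. exact: subset_closure. Qed.

Lemma pairingMr (lam : 'rV[R]_m) (t : 'M[R]_m) x : pairing lam (t *m x) = pairing (lam *m t) x.
Proof. by rewrite /pairing mulmxA. Qed.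

Lemma ler_pairing (lam : 'rV[R]_m) (x : 'cV[R]_m) : `|pairing lam x| <= m%:R * `|lam| * `|x|.
Proof. by apply: le_trans (ler_coord_norm _ _ _) _; exact: ler_norm_mulmx. Qed.

Lemma pairing_continuous : continuous (fun p : 'rV[R]_m * 'cV[R]_m => pairing p.1 p.2).
Proof.
apply: mx_coord_continuous; apply: mulmx_continuous => p; [exact: cvg_fst|exact: cvg_snd].
Qed.

Lemma coercive_compact (H : set 'rV[R]_m) : compact H -> H `<=` O' ->
  exists2 c, 0 < c & forall lam x, H lam -> closure O x -> c * `|x| <= pairing lam x.
Proof.
move=> cH HO; pose S : set 'cV[R]_m := closure O `&` [set x | `|x| = 1].
have cS : compact S.
  apply: (@compact_mx R _ _ _ 1); last by move=> x [_ /= ->].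
  apply: closedI; first exact: closed_closure.
  by apply: (@preimage_closed _ _ (fun x : 'cV[R]_m => `|x|) [set x | x = 1]) => [x _|]; [exact: norm_continuous|exact: closed_eq].
have red c : (forall lam x, H lam -> S x -> c <= pairing lam x) ->
    forall lam x, H lam -> closure O x -> c * `|x| <= pairing lam x.
  move=> Hc lam x Hl Ox; have [->|x0] := eqVneq x 0.
    by rewrite normr0 mulr0 /pairing mulmx0 mxE.
  have nx : 0 < `|x| by rewrite normr_gt0.
  have := Hc lam (`|x|^-1 *: x) Hl; rewrite /pairing -scalemxAr mxE.
  rewrite mulrC ler_pdivlMr//; apply; split; first by apply: closure_scale; rewrite ?invr_gt0.
  by rewrite /= normrZ gtr0_norm ?invr_gt0// mulVf ?gt_eqF.
have [HS0|HS0] := pselect (H `*` S !=set0); last first.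
  by exists 1 => //; apply: red => lam x Hl Sx; exfalso; apply: HS0; exists (lam, x).
have cHS := compact_setX cH cS.
have [[lam0 x0] /set_mem[Hl0 [Ox0 nx0]] Hmin] := compact_EVT_min HS0 cHS
  (continuous_subspaceT pairing_continuous).
exists (pairing lam0 x0).
  apply: HO => //; rewrite -normr_gt0; by rewrite /= in nx0; rewrite nx0.
apply: red => lam x Hl Sx; apply: (Hmin (lam, x)); exact/mem_set.
Qed.

Lemma dual_coercive lam : O' lam ->
  exists2 c, 0 < c & forall x, closure O x -> c * `|x| <= pairing lam x.
Proof.
move=> Ol; have [] := @coercive_compact [set lam].
- exact: compact_set1.
- by move=> _ ->.
- by move=> c c0 H; exists c => // x; exact: H.
Qed.

Lemma coercive_dual lam c : 0 < c ->
  (forall x, closure O x -> c * `|x| <= pairing lam x) -> O' lam.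
Proof.
move=> c0 H x Ox x0; apply: lt_le_trans (H x Ox); by rewrite mulr_gt0// normr_gt0.
Qed.

Lemma dual_ball lam : O' lam -> exists2 e, 0 < e & closed_ball lam e `<=` O'.
Proof.
move=> /dual_coercive[c c0 H]; pose e := c / (2 * (m%:R + 1)).
have m0 : 0 < m%:R + 1 :> R by rewrite ltr_wpDl.
have e0 : 0 < e by rewrite divr_gt0// mulr_gt0.
exists e => //; rewrite closed_ballE// => mu; rewrite /closed_ball_ /= => lm.
apply: (@coercive_dual _ (c / 2)); first by rewrite divr_gt0.
move=> x Ox; have h1 := H x Ox; have h2 := ler_pairing (lam - mu) x.
have h3 : pairing (lam - mu) x = pairing lam x - pairing mu x.
  by rewrite /pairing mulmxBl !mxE.
have h4 : m%:R * `|lam - mu| * `|x| <= c / 2 * `|x|.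
  apply: ler_wpM2r => //; apply: (@le_trans _ _ ((m%:R + 1) * e)).
    by apply: ler_pM => //; rewrite lerDl.
  by rewrite /e le_eqVlt; apply/orP; left; apply/eqP; field; rewrite gt_eqF.
move: h2; rewrite h3 ler_norml => /andP[_]; lra.
Qed.

Lemma dual_open : open O'.
Proof.
rewrite openE => lam /dual_ball[e e0 H]; apply/nbhs_ballP; exists e => //.
by apply: subset_trans H; exact: subset_closed_ball.
Qed.

Lemma group_span : exists2 K, 0 < K & forall (A : 'M[R]_m) C, 0 <= C ->
  (forall x, closure O x -> `|A *m x| <= C * `|x|) -> `|A| <= C * K.
Proof.
have [[[x0 Ox0] oO _ _] _] := hO.
have /nbhs_ballP[e /= e0 eO] := open_nbhs_nbhs (conj oO Ox0).
exists ((2 / e) * (2 * `|x0| + e / 2)).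
  by rewrite mulr_gt0 ?divr_gt0// ltr_wpDl ?divr_gt0// mulr_ge0.
move=> A C C0 H; apply: ler_norm_coord.
  have he : 0 <= e by exact: ltW.
  by apply: mulr_ge0 => //; apply: mulr_ge0; [exact: divr_ge0|apply: addr_ge0; [exact: mulr_ge0|exact: divr_ge0]].
move=> i j; pose d : 'cV[R]_m := delta_mx j 0; pose y := x0 + (e / 2) *: d.
have nd : `|d| <= 1.
  by apply: ler_norm_coord => // k l; rewrite mxE; case: (_ && _); rewrite ?normr1 ?normr0.
have Oy : O y.
  apply: eO; rewrite -ball_normE /= /y opprD addNKr normrN normrZ gtr0_norm ?divr_gt0//.
  by apply: le_lt_trans (_ : e / 2 * 1 < _); [apply: ler_wpM2l => //; rewrite divr_ge0 ?ltW|rewrite mulr1; lra].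
have -> : A i j = (2 / e) * (A *m y - A *m x0) i 0.
  rewrite /y mulmxDr addrAC subrr add0r -scalemxAr mxE -colE mxE.
  by field; rewrite gt_eqF.
rewrite normrM gtr0_norm ?divr_gt0// mulrCA; apply: ler_wpM2l.
  by rewrite divr_ge0 ?ltW.
apply: le_trans (ler_coord_norm _ _ _) _; apply: le_trans (ler_normB _ _) _.
have h1 := H _ (Omega_closure Oy); have h2 := H _ (Omega_closure Ox0).
apply: le_trans (lerD h1 h2) _; rewrite -mulrDr; apply: ler_wpM2l => //.
have h3 : `|y| <= `|x0| + e / 2.
  apply: le_trans (ler_normD _ _) _; rewrite lerD2l normrZ gtr0_norm ?divr_gt0//.
  by rewrite -[leRHS]mulr1; apply: ler_wpM2l => //; rewrite divr_ge0 ?ltW.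
lra.
Qed.

Lemma Tsub t : T t -> cone_group O t.
Proof. by case: hT => _ _ _ H _ /H. Qed.
Lemma Tunit t : T t -> t \in unitmx.
Proof. by case: hT => -[H _ _ _] _ _ _ _ /H. Qed.
Lemma Tmul a b : T a -> T b -> T (a *m b).
Proof. by case: hT => -[_ _ H _] _ _ _ _; exact: H. Qed.
Lemma Tinv a : T a -> T (invmx a).
Proof. by case: hT => -[_ _ _ H] _ _ _ _; exact: H. Qed.
Lemma T1 : T 1%:M.
Proof. by case: hT => -[_ H _ _] _ _ _ _. Qed.

Lemma dual_T lam t : O' lam -> T t -> O' (lam *m t).
Proof.
move=> Ol Tt x Ox x0; rewrite -pairingMr; apply: Ol.
  by apply: closure_group => //; exact: Tsub.
apply: contra x0 => /eqP h; rewrite -[x]mul1mx -(mulVmx (Tunit Tt)) -mulmxA h.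
by rewrite mulmx0.
Qed.

Lemma proper_bound e' (H : set 'rV[R]_m) : O' e' -> compact H -> H `<=` O' ->
  exists2 M, 0 < M & forall t, T t -> H (e' *m t) -> `|t| <= M /\ `|invmx t| <= M.
Proof.
move=> Oe cH HO; have [c c0 Hc] := dual_coercive Oe.
have [c' c'0 Hc'] := coercive_compact cH HO.
have [K K0 HK] := group_span.
have [B B0 HB] : exists2 B, 0 <= B & forall lam, H lam -> `|lam| <= B.
  have /compact_bounded[B0 [_ HB]] := cH.
  exists (`|B0| + 1) => [|lam Hl]; first by rewrite addr_ge0.
  by apply: (HB (`|B0| + 1)) => //; apply: le_lt_trans (ler_norm _) _; rewrite ltrDl.
pose M1 := m%:R * B / c; pose M2 := m%:R * `|e'| / c'.
have M10 : 0 <= M1 by rewrite divr_ge0 ?mulr_ge0 ?(ltW c0).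
have M20 : 0 <= M2 by rewrite divr_ge0 ?mulr_ge0 ?(ltW c'0).
exists (M1 * K + M2 * K + 1).
  by rewrite ltr_wpDl// addr_ge0// mulr_ge0// (ltW K0).
move=> t Tt Ht.
have h1 : `|t| <= M1 * K.
  apply: HK => // x Ox; rewrite /M1 mulrAC ler_pdivlMr// mulrC.
  apply: le_trans (Hc _ (closure_group (Tsub Tt) Ox)) _.
  rewrite pairingMr; apply: le_trans (ler_norm _) _; apply: le_trans (ler_pairing _ _) _.
  by apply: ler_wpM2r => //; apply: ler_wpM2l => //; exact: HB.
have h2 : `|invmx t| <= M2 * K.
  apply: HK => // x Ox; rewrite /M2 mulrAC ler_pdivlMr// mulrC.
  apply: le_trans (Hc' _ _ Ht (closure_group (Tsub (Tinv Tt)) Ox)) _.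
  rewrite pairingMr mulmxK ?Tunit//.
  by apply: le_trans (ler_norm _) _; exact: ler_pairing.
have h3 : 0 <= M1 * K by rewrite mulr_ge0// (ltW K0).
have h4 : 0 <= M2 * K by rewrite mulr_ge0// (ltW K0).
split; [apply: le_trans h1 _|apply: le_trans h2 _].
  by rewrite -addrA lerDl addr_ge0.
by rewrite addrAC lerDr addr_ge0.
Qed.

Definition Tball M d : set 'M[R]_m := [set t | [/\ T t, `|t| <= M & d <= `|\det t|]].

Lemma Tball_compact M d : 0 < d -> compact (Tball M d).
Proof.
move=> d0; apply: (@compact_mx R _ _ _ M); last by move=> t [].
have -> : Tball M d = closure T `&` ([set t | `|t| <= M] `&` [set t | d <= `|\det t|]).
  apply/seteqP; split => t /=.
    by move=> [Tt h1 h2]; split => //; exact: subset_closure.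
  move=> [cT [h1 h2]]; split => //; have [_ H _ _ _] := hT; apply: H => //.
  by rewrite unitmxE unitfE -normr_gt0; exact: lt_le_trans d0 h2.
apply: closedI; first exact: closed_closure.
apply: closedI.
  by apply: (@preimage_closed _ _ (fun x : 'M[R]_m => `|x|) [set y | y <= M]) => [x _|]; [exact: norm_continuous|exact: closed_le].
apply: (@preimage_closed _ _ (fun x : 'M[R]_m => `|\det x|) [set y | d <= y]) => [x _|]; last exact: closed_ge.
apply: (@continuous_comp _ _ _ (fun A : 'M[R]_m => \det A) (fun y => `|y|)).
  exact: det_continuous.
exact: norm_continuous.
Qed.

Lemma proper_Tball e' (H : set 'rV[R]_m) : O' e' -> compact H -> H `<=` O' ->
  exists M d, 0 < d /\ forall t, T t -> H (e' *m t) -> Tball M d t.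
Proof.
move=> Oe cH HO; have [M M0 HM] := proper_bound Oe cH HO.
have [B B0 HB] : exists2 B, 0 < B & forall A : 'M[R]_m, `|A| <= M -> `|\det A| <= B.
  have cb : compact [set A : 'M[R]_m | `|A| <= M].
    apply: (@compact_mx R _ _ _ M) => //.
    by apply: (@preimage_closed _ _ (fun x : 'M[R]_m => `|x|) [set y | y <= M]) => [x _|]; [exact: norm_continuous|exact: closed_le].
  have n0 : [set A : 'M[R]_m | `|A| <= M] !=set0 by exists 0; rewrite /= normr0 ltW.
  have cd : continuous (fun A : 'M[R]_m => `|\det A|).
    move=> x; apply: (@continuous_comp _ _ _ (fun A : 'M[R]_m => \det A) (fun y => `|y|)).
      exact: det_continuous.
    exact: norm_continuous.
  have [A _ HA] := compact_EVT_max n0 cb (continuous_subspaceT cd).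
  exists (`|\det A| + 1); first by rewrite ltr_wpDl.
  move=> A' hA'; apply: le_trans (HA A' _) _; first exact/mem_set.
  by rewrite lerDl.
exists M, B^-1; split; first by rewrite invr_gt0.
move=> t Tt Ht; have [h1 h2] := HM t Tt Ht; split => //.
have := HB _ h2; rewrite det_inv normfV => h3.
have dt : 0 < `|\det t| by rewrite normr_gt0 -unitfE -unitmxE Tunit.
by rewrite -[leRHS]invrK lef_pV2 ?posrE ?invr_gt0.
Qed.

End cone.

(* FILE H3 *)
Section unipotent.
Context (R : realType) (m : nat).
Implicit Types (A B w : 'M[R]_m).

Lemma archi_le0 (a b : R) : (forall k : nat, k%:R * a <= b) -> a <= 0.
Proof.
move=> H; rewrite leNgt; apply/negP => a0.
have := H (Num.truncn (b / a)).+1; apply/negP; rewrite -ltNge -ltr_pdivrMr//.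
exact: truncnS_gt.
Qed.

Lemma bounded_exp_le1 (x b : R) : 0 <= x -> (forall k, x ^+ k <= b) -> x <= 1.
Proof.
move=> x0 H; rewrite leNgt; apply/negP => x1.
suff : x - 1 <= 0 by rewrite subr_le0 leNgt x1.
apply: (@archi_le0 _ b) => k; apply: le_trans (H k).
elim: k => [|k IH]; first by rewrite mul0r expr0 ler01.
have h : 1 <= x ^+ k by rewrite exprn_ege1// ltW.
have : 0 <= (x - 1) * (x ^+ k - 1) by rewrite mulr_ge0// subr_ge0// ltW.
by rewrite exprS -natr1; move: (x ^+ k) (k%:R) IH h => y z; nra.
Qed.

Definition upper A := forall i j : 'I_m, (j < i)%N -> A i j = 0.

Lemma upperM A B : upper A -> upper B -> upper (A * B).
Proof.
move=> uA uB i j ji; rewrite mxE big1// => k _.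
have [ki|ik] := ltnP k i; first by rewrite uA ?mul0r.
by rewrite uB ?mulr0// (leq_trans ji).
Qed.

Lemma upper1 : upper 1.
Proof. by move=> i j ji; rewrite mxE -val_eqE /= gtn_eqF. Qed.

Lemma upper_diagM A B i : upper A -> upper B -> (A * B) i i = A i i * B i i.
Proof.
move=> uA uB; rewrite mxE (bigD1 i)//= big1 ?addr0// => k.
rewrite -val_eqE neq_ltn => /orP[ki|ik]; first by rewrite uA ?mul0r.
by rewrite uB ?mulr0.
Qed.

Lemma upper_exp A k : upper A -> upper (A ^+ k).
Proof.
move=> uA; elim: k => [|k IH]; first by rewrite expr0; exact: upper1.
by rewrite exprS; exact: upperM.
Qed.

Lemma upper_diagX A i k : upper A -> (A ^+ k) i i = A i i ^+ k.
Proof.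
move=> uA; elim: k => [|k IH]; first by rewrite !expr0 mxE eqxx.
by rewrite !exprS upper_diagM ?IH//; exact: upper_exp.
Qed.

Lemma trmxX A k : (A ^+ k)^T = A^T ^+ k.
Proof.
elim: k => [|k IH]; first by rewrite !expr0 trmx1.
by rewrite exprS exprSr [LHS]trmx_mul IH.
Qed.

Lemma bounded_unipotent w M : (exists k, (w - 1) ^+ k = 0) ->
  (forall k, `|w ^+ k| <= M) -> w = 1.
Proof.
move=> [k hk] HM; pose Z := w - 1.
have wE : w = 1 + Z by rewrite /Z addrC subrK.
have step q : Z ^+ q.+2 = 0 -> Z ^+ q.+1 = 0.
  move=> Zq.
  have E j : w ^+ j * Z ^+ q = Z ^+ q + j%:R *: Z ^+ q.+1.
    elim: j => [|j IH]; first by rewrite expr0 mul1r scale0r addr0.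
    rewrite exprS -mulrA IH wE mulrDl mul1r mulrDr -exprS.
    have -> : Z * (j%:R *: Z ^+ q.+1) = 0.
      by rewrite -[LHS]/(_ *m _) -scalemxAr -[Z *m _]exprS Zq scaler0.
    by rewrite addr0 -natr1 scalerDl scale1r addrA.
  apply/eqP; rewrite -normr_le0; apply: (@archi_le0 _ (m%:R * M * `|Z ^+ q| + `|Z ^+ q|)) => j.
  rewrite -[leLHS](_ : `|j%:R *: Z ^+ q.+1| = _); last by rewrite normrZ ger0_norm.
  have -> : j%:R *: Z ^+ q.+1 = w ^+ j * Z ^+ q - Z ^+ q by rewrite E addrC addKr.
  apply: le_trans (ler_normB _ _) _; rewrite lerD2r.
  apply: le_trans (ler_norm_mulmx _ _) _.
  by apply: ler_wpM2r => //; apply: ler_wpM2l.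
have : Z ^+ 1 = 0.
  case: k hk => [|k hk].
    by rewrite expr0 => h; rewrite expr1 -[Z]mul1r h mul0r.
  by elim: k hk => [//|k IH] hk; apply: IH; exact: step.
by rewrite expr1 => /eqP; rewrite subr_eq0 => /eqP.
Qed.

End unipotent.

Lemma upper_nilpotent (R : realType) m (A : 'M[R]_m) :
  upper A -> (forall i, A i i = 0) -> A ^+ m = 0.
Proof.
case: m A => [|m] A uA dA; first by rewrite [LHS]flatmx0 [RHS]flatmx0.
have tA : is_trig_mx A^T by apply/is_trig_mxP => i j ij; rewrite mxE uA.
have := Cayley_Hamilton A^T; rewrite (char_poly_trig tA).
under eq_bigr do rewrite mxE dA subr0.
rewrite prodr_const card_ord rmorphXn /= horner_mx_X -trmxX => /(congr1 trmx).
by rewrite trmxK trmx0.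
Qed.

Section homothety.
Context (R : realType) (m : nat) (O : set 'cV[R]_m) (T : set 'M[R]_m).
Hypothesis hO : homogeneous_cone O.
Hypothesis hT : triangular_simply_transitive O T.
Local Notation O' := (dual_cone O).

Lemma stabilizer_bounded e e' : O e -> O' e' -> exists M, forall A : 'M[R]_m,
  (forall x, O x -> O (A *m x)) -> A *m e = e -> `|A| <= M.
Proof.
move=> Oe Oe'; have [c c0 Hc] := dual_coercive hO Oe'.
have [K K0 HK] := group_span hO.
have [[_ oO _ _] _] := hO.
have /nbhs_ballP[d /= d0 dO] := open_nbhs_nbhs (conj oO Oe).
have pe : 0 <= pairing e' e.
  by apply: le_trans (Hc _ (Omega_closure Oe)); rewrite mulr_ge0// ltW.
pose B := `|e| + 2 * pairing e' e / c.
have B0 : 0 <= B.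
  by apply: addr_ge0 => //; apply: divr_ge0; [exact: mulr_ge0|exact: ltW].
exists (2 / d * B * K) => A AO Ae.
have d20 : 0 <= 2 / d by apply: divr_ge0; [|exact: ltW].
apply: HK => [|x Ox]; first exact: mulr_ge0.
have [->|x0] := eqVneq x 0; first by rewrite mulmx0 !normr0 mulr0.
have nx : 0 < `|x| by rewrite normr_gt0.
pose y := (d / 2 / `|x|) *: x.
have dx : 0 < d / 2 / `|x| by rewrite divr_gt0// divr_gt0.
have ny : `|y| < d.
  rewrite normrZ gtr0_norm// mulfVK ?gt_eqF// ltr_pdivrMr// mulr_natr mulr2n ltrDl//.
have key b : `|b| = 1 -> O (A *m (e + b *: y)).
  move=> b1; apply: AO; apply: dO; rewrite -ball_normE /= opprD addNKr.
  by rewrite normrN normrZ b1 mul1r.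
have pA b : pairing e' (A *m (e + b *: y)) = pairing e' e + b * pairing e' (A *m y).
  by rewrite mulmxDr Ae -scalemxAr /pairing mulmxDr -scalemxAr !mxE.
have k1 := Hc _ (Omega_closure (key 1 (normr1 _))).
have k2 : 0 <= pairing e' (A *m (e + (-1) *: y)).
  apply: le_trans (Hc _ (Omega_closure (key (-1) _))); first by rewrite mulr_ge0// ltW.
  by rewrite normrN1.
have hy : `|A *m y| <= B.
  have : c * `|A *m (e + 1 *: y)| <= 2 * pairing e' e.
    by apply: le_trans k1 _; rewrite pA mul1r; move: k2; rewrite pA; lra.
  rewrite mulrC -ler_pdivlMr// scale1r mulmxDr Ae => h.
  have -> : A *m y = (e + A *m y) - e by rewrite addrC addKr.
  apply: le_trans (ler_normB _ _) _; rewrite addrC /B; lra.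
have -> : A *m x = (2 / d * `|x|) *: (A *m y).
  rewrite /y -scalemxAr scalerA [X in X *: _](_ : _ = 1) ?scale1r//.
  by field; rewrite gt_eqF//= gt_eqF.
rewrite normrZ gtr0_norm; last by rewrite mulr_gt0// divr_gt0.
by rewrite mulrAC; apply: ler_wpM2r => //; apply: ler_wpM2l.
Qed.

Lemma T_Omega t x : T t -> O x -> O (t *m x).
Proof. by move=> /(Tsub hT)[_ tO] Ox; rewrite -tO; exists x. Qed.

Lemma homothety_in_T e e' rho : O e -> O' e' -> 0 < rho -> T rho%:M.
Proof.
move=> Oe Oe' rho0; pose a := Num.sqrt rho.
have a0 : 0 < a by rewrite sqrtr_gt0.
have aa : a * a = rho by rewrite -expr2 sqr_sqrtr ?ltW.
have [_ _ [P Pu Ptri] _ Tst] := hT.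
have [t [[Tt te] _]] := Tst e (a *: e) Oe (cone_scale hO Oe a0).
have tu := Tunit hT Tt.
pose u : 'M[R]_m := a^-1 *: t; pose v : 'M[R]_m := a *: invmx t.
have vu : v * u = 1.
  by rewrite -[LHS]/(_ *m _) /u /v -scalemxAr -scalemxAl mulVmx// scalerA mulVf ?gt_eqF// scale1r.
have [M HM] := stabilizer_bounded Oe Oe'.
have pow (A : 'M[R]_m) k : (forall x, O x -> O (A *m x)) -> A *m e = e -> `|A ^+ k| <= M.
  move=> AO Ae; apply: HM.
    elim: k => [|k IH] x Ox; first by rewrite expr0 mul1mx.
    by rewrite exprS -mulmxA; apply: AO; exact: IH.
  elim: k => [|k IH]; first by rewrite expr0 mul1mx.
  by rewrite exprS -mulmxA IH.
have uO x : O x -> O (u *m x).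
  by move=> Ox; rewrite -scalemxAl; apply: cone_scale; rewrite ?invr_gt0//; exact: T_Omega.
have vO x : O x -> O (v *m x).
  by move=> Ox; rewrite -scalemxAl; apply: cone_scale => //; apply: T_Omega => //; exact: (Tinv hT).
have ue : u *m e = e by rewrite -scalemxAl te scalerA mulVf ?gt_eqF// scale1r.
have ve : v *m e = e by rewrite -{1}ue mulmxA [v *m u]vu mul1mx.
pose cj (A : 'M[R]_m) : 'M[R]_m := P *m A *m invmx P.
have cjM A B : cj (A * B) = cj A * cj B.
  rewrite /cj -[A * B]/(A *m B) -[_ * _]/(P *m A *m invmx P *m (P *m B *m invmx P)).
  by rewrite !mulmxA mulmxKV.
have cj1 : cj 1 = 1 by rewrite /cj mulmx1 mulmxV.
have cjX A k : cj (A ^+ k) = cj A ^+ k.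
  by elim: k => [|k IH]; rewrite ?expr0// !exprS cjM IH.
pose M' := m%:R * (m%:R * `|P| * M) * `|invmx P|.
have powc A k : (forall x, O x -> O (A *m x)) -> A *m e = e -> `|cj A ^+ k| <= M'.
  move=> AO Ae; rewrite -cjX; apply: le_trans (ler_norm_mulmx _ _) _.
  apply: ler_wpM2r => //; apply: ler_wpM2l => //; apply: le_trans (ler_norm_mulmx _ _) _.
  by apply: ler_wpM2l; [exact: mulr_ge0|exact: pow].
have uU : upper (cj u).
  by move=> i j ji; rewrite /cj /u -scalemxAr -scalemxAl mxE Ptri ?mulr0.
have vU : upper (cj v).
  move=> i j ji; rewrite /cj /v -scalemxAr -scalemxAl mxE Ptri ?mulr0//.
  exact: (Tinv hT).
have diag_le A i : upper (cj A) -> (forall x, O x -> O (A *m x)) -> A *m e = e ->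
    `|cj A i i| <= 1.
  move=> UA AO Ae; apply: (@bounded_exp_le1 _ _ M') => // k.
  rewrite -normrX -upper_diagX//; apply: le_trans (ler_coord_norm _ _ _) _.
  exact: powc.
have d1 i : cj u i i ^+ 2 = 1.
  have h : cj v i i * cj u i i = 1 by rewrite -upper_diagM// -cjM vu cj1 mxE eqxx.
  have h1 := diag_le u i uU uO ue; have h2 := diag_le v i vU vO ve.
  have : `|cj v i i| * `|cj u i i| = 1 by rewrite -normrM h normr1.
  rewrite -real_normK ?num_real// => h3.
  suff -> : `|cj u i i| = 1 by rewrite expr1n.
  by apply/eqP; rewrite eq_le h1 /= -h3; apply: ler_piMl.
have w1 : cj u ^+ 2 = 1.
  apply: (@bounded_unipotent _ _ _ M') => [|k].
    exists m; apply: upper_nilpotent => [i j ji|i].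
      by rewrite mxE [X in _ + X]mxE (upper_exp 2 uU) ?(@upper1 R m)// oppr0 addr0.
    by rewrite mxE [X in _ + X]mxE upper_diagX// d1 mxE eqxx subrr.
  by rewrite -exprM; exact: powc.
have uu : u *m u = 1.
  have : cj (u ^+ 2) = 1 by rewrite cjX.
  rewrite /cj expr2 => /(congr1 (fun A : 'M[R]_m => invmx P *m A *m P)).
  by rewrite !mulmxA mulVmx// mul1mx mulmxKV// mulmx1 mulVmx.
have -> : rho%:M = t *m t.
  have -> : t = a *: u by rewrite scalerA mulfV ?gt_eqF// scale1r.
  by rewrite -scalemxAr -scalemxAl scalerA uu aa scalemx1.
exact: (Tmul hT).
Qed.

End homothety.

(* FILE H4 *)
Lemma powR_lower_bound (R : realType) (b s x : R) : 0 < b -> b^-1 <= x <= b ->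
  expR (- (`|s| * ln b)) <= x `^ s.
Proof.
move=> b0 /andP[bx xb]; have x0 : 0 < x by apply: lt_le_trans bx; rewrite invr_gt0.
rewrite /powR gt_eqF// ler_expR; apply: lerNnormlW.
rewrite normrM; apply: ler_wpM2l => //.
have h1 : ln x <= ln b by rewrite ler_ln ?posrE.
have h2 : - ln b <= ln x by rewrite -lnV ?posrE// ler_ln ?posrE ?invr_gt0.
by rewrite ler_norml h2.
Qed.

Section modulus.
Context (R : realType) (n m r : nat) (D : siegel_data R n m r).
Local Notation O := (Omega D).
Local Notation T := (Tplus D).
Local Notation e' := (e_Omega' D).
Local Notation O' := (dual_cone O).
Implicit Types (s : 'I_r -> R) (lam : 'rV[R]_m).
Hypothesis hO : homogeneous_cone O.
Hypothesis hT : triangular_simply_transitive O T.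
Hypothesis hA : abelianization T (Delta D).
Hypothesis he' : O' e'.

Lemma Delta_gt0 t j : T t -> 0 < Delta D t j.
Proof. by case: hA => H _ /H; exact. Qed.

Lemma DeltaM t u j : T t -> T u -> Delta D (t *m u) j = Delta D t j * Delta D u j.
Proof. by case: hA => _ [H _] Tt Tu; exact: H. Qed.

Lemma Delta1 j : Delta D 1%:M j = 1.
Proof.
have /(mulfI (lt0r_neq0 (Delta_gt0 j (T1 hT)))) : Delta D 1%:M j * Delta D 1%:M j = Delta D 1%:M j * 1.
  by rewrite -DeltaM ?mulmx1 ?mulr1//; exact: (T1 hT).
by [].
Qed.

Lemma Delta_pow_gt0 s t : T t -> 0 < Delta_pow D s t.
Proof. by move=> Tt; apply: prodr_gt0 => j _; rewrite powR_gt0// Delta_gt0. Qed.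

Lemma Delta_powM s t u : T t -> T u ->
  Delta_pow D s (t *m u) = Delta_pow D s t * Delta_pow D s u.
Proof.
move=> Tt Tu; rewrite /Delta_pow -big_split; apply: eq_bigr => j _ /=.
by rewrite DeltaM// powRM// ltW// Delta_gt0.
Qed.

Lemma Delta_pow1 s : Delta_pow D s 1%:M = 1.
Proof. by rewrite /Delta_pow big1// => j _; rewrite Delta1 powR1. Qed.

Lemma Delta_within M d j : {within Tball T M d, continuous (fun t => Delta D t j)}.
Proof.
case: hA => _ [_ [H _]]; apply: continuous_subspaceW (H j) => t; by case.
Qed.

Lemma Delta_bounded M d : 0 < d -> exists2 B, 0 < B &
  forall t j, Tball T M d t -> B^-1 <= Delta D t j <= B.
Proof.
move=> d0; have cT := Tball_compact hT (M := M) d0.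
have [n0|n0] := pselect (Tball T M d !=set0); last first.
  by exists 1 => // t j Tt; exfalso; apply: n0; exists t.
have H j : exists B : R, forall t, Tball T M d t -> (Delta D t j)^-1 + Delta D t j <= B.
  have [t1 /set_mem Tt1 H1] := compact_EVT_max n0 cT (@Delta_within M d j).
  have [t2 /set_mem Tt2 H2] := compact_EVT_min n0 cT (@Delta_within M d j).
  exists ((Delta D t2 j)^-1 + Delta D t1 j) => t Tt; apply: lerD; last exact/H1/mem_set.
  rewrite lef_pV2 ?posrE; first exact/H2/mem_set.
    by apply: Delta_gt0; case: Tt.
  by apply: Delta_gt0; case: Tt2.
have [B HB] := choice H.
have [t0 Tt0] := n0.
have B0 j : 0 <= B j.
  have D0 : 0 < Delta D t0 j by apply: Delta_gt0; case: Tt0.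
  by apply: le_trans (HB j _ Tt0); rewrite addr_ge0 ?invr_ge0 ?(ltW D0).
have S0 : 0 <= \sum_j B j by rewrite sumr_ge0.
have BS j : B j <= 1 + \sum_j B j.
  by rewrite (bigD1 j)//= addrCA lerDl addr_ge0// sumr_ge0.
have p1 : 0 < 1 + \sum_j B j by rewrite ltr_pwDl.
exists (1 + \sum_j B j) => // t j Tt.
have D0 : 0 < Delta D t j by apply: Delta_gt0; case: Tt.
have h := le_trans (HB j _ Tt) (BS j).
apply/andP; split; last by apply: le_trans h; rewrite lerDr invr_ge0 ltW.
rewrite -[leRHS]invrK lef_pV2 ?posrE ?invr_gt0//.
by apply: le_trans h; rewrite lerDl ltW.
Qed.

Lemma Delta_pow_ge M d s : 0 < d ->
  exists2 c, 0 < c & forall t, Tball T M d t -> c <= Delta_pow D s t.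
Proof.
move=> d0; have [B B0 HB] := Delta_bounded M d0.
exists (\prod_j expR (- (`|s j| * ln B))); first by rewrite prodr_gt0// => j _; exact: expR_gt0.
move=> t Tt; apply: ler_prod => j _; rewrite expR_ge0/=.
by apply: powR_lower_bound => //; exact: HB.
Qed.

Lemma stabilizer_Delta u j : T u -> e' *m u = e' -> Delta D u j = 1.
Proof.
move=> Tu ue; have [|M [d [d0 HM]]] := proper_Tball hO hT he' (@compact_set1 _ e').
  by move=> _ ->.
have [B B0 HB] := Delta_bounded M d0.
have Tk (k : nat) : T (u ^+ k).
  elim: k => [|k IH]; first by rewrite expr0; exact: (T1 hT).
  by rewrite exprS; exact: (Tmul hT).
have ek (k : nat) : e' *m (u ^+ k) = e'.
  elim: k => [|k IH]; first by rewrite expr0 mulmx1.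
  by rewrite exprS mulmxA ue.
have Dk (k : nat) : Delta D (u ^+ k) j = Delta D u j ^+ k.
  elim: k => [|k IH]; first by rewrite !expr0 Delta1.
  by rewrite !exprS DeltaM ?IH.
have HD (k : nat) := HB _ j (HM _ (Tk k) (ek k)).
have D0 := Delta_gt0 j Tu.
apply/eqP; rewrite eq_le; apply/andP; split.
  apply: (@bounded_exp_le1 _ _ B) => [|k]; first exact: ltW.
  by have := HD k; rewrite Dk => /andP[].
rewrite -[leRHS]invrK -[leLHS]invr1 lef_pV2 ?posrE ?invr_gt0//.
apply: (@bounded_exp_le1 _ _ B) => [|k]; first by rewrite invr_ge0 ltW.
have := HD k; rewrite Dk => /andP[+ _].
rewrite -[B in _ -> _ <= B]invrK exprVn lef_pV2 ?posrE ?invr_gt0//.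
exact: exprn_gt0.
Qed.

(** orbit *)
Definition orbit_of : set 'rV[R]_m := [set lam | exists2 t, T t & e' *m t = lam].

Definition modulus lam j : R := Delta D (xget 1%:M [set t | T t /\ e' *m t = lam]) j.

Lemma modulusE t j : T t -> modulus (e' *m t) j = Delta D t j.
Proof.
move=> Tt; rewrite /modulus.
have [] := @xgetPex _ 1%:M [set u | T u /\ e' *m u = e' *m t] (ex_intro _ t (conj Tt erefl)).
move: (xget _ _) => u /= Tu eu.
have -> : u = (u *m invmx t) *m t by rewrite mulmxKV// (Tunit hT).
have Tv : T (u *m invmx t) by apply: (Tmul hT) => //; exact: (Tinv hT).
by rewrite DeltaM// stabilizer_Delta ?mul1r// mulmxA eu mulmxK// (Tunit hT).
Qed.

Lemma Delta_Omega'E s t : T t -> Delta_Omega' D s (e' *m t) = Delta_pow D s t.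
Proof.
by move=> Tt; apply: eq_bigr => j _; rewrite -/(modulus _ _) modulusE.
Qed.

Lemma Delta_Omega'_out s lam : ~ orbit_of lam -> Delta_Omega' D s lam = 1.
Proof.
move=> nl; rewrite /Delta_Omega' xgetPN ?Delta_pow1// => t [Tt et].
by apply: nl; exists t.
Qed.

Lemma orbit_dual : orbit_of `<=` O'.
Proof. by move=> _ [t Tt <-]; exact: (dual_T hT). Qed.

Lemma orbit_scale lam rho : (forall rho, 0 < rho -> T rho%:M) -> 0 < rho ->
  orbit_of (rho *: lam) <-> orbit_of lam.
Proof.
move=> HT.
have key rho' mu : 0 < rho' -> orbit_of mu -> orbit_of (rho' *: mu).
  move=> r0 [t Tt <-]; exists (rho'%:M *m t); first by apply: (Tmul hT) => //; exact: HT.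
  by rewrite mul_scalar_mx -scalemxAr.
move=> r0; split=> [H|]; last exact: key.
have := key rho^-1 _ _ H; rewrite invr_gt0 => /(_ r0).
by rewrite scalerA mulVf ?gt_eqF// scale1r.
Qed.

Lemma Delta_Omega'_scale s lam rho :
  (forall rho, 0 < rho -> T rho%:M) ->
  (forall rho, 0 < rho -> T rho%:M -> forall s, Delta_pow D s rho%:M = rho `^ (\sum_j s j)) ->
  0 < rho -> orbit_of lam ->
  Delta_Omega' D s (rho *: lam) = rho `^ (\sum_j s j) * Delta_Omega' D s lam.
Proof.
move=> HT HD r0 [t Tt <-].
have -> : rho *: (e' *m t) = e' *m (rho%:M *m t) by rewrite mul_scalar_mx -scalemxAr.
have Tr := HT _ r0.
by rewrite !Delta_Omega'E// ?Delta_powM ?HD//; exact: (Tmul hT).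
Qed.

Definition orbit_le j c : set 'rV[R]_m :=
  [set lam | exists2 t, T t & e' *m t = lam /\ Delta D t j <= c].

Lemma orbit_le_closed j c : closure (orbit_le j c) `&` O' = orbit_le j c.
Proof.
apply/seteqP; split=> [lam [cl Ol]|lam ol]; last first.
  split; first exact: subset_closure.
  by case: ol => t Tt [<- _]; exact: (dual_T hT).
have [e e0 He] := dual_ball hO Ol.
have cH : compact (closed_ball lam e).
  apply: (@compact_mx R _ _ _ (`|lam| + e)); first exact: closed_ball_closed.
  move=> x; rewrite closed_ballE// /closed_ball_ /= => h.
  have -> : x = lam - (lam - x) by rewrite subKr.
  by apply: le_trans (ler_normB _ _) _; rewrite lerD2l.
have [M [d [d0 HM]]] := proper_Tball hO hT he' cH He.
have cS := compact_sublevel (c := c) (Tball_compact hT (M := M) d0) (@Delta_within M d j).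
have cI : compact ((fun t : 'M[R]_m => e' *m t) @` (Tball T M d `&` [set t | Delta D t j <= c])).
  apply: continuous_compact cS; apply: continuous_subspaceT.
  by apply: (@mulmx_continuous _ _ _ _ _ (fun=> e') id) => [t|t]; [exact: cst_continuous|apply: cvg_id].
have clI := compact_closed (@norm_hausdorff _ _) cI.
suff : ((fun t : 'M[R]_m => e' *m t) @` (Tball T M d `&` [set t | Delta D t j <= c])) lam.
  by move=> [t [[Tt _ _] h] <-]; exists t.
apply: clI => B nB.
have nb : nbhs lam (closed_ball lam e).
  by apply: filterS (nbhsx_ballx lam e e0); exact: subset_closed_ball.
have [mu [[t Tt [et h]] [Bmu cmu]]] := cl _ (filterI nB nb).
by exists mu; split => //; exists t => //; split => //; apply: HM => //; rewrite et.
Qed.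

Let row := @row_of R m.

Lemma measurable_orbit_le j c : measurable (row @^-1` orbit_le j c).
Proof.
rewrite -orbit_le_closed preimage_setI; apply: measurableI.
  by apply: measurable_row_of_closed; exact: closed_closure.
by apply: measurable_row_of_open; exact: (dual_open hO).
Qed.

Lemma measurable_orbit (j : 'I_r) : measurable (row @^-1` orbit_of).
Proof.
have -> : row @^-1` orbit_of = \bigcup_k (row @^-1` orbit_le j k%:R).
  apply/seteqP; split=> x /=.
    move=> [t Tt et]; exists (Num.truncn (Delta D t j)).+1 => //.
    by exists t => //; split => //; exact/ltW/truncnS_gt.
  by move=> [k _ [t Tt [et _]]]; exists t.
by apply: bigcup_measurable => k _; exact: measurable_orbit_le.
Qed.

Lemma measurable_modulus j :
  measurable_fun (row @^-1` orbit_of) (fun x => modulus (row x) j).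
Proof.
move=> mD; apply: (measurability _ (RGenOInfty.measurableE R)) => //.
move=> /= _ [_ [c ->] <-].
have -> : row @^-1` orbit_of `&` (fun x => modulus (row x) j) @^-1` `]c, +oo[
    = (row @^-1` orbit_of) `\` (row @^-1` orbit_le j c).
  apply/seteqP; split=> x /=.
    rewrite in_itv/= andbT => -[[t Tt et]]; rewrite -et modulusE// => h; split; first by exists t.
    by move=> [u Tu [eu]]; rewrite -(modulusE j Tu) eu modulusE// leNgt h.
  move=> [[t Tt et] h]; split; first by exists t.
  rewrite in_itv/= andbT ltNge; apply/negP => h2; apply: h; exists t => //; split => //.
  by rewrite -modulusE// [e' *m t]et.
apply: measurableD => //; exact: measurable_orbit_le.
Qed.

Lemma measurable_Delta_Omega' s :
  measurable_fun (row @^-1` orbit_of) (fun x => Delta_Omega' D s (row x)).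
Proof.
apply: measurable_prod => j _.
apply: (measurableT_comp (measurable_powR _)); exact: measurable_modulus.
Qed.

End modulus.

(* FILE H5 *)
Section Phi_on_dual_cone.
Context (R : realType) (n m r : nat) (D : siegel_data R n m r).
Local Notation C := (Cplx R).
Local Notation Re := (@complex.Re R).
Local Notation Im := (@complex.Im R).
Local Notation normc := (@Normc.normc R).
Local Notation E := 'cV[C]_n.
Hypothesis hO : homogeneous_cone (Omega D).
Hypothesis hPhi : Phi_hermitian D.
Hypothesis hnd : Phi_nondegenerate D.
Hypothesis hpos : Phi_positive D.
Local Notation Phi := (Phi D).
Local Notation O' := (dual_cone (Omega D)).
Implicit Types (lam : 'rV[R]_m) (z w : E).

#[local] Opaque cexp toC.

Lemma pairingC0 lam : pairingC lam (0 : 'cV[C]_m) = 0.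
Proof. by rewrite /pairingC mulmx0 mxE. Qed.

Lemma q_pairing lam z x : Phi z z = map_mx toC x -> q D lam z = pairing lam x.
Proof. by move=> e; rewrite /q /L e pairingC_toC cReC. Qed.

Lemma q_dual_ge0 lam z : O' lam -> 0 <= q D lam z.
Proof.
move=> /dual_coercive[//|c c0 H]; have [x Ox e] := hpos z.
by rewrite (q_pairing lam e); apply: le_trans (H x Ox); rewrite mulr_ge0// ltW.
Qed.

Lemma LZr lam a z w : L D lam z (a *: w) = a^* * L D lam z w.
Proof. by rewrite /L PhiZr// pairingCZ. Qed.
Lemma LZl lam a z w : L D lam (a *: z) w = a * L D lam z w.
Proof. by rewrite /L PhiZl// pairingCZ. Qed.

Lemma q_Z lam a z : q D lam (a *: z) = normc a ^+ 2 * q D lam z.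
Proof.
have := Lzz hPhi lam (a *: z); rewrite LZl LZr mulrA mul_conj (Lzz hPhi) -toCM.
by move=> /(congr1 Re); rewrite !cReC.
Qed.

Lemma dual_L_eq0 lam z w : O' lam -> q D lam z = 0 -> L D lam z w = 0.
Proof.
move=> Ol qz; apply: normc_eq0; pose t := (1 + q D lam w)^-1.
have qw := q_dual_ge0 w Ol.
have h := q_dual_ge0 (z + (toC (- t) * L D lam z w) *: w) Ol.
have p : 0 < 1 + q D lam w by rewrite ltr_pwDl.
have t0 : 0 < t by rewrite invr_gt0.
have tq : t * q D lam w < 1 by rewrite mulrC ltr_pdivrMr// mul1r ltrDr.
move: h; rewrite (qD hPhi) qz q_Z LZr cconjM toC_conj -mulrA [_^* * _]mulrC mul_conj.
rewrite cReM !cReC !cImC normcM normc_toC normrN gtr0_norm// exprMn.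
have := normc_ge0 (L D lam z w).
move: (normc (L D lam z w)) (q D lam w) t0 tq qw => a b t0 tq b0 a0 h.
apply/eqP; rewrite -sqrf_eq0 eq_le sqr_ge0 andbT.
have {}h : 0 <= (t * a ^+ 2) * (t * b - 2) by move: h; congr (_ <= _); ring.
rewrite leNgt; apply/negP => a2.
move: h; rewrite leNgt => /negP; apply; rewrite pmulr_rlt0; last by rewrite mulr_gt0.
by lra.
Qed.

Lemma dual_q_eq0 lam z : O' lam -> q D lam z = 0 -> z = 0.
Proof.
move=> Ol qz; have [x Ox e] := hpos z.
have x0 : x = 0.
  have [c c0 H] := dual_coercive hO Ol; have := H x Ox.
  rewrite -(q_pairing lam e) qz pmulr_rle0// normr_le0 => /eqP //.
have q0 mu : q D mu z = 0 by rewrite (q_pairing mu e) x0 /pairing mulmx0 mxE.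
apply: hnd => w; apply/colP => i; rewrite mxE.
have [d d0 Hd] := dual_ball hO Ol.
pose mu := lam + d *: delta_mx 0 i.
have Om : O' mu.
  apply: Hd; rewrite closed_ballE// /closed_ball_ /= /mu opprD addNKr normrN normrZ gtr0_norm//.
  rewrite -[leRHS]mulr1; apply: ler_wpM2l; first exact: ltW.
  by apply: ler_norm_coord => // k l; rewrite mxE; case: (_ && _); rewrite ?normr1 ?normr0.
have h1 := dual_L_eq0 w Ol (q0 _); have h2 := dual_L_eq0 w Om (q0 _).
have : L D mu z w = L D lam z w + toC d * Phi z w i 0.
  rewrite /L; move: (Phi z w) => a; rewrite /pairingC !mxE.
  transitivity (\sum_k (map_mx toC lam 0 k * a k 0 + toC d * ((k == i)%:R * a k 0))).
    apply: eq_bigr => k _; rewrite !mxE eqxx toCD mulrDl /=; congr (_ + _).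
    by rewrite toCM -mulrA; case: (k == i); rewrite ?toC1 ?toC0.
  rewrite big_split /=; congr (_ + _); rewrite -mulr_sumr (bigD1 i)//= eqxx mul1r big1 ?addr0//.
  by move=> k /negPf ->; rewrite mul0r.
rewrite h1 h2 add0r => /(congr1 normc); rewrite normcM normc_toC gtr0_norm//.
rewrite [normc 0](_ : _ = 0) ?normcE ?cRe0 ?cIm0 ?expr0n ?addr0 ?sqrtr0//.
by move=> /esym/eqP; rewrite mulf_eq0 gt_eqF//= -normcE => /eqP/normc_eq0.
Qed.

Lemma q_continuous lam : continuous (fun v : 'rV[R]_(n + n) => q D lam (E_of v)).
Proof.
pose h j k := L D lam (delta_mx j 0) (delta_mx k 0).
pose x (l : 'I_(n + n)) (v : 'rV[R]_(n + n)) := v 0 l.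
have cx l : continuous (x l) by apply: (@mx_coord_continuous _ _ _ _ id) => v; exact: cvg_id.
have -> : (fun v : 'rV[R]_(n + n) => q D lam (E_of v)) = fun v => \sum_j \sum_k
   ((x (lshift n j) v * x (lshift n k) v + x (rshift n j) v * x (rshift n k) v) * Re (h j k)
  - (x (rshift n j) v * x (lshift n k) v - x (lshift n j) v * x (rshift n k) v) * Im (h j k)).
  apply/funext => v; rewrite /q {1}(cV_delta (E_of v)) {2}(cV_delta (E_of v)).
  rewrite /L Phi_suml// (big_morph (pairingC lam) (pairingCD lam) (pairingC0 lam)) cRe_sum.
  apply: eq_bigr => j _.
  rewrite Phi_sumr// (big_morph (pairingC lam) (pairingCD lam) (pairingC0 lam)) cRe_sum.
  apply: eq_bigr => k _; rewrite -/(L D lam _ _) LZl LZr -/(h j k) !E_ofE.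
  rewrite /x; move: (h j k) (v 0 (lshift n j)) (v 0 (rshift n j)) (v 0 (lshift n k)) (v 0 (rshift n k)).
  by move=> a x1 y1 x2 y2; rewrite !cE /=; ring.
have cM (f g : 'rV[R]_(n + n) -> R) : continuous f -> continuous g -> continuous (fun v => f v * g v).
  by move=> cf cg v; apply: (@continuousM _ _ f g); [exact: cf|exact: cg].
have cD (f g : 'rV[R]_(n + n) -> R) : continuous f -> continuous g -> continuous (fun v => f v + g v).
  by move=> cf cg v; apply: (@continuousD _ _ _ f g); [exact: cf|exact: cg].
have cN (f : 'rV[R]_(n + n) -> R) : continuous f -> continuous (fun v => - f v).
  by move=> cf v; apply: (@continuousN _ _ _ f); exact: cf.
have cC (a : R) : continuous (fun _ : 'rV[R]_(n + n) => a) by move=> v; exact: cst_continuous.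
apply: sum_continuous => j; apply: sum_continuous => k.
apply: (cD _ _); [|apply: (cN _)]; apply: (cM _ _ _ (cC _)).
  by apply: (cD _ _); apply: (cM _ _); exact: cx.
by apply: (cD _ _); [|apply: (cN _)]; apply: (cM _ _); exact: cx.
Qed.

Lemma vecE_Z a z : vecE (toC a *: z) = a *: vecE z.
Proof.
apply/rowP => l; rewrite [RHS]mxE; case: (split_ordP l) => k ->.
  by rewrite !row_mxEl !mxE cReM cReC cImC mul0r subr0.
by rewrite !row_mxEr !mxE cImM cReC cImC mul0r addr0.
Qed.

Lemma dual_q_coercive lam : O' lam ->
  exists2 c, 0 < c & forall z, c * `|vecE z| ^+ 2 <= q D lam z.
Proof.
move=> Ol; pose S : set 'rV[R]_(n + n) := [set v | `|v| = 1].
have cS : compact S.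
  apply: (@compact_mx R _ _ _ 1); last by move=> v /= ->.
  by apply: (@preimage_closed _ _ (fun v : 'rV[R]_(n + n) => `|v|) [set y | y = 1]) => [v _|];
    [exact: norm_continuous|exact: closed_eq].
have red c : 0 < c -> (forall v, S v -> c <= q D lam (E_of v)) ->
    exists2 c, 0 < c & forall z, c * `|vecE z| ^+ 2 <= q D lam z.
  move=> c0 Hc; exists c => // z; have [v0|v0] := eqVneq (vecE z) 0.
    by rewrite v0 normr0 expr0n mulr0; exact: q_dual_ge0.
  have nv : 0 < `|vecE z| by rewrite normr_gt0.
  have := Hc (`|vecE z|^-1 *: vecE z); rewrite -vecE_Z vecEK q_Z normc_toC.
  rewrite /S /= vecE_Z normrZ gtr0_norm ?invr_gt0// mulVf ?gt_eqF// => /(_ erefl).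
  by rewrite exprVn mulrC ler_pdivlMr// exprn_gt0.
have [S0|S0] := pselect (S !=set0); last first.
  by apply: (red 1) => // v Sv; exfalso; apply: S0; exists v.
have [v0 /set_mem Sv0 Hmin] := compact_EVT_min S0 cS (continuous_subspaceT (@q_continuous lam)).
apply: (red (q D lam (E_of v0))) => [|v Sv]; last exact/Hmin/mem_set.
rewrite lt_neqAle eq_sym q_dual_ge0// andbT; apply/eqP => /(dual_q_eq0 Ol) e0.
have := Sv0; rewrite /S /= -[v0]E_ofK e0 => e1.
have : vecE (0 : E) = 0 by rewrite -[in LHS](scaler0 _ (toC 0)) vecE_Z scale0r.
by move=> e2; move: e1; rewrite e2 normr0 => /eqP; rewrite eq_sym oner_eq0.
Qed.

Lemma dual_not_W lam : O' lam -> ~ W D lam.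
Proof.
move=> Ol [z z0 H]; move: z0; rewrite (dual_q_eq0 (z := z) Ol) ?eqxx//.
by rewrite /q /L H.
Qed.

(** N *)
Definition gram lam : 'M[C]_n :=
  \matrix_(j, k) L D lam (delta_mx k 0) (delta_mx j 0).

Lemma L_dotE lam z w : L D lam z w = dotE (gram lam *m z) w.
Proof.
rewrite {1}(cV_delta z) {1}(cV_delta w) /L Phi_suml//.
rewrite (big_morph (pairingC lam) (pairingCD lam) (pairingC0 lam)).
under eq_bigr do rewrite Phi_sumr// (big_morph (pairingC lam) (pairingCD lam) (pairingC0 lam)).
rewrite exchange_big /=; apply: eq_bigr => k _; rewrite mxE mulr_suml; apply: eq_bigr => j _.
by rewrite -/(L D lam _ _) LZl LZr mxE mulrCA [z _ _ * _]mulrC [LHS]mulrC.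
Qed.

Lemma dotE_adjoint (A : 'M[C]_n) z w : dotE (A *m z) w = dotE z (adjoint A *m w).
Proof.
rewrite /dotE; under eq_bigr do rewrite mxE mulr_suml.
rewrite exchange_big /=; apply: eq_bigr => k _; rewrite mxE rmorph_sum mulr_sumr.
apply: eq_bigr => j _; rewrite !mxE rmorphM /= conjCK.
by rewrite mulrCA mulrA.
Qed.

Lemma dotE_delta z k : dotE z (delta_mx k 0) = z k 0.
Proof.
rewrite /dotE (bigD1 k)//= mxE !eqxx conjC1 mulr1 big1 ?addr0// => j /negPf jk.
by rewrite mxE jk conjC0 mulr0.
Qed.

Lemma dotE_inj z z' : (forall w, dotE z w = dotE z' w) -> z = z'.
Proof. by move=> H; apply/colP => k; rewrite -!dotE_delta H. Qed.

Lemma dotE_C z w : dotE w z = (dotE z w)^*.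
Proof.
rewrite /dotE rmorph_sum; apply: eq_bigr => k _; rewrite rmorphM /= conjCK; exact: mulrC.
Qed.

Lemma gram_adjoint lam : adjoint (gram lam) = gram lam.
Proof.
apply/matrixP => j k; rewrite !mxE; symmetry; exact: LC.
Qed.

Lemma J_E lam : J_ D lam = 'i *: gram lam.
Proof.
have key J : (forall z w, pairingC lam (Phi z w) = dotE z (- ('i : C) *: (J *m w))) <->
    J = 'i *: gram lam.
  have e1 z w : pairingC lam (Phi z w) = dotE z (gram lam *m w).
    by rewrite -/(L D lam z w) L_dotE dotE_adjoint gram_adjoint.
  have ii : - ('i : C) * 'i = 1 by rewrite mulNr -expr2 sqrCi opprK.
  split=> [H|-> z w]; last by rewrite e1 -scalemxAl scalerA ii scale1r.
  apply/matrixP => a b.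
  have : gram lam *m (delta_mx b 0 : E) = - ('i : C) *: (J *m (delta_mx b 0 : E)).
    apply: dotE_inj => w; rewrite dotE_C [RHS]dotE_C -H e1 //.
  move=> /matrixP/(_ a 0); rewrite -!colE !mxE => ->.
  by rewrite mulrA mulrC -[_ * - _]mulrC ii mulr1.
apply: (proj1 (key _)); rewrite /J_.
apply: (@xgetPex _ 0 [set J | forall z w, pairingC lam (Phi z w) = dotE z (- ('i : C) *: (J *m w))]).
by exists ('i *: gram lam); apply/key.
Qed.

Lemma mxtrace_dotE (A : 'M[C]_n) : \tr A = \sum_k dotE (A *m delta_mx k 0) (delta_mx k 0).
Proof. by apply: eq_bigr => k _; rewrite dotE_delta -colE mxE. Qed.

Lemma abs_J lam : O' lam -> abs_mx (J_ D lam) = gram lam.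
Proof.
move=> Ol; set H := gram lam.
have HH : adjoint H = H := gram_adjoint lam.
have AJ : adjoint (J_ D lam) *m J_ D lam = H *m H.
  have -> : adjoint (J_ D lam) = - 'i *: H.
    rewrite J_E -/H -[in RHS]HH; apply/matrixP => a b; rewrite !mxE rmorphM /= conjCi.
    by [].
  by rewrite J_E -scalemxAl -scalemxAr scalerA mulNr -expr2 sqrCi opprK scale1r.
have Hpos z : 0 <= dotE (H *m z) z.
  by rewrite -L_dotE (Lzz hPhi) -[0](@toC0 R) lec_toC; exact: q_dual_ge0.
have H0 z : dotE (H *m z) z = 0 -> z = 0.
  rewrite -L_dotE => h; apply: (dual_q_eq0 Ol); by rewrite /q h.
have uniq B : [/\ adjoint B = B, (forall z, 0 <= dotE (B *m z) z) &
    B *m B = adjoint (J_ D lam) *m J_ D lam] -> B = H.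
  move=> [BB Bpos]; rewrite AJ => e; pose X := B - H; pose S := B + H.
  have XX : adjoint X = X.
    by rewrite /X -[in RHS]BB -[in RHS]HH; apply/matrixP => a b; rewrite !mxE rmorphB.
  have XS : X *m S = - (S *m X).
    rewrite /X /S !(mulmxDl, mulmxBl, mulmxDr, mulmxBr, mulNmx, mulmxN) e.
    move: (B *m H) (H *m B) (H *m H) => u v w.
    by apply/matrixP => a b; rewrite !mxE; ring.
  have t0 : \tr (X *m S *m X) = 0.
    have : \tr (X *m S *m X) = - \tr (X *m S *m X).
      by rewrite {1}XS mulNmx raddfN /= mxtrace_mulC mulmxA.
    by move=> /esym/eqP; rewrite eqNr => /eqP.
  have tE A : \tr (X *m A *m X) = \sum_k dotE (A *m (X *m delta_mx k 0)) (X *m delta_mx k 0).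
    rewrite mxtrace_dotE; apply: eq_bigr => k _.
    by rewrite -!mulmxA dotE_adjoint XX !mulmxA.
  have s0 k : dotE (H *m (X *m delta_mx k 0)) (X *m delta_mx k 0) = 0.
    have dD (u v w : E) : dotE (u + v) w = dotE u w + dotE v w.
      by rewrite /dotE -big_split; apply: eq_bigr => j _; rewrite mxE mulrDl.
    have p0 j : 0 <= dotE (S *m (X *m delta_mx j 0)) (X *m delta_mx j 0).
      by rewrite /S mulmxDl dD addr_ge0.
    have := t0; rewrite tE => /eqP; rewrite psumr_eq0 => [|j _]; last exact: p0.
    move=> /allP/(_ k (mem_index_enum _)) /=; rewrite /S mulmxDl dD.
    by rewrite paddr_eq0 => // /andP[_ /eqP].
  apply/eqP; rewrite -subr_eq0 -/X; apply/eqP/matrixP => a k.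
  have /matrixP/(_ a 0) := H0 _ (s0 k); by rewrite -colE !mxE.
apply: uniq; rewrite /abs_mx.
apply: (@xgetPex _ 0 [set B | [/\ adjoint B = B, (forall z, 0 <= dotE (B *m z) z) &
    B *m B = adjoint (J_ D lam) *m J_ D lam]]).
by exists H; split.
Qed.

Lemma N_E lam : O' lam ->
  N_ D lam = (\sum_k q D lam (delta_mx k 0)) ^+ 2 + \sum_i lam 0 i ^+ 2.
Proof.
move=> Ol; rewrite /N_ abs_J// mxtrace_dotE cRe_sum; congr (_ ^+ 2 + _).
by apply: eq_bigr => k _; rewrite -L_dotE.
Qed.

Lemma q_homogeneous rho lam z : q D (rho *: lam) z = rho * q D lam z.
Proof.
by have [x _ e] := hpos z; rewrite !(q_pairing _ e) /pairing -scalemxAl mxE.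
Qed.

Lemma N_homogeneous rho lam : 0 < rho -> O' lam -> N_ D (rho *: lam) = rho ^+ 2 * N_ D lam.
Proof.
move=> r0 Ol; rewrite !N_E//.
  rewrite mulrDr -exprMn !mulr_sumr; congr (_ ^+ 2 + _).
    by apply: eq_bigr => k _; rewrite q_homogeneous.
  by apply: eq_bigr => k _; rewrite mxE exprMn.
by move=> x Ox x0; rewrite /pairing -scalemxAl mxE mulr_gt0//; exact: Ol.
Qed.

Lemma N_bounds : exists2 B, 0 < B & forall lam, O' lam ->
  `|lam| ^+ 2 <= N_ D lam <= B * `|lam| ^+ 2.
Proof.
have /choice[x Hx] : forall k, exists x : 'cV[R]_m,
    Phi (delta_mx k 0) (delta_mx k 0) = map_mx toC x.
  by move=> k; have [x _ e] := hpos (delta_mx k 0); exists x.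
pose A := \sum_k m%:R * `|x k|; have A0 : 0 <= A by rewrite sumr_ge0// => k _; rewrite mulr_ge0.
exists (A ^+ 2 + m%:R + 1).
  by rewrite ltr_wpDl// addr_ge0// sqr_ge0.
move=> lam Ol; rewrite N_E//; apply/andP; split.
  have s0 : 0 <= \sum_i lam 0 i ^+ 2 by rewrite sumr_ge0// => i _; rewrite sqr_ge0.
  apply: (@le_trans _ _ (\sum_i lam 0 i ^+ 2)); last by rewrite lerDr sqr_ge0.
  rewrite -[leRHS]sqr_sqrtr// ler_sqr ?nnegrE ?sqrtr_ge0//.
  apply: ler_norm_coord; first exact: sqrtr_ge0.
  move=> i j; rewrite (ord1 i) -sqrtr_sqr ler_wsqrtr// (bigD1 j)//= lerDl.
  by rewrite sumr_ge0// => k _; rewrite sqr_ge0.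
have h1 : \sum_k q D lam (delta_mx k 0) <= A * `|lam|.
  rewrite /A mulr_suml; apply: ler_sum => k _; rewrite (q_pairing _ (Hx k)).
  by apply: le_trans (ler_norm _) _; rewrite mulrAC; exact: ler_pairing.
have h0 : 0 <= \sum_k q D lam (delta_mx k 0).
  by rewrite sumr_ge0// => k _; exact: q_dual_ge0.
have h2 : \sum_i lam 0 i ^+ 2 <= m%:R * `|lam| ^+ 2.
  have -> : m%:R * `|lam| ^+ 2 = \sum_(i < m) `|lam| ^+ 2.
    by rewrite sumr_const card_ord mulr_natl.
  apply: ler_sum => i _; rewrite -real_normK ?num_real// ler_sqr ?nnegrE//.
  exact: ler_coord_norm.
have h3 : (\sum_k q D lam (delta_mx k 0)) ^+ 2 <= A ^+ 2 * `|lam| ^+ 2.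
  by rewrite -exprMn ler_sqr ?nnegrE// mulr_ge0.
have := sqr_ge0 `|lam|; rewrite !mulrDl mul1r; move: (`|lam| ^+ 2) h2 h3 => y *; lra.
Qed.

End Phi_on_dual_cone.

(* FILE H6 *)
Lemma ell_single (R : realType) (q : \bar R) (K : choiceType) (A : set K) (a : K -> \bar R) k :
  (0 < q)%E -> A k -> (0 <= a k)%E -> (forall i, i <> k -> a i = 0%E) ->
  (ell q A a <= a k)%E.
Proof.
move=> q0 Ak ak a0; case: q q0 => [q| |] //=; last first.
  move=> _; apply: ge_ereal_sup => _ [->//|[i Ai <-]].
  by have [->//|ik] := pselect (i = k); rewrite a0.
rewrite lte_fin => q0.
rewrite (_ : \esum_(i in A) _ = (a k `^ q)%E).
  by rewrite -poweRrM mulfV ?gt_eqF// poweRe1.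
rewrite -(@esum_set1 _ _ k (fun i => a i `^ q)%E) ?poweR_ge0//.
rewrite esum_mkcond [RHS]esum_mkcond; apply: eq_esum => i _.
have [->|ik] := pselect (i = k); first by rewrite !mem_set.
by rewrite [i \in [set k]]memNset// a0// poweR0r ?gt_eqF//; case: ifP.
Qed.

Lemma dual_norm_gt0 (R : realType) m (O : set 'cV[R]_m) lam : homogeneous_cone O ->
  (0 < m)%N -> dual_cone O lam -> 0 < `|lam|.
Proof.
move=> hO m0 Ol; rewrite normr_gt0; apply/eqP => l0.
have [x] : exists2 x, O x & x != 0.
  have [[[x0 Ox0] oO _ _] _] := hO; have [x00|] := eqVneq x0 0; last by exists x0.
  have /nbhs_ballP[e /= e0 eO] := open_nbhs_nbhs (conj oO Ox0).
  pose v : 'cV[R]_m := const_mx (e / 2).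
  have e2 : 0 < e / 2 by rewrite divr_gt0.
  exists v; last by apply/eqP => /matrixP/(_ (Ordinal m0) 0)/eqP; rewrite !mxE gt_eqF.
  apply: eO; rewrite -ball_normE /= x00 sub0r normrN.
  apply: (@le_lt_trans _ _ (e / 2)); last by rewrite ltr_pdivrMr// mulr_natr mulr2n ltrDl.
  by apply: ler_norm_coord => [|i j]; rewrite ?mxE ?gtr0_norm// ltW.
by move=> Ox x0; have := Ol x (Omega_closure Ox) x0; rewrite l0 /pairing mul0mx mxE ltxx.
Qed.

Section claimA.
Context (R : realType) (n m r : nat) (D : siegel_data R n m r).
Local Notation C := (Cplx R).
Local Notation N := ('cV[C]_n * 'cV[R]_m)%type.
Local Notation T := (Tplus D).
Local Notation e' := (e_Omega' D).
Local Notation O' := (dual_cone (Omega D)).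
Hypothesis hO : homogeneous_cone (Omega D).
Hypothesis hT : triangular_simply_transitive (Omega D) T.
Hypothesis hA : abelianization T (Delta D).
Hypothesis hPhi : Phi_hermitian D.
Hypothesis hnd : Phi_nondegenerate D.
Hypothesis hpos : Phi_positive D.
Hypothesis he' : O' e'.

Lemma convN0 (g : N -> C) : Defs.convN D (fun=> 0) g = fun=> 0.
Proof.
apply/funext => y; rewrite /Defs.convN /Defs.integralN -[RHS](cintegral0 (leb R (n + n + m))).
by apply: eq_cintegral => x; rewrite mul0r.
Qed.

Lemma LpN0 (p : \bar R) : (0 < p)%E -> LpN p (fun _ : N => 0 : C) = 0%E.
Proof.
move=> p0; rewrite /LpN -[RHS](@Lnorm0 _ _ _ (leb R (n + n + m)) p) ?gt_eqF//.
by congr Lnorm; apply/funext => x; rewrite Normc.normc0.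
Qed.

Lemma property_D'_bound s (p q : \bar R) : (0 < p)%E -> (0 < q)%E -> property_D' D s p q ->
  exists2 c, 0 < c & forall lam, orbit_of D lam -> N_ D lam = 1 -> c <= Delta_Omega' D s lam.
Proof.
move=> p0 q0 [delta [rho [K [lamk [tk [phi [psi [M [c]]]]]]]]] /=.
move=> [[_ _ M0 c1] [[_ Htk Hphi phi0 Hsum] [Hpsi Hineq]]].
have [_ [[H [cH HO Hout]] _]] := Hphi.
have [M' [d [d0 HM]]] := proper_Tball hO hT he' cH HO.
have [b b0 Hb] := Delta_pow_ge hT hA M' s d0.
exists (b * M^-1); first by rewrite mulr_gt0// invr_gt0.
move=> lam [t Tt et] Nlam; have Ol : O' lam by rewrite -et; exact: (dual_T hT).
have [k pk] : exists k, phi k (lam *m invmx (tk k)) != 0.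
  apply: contrapT => /forallNP no; have := Hsum _ Ol.
  rewrite esum1 ?lee_fin ?ler10// => k _; apply/eqP; rewrite eqe.
  by apply: contrapT => /negP; exact: no.
have [Ttk ek] := Htk k.
have Kk : [set k | exists lam, [/\ phi k (lam *m invmx (tk k)) != 0,
    c^-1 <= N_ D lam & N_ D lam <= c]] k.
  by exists lam; split => //; rewrite Nlam ?invf_le1 ?ltW// (lt_trans ltr01).
have [Spsi Tpsi] := Hpsi k.
have [S1 S0] := S_OmegaL_neq0 hPhi Spsi.
pose u i : N -> C := if i == k then Defs.convN D (psi k) (psi k) else fun=> 0.
have ui i : i <> k -> Defs.convN D (u i) (psi i) = fun=> 0.
  by move=> /eqP/negPf ik; rewrite /u ik convN0.
have uk : Defs.convN D (u k) (psi k) = Defs.convN D (Defs.convN D (psi k) (psi k)) (psi k).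
  by rewrite /u eqxx.
have := Hineq u _ _; rewrite -/(N_ D).
set X := LpN p (Defs.convN D (Defs.convN D (psi k) (psi k)) (psi k)).
have /andP[X0 Xoo] : (0 < X < +oo)%E.
  apply: (convolution_cube hPhi Spsi (dual_q_coercive hO hPhi hnd hpos Ol) Ol
    (dual_not_W hO hPhi hnd hpos Ol) (Tpsi _ Ol) _ p0).
  apply: contra pk => /eqP e0; apply/eqP.
  by have := congr1 (@complex.Re R) e0.
have -> : (fun y => \sum_(i \in [set k | exists lam, [/\ phi k (lam *m invmx (tk k)) != 0,
    c^-1 <= N_ D lam & N_ D lam <= c]]) Defs.convN D (u i) (psi i) y)
    = Defs.convN D (Defs.convN D (psi k) (psi k)) (psi k).
  apply/funext => y; rewrite -(@fsbig_widen _ _ _ _ [set k]).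
  - by rewrite fsbig_set1 uk.
  - by move=> _ ->.
  - by move=> i [_ /= ik]; rewrite ui.
move=> /(_ _ _)/wrap[].
  by move=> i _; rewrite /u; case: ifP.
  apply: (@sub_finite_set _ _ [set k]) => [i [_ /=]|]; last exact: finite_set1.
  by rewrite /u; case: eqP => // _ [].
move=> h.
have Dk0 : 0 < Delta_pow D s (tk k) by exact: (Delta_pow_gt0 hA).
have {}h : (X <= M%:E * ((Delta_pow D s (tk k))%:E * X))%E.
  apply: le_trans h _; apply: lee_wpmul2l; first by rewrite lee_fin ltW.
  have := @ell_single R q K _ (fun i => (Delta_Omega' D s (lamk i))%:E * LpN p (Defs.convN D (u i) (psi i)))%E k q0 Kk.
  rewrite uk -/X ek (Delta_Omega'E hO hT hA he')//; apply.
    by rewrite mule_ge0 ?lee_fin ?ltW.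
  by move=> i ik; rewrite ui// LpN0// mule0.
have fX : X \is a fin_num by rewrite ge0_fin_numE ?ltW.
move: h X0; rewrite -(fineK fX) -!EFinM lee_fin lte_fin mulrA => h X0.
have {}h : 1 <= M * Delta_pow D s (tk k) by rewrite -(ler_pM2r X0) mul1r.
have Tq : T (t *m invmx (tk k)) by apply: (Tmul hT) => //; exact: (Tinv hT).
have hq : Tball T M' d (t *m invmx (tk k)).
  apply: HM => //; rewrite mulmxA et; apply: contrapT => /Hout e0.
  by move: pk; rewrite e0 eqxx.
rewrite -et (Delta_Omega'E hO hT hA he')// -[t](mulmxKV (Tunit hT Ttk)) (Delta_powM hA)//.
apply: ler_pM; rewrite ?invr_ge0 ?(ltW b0) ?(ltW M0)//; first exact: Hb.
by rewrite -[leRHS]mulr1 -(mulfV (lt0r_neq0 M0)) mulrCA mulrA mulrC ler_peMr ?invr_ge0 ?(ltW M0)// mulrC.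
Qed.

Hypothesis hH : forall rho, 0 < rho -> T rho%:M.
Hypothesis hD : forall rho, 0 < rho -> T rho%:M ->
  forall s, Delta_pow D s rho%:M = rho `^ (\sum_j s j).

Lemma property_D'_lower_bound s (p q : \bar R) : (0 < m)%N ->
  (0 < p)%E -> (0 < q)%E -> property_D' D s p q ->
  exists2 c, 0 < c & forall lam, orbit_of D lam ->
    c * `|lam| `^ (\sum_j s j) <= Delta_Omega' D s lam.
Proof.
move=> m0 p0 q0 hp; have [c c0 Hc] := property_D'_bound p0 q0 hp.
have [B B0 HB] := N_bounds hO hPhi hnd hpos.
set sg := \sum_j s j.
pose b := Num.sqrt B + 1; have b0 : 0 < b by rewrite ltr_wpDl// sqrtr_ge0.
exists (c * expR (- (`|sg| * ln b))); first by rewrite mulr_gt0// expR_gt0.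
move=> lam Ol; have Odl := orbit_dual hT he' Ol.
have nl : 0 < `|lam| := dual_norm_gt0 hO m0 Odl.
have /andP[N1 N2] := HB _ Odl.
have N0 : 0 < N_ D lam by apply: lt_le_trans N1; rewrite exprn_gt0.
pose nu := Num.sqrt (N_ D lam); have nu0 : 0 < nu by rewrite sqrtr_gt0.
have nu2 : nu ^+ 2 = N_ D lam by rewrite sqr_sqrtr// ltW.
have N_1 : N_ D (nu^-1 *: lam) = 1.
  by rewrite (N_homogeneous hO hPhi hnd hpos) ?invr_gt0// exprVn nu2 mulVf// gt_eqF.
have Ol' : orbit_of D (nu^-1 *: lam) by apply/(orbit_scale hT lam hH _); rewrite ?invr_gt0.
have := Hc _ Ol' N_1.
have -> : Delta_Omega' D s lam = nu `^ sg * Delta_Omega' D s (nu^-1 *: lam).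
  rewrite -(Delta_Omega'_scale hO hT hA he')// scalerA mulfV ?gt_eqF// scale1r//.
pose ka := nu / `|lam|; have nE : nu = ka * `|lam| by rewrite mulfVK// gt_eqF.
have ka0 : 0 < ka by rewrite divr_gt0.
have kb : b^-1 <= ka <= b.
  apply/andP; split.
    apply: (@le_trans _ _ 1); first by rewrite invf_le1// lerDr sqrtr_ge0.
    rewrite ler_pdivlMr// mul1r -ler_sqr ?nnegrE ?(ltW nu0)// nu2 //.
  apply: (@le_trans _ _ (Num.sqrt B)); last by rewrite lerDl.
  rewrite ler_pdivrMr// -ler_sqr ?nnegrE ?(ltW nu0) ?mulr_ge0 ?sqrtr_ge0//.
  by rewrite nu2 exprMn sqr_sqrtr ?(ltW B0).
move=> h; rewrite -mulrA (mulrC c); apply: ler_pM => //; first exact: ltW.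
rewrite nE powRM ?(ltW ka0)//; apply: ler_wpM2r; first exact: powR_ge0.
exact: powR_lower_bound.
Qed.

End claimA.

(* FILE H7 *)
Section density.
Context d (T : measurableType d) (R : realType) (mu : {measure set T -> \bar R}) (f : T -> \bar R).
Hypothesis mf : measurable_fun setT f.
Hypothesis f0 : forall x, (0 <= f x)%E.

Definition density_measure (A : set T) : \bar R := (\int[mu]_(x in A) f x)%E.

Let density0 : density_measure set0 = 0%E.
Proof. exact: integral_set0. Qed.

Let density_ge0 A : (0 <= density_measure A)%E.
Proof. exact: integral_ge0. Qed.

Let density_additive : semi_sigma_additive density_measure.
Proof.
move=> F mF tF mUF; rewrite /density_measure ge0_integral_bigcup//; last first.
  exact: measurable_funTS.
by apply: is_cvg_nneseries => i _ _; exact: integral_ge0.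
Qed.

HB.instance Definition _ := isMeasure.Build _ _ _ density_measure
  density0 density_ge0 density_additive.

Lemma density_exists : exists nu : {measure set T -> \bar R},
  forall A, nu A = (\int[mu]_(x in A) f x)%E.
Proof. by exists density_measure. Qed.

End density.

Section claimC.
Context (R : realType) (n m r : nat) (D : siegel_data R n m r).
Local Notation T := (Tplus D).
Local Notation e' := (e_Omega' D).
Local Notation O' := (dual_cone (Omega D)).
Hypothesis m0 : (0 < m)%N.
Hypothesis hO : homogeneous_cone (Omega D).
Hypothesis hT : triangular_simply_transitive (Omega D) T.
Hypothesis hA : abelianization T (Delta D).
Hypothesis he' : O' e'.
Hypothesis hH : forall rho, 0 < rho -> T rho%:M.
Hypothesis hD : forall rho, 0 < rho -> T rho%:M ->
  forall s, Delta_pow D s rho%:M = rho `^ (\sum_j s j).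
Local Notation tup := (m.-tuple (measurableTypeR R)).
Let row : tup -> 'rV[R]_m := @row_of R m.
Let Orb : set tup := row @^-1` orbit_of D.
Let Ball (b : R) : set tup := row @^-1` [set lam | `|lam| <= b].
Variable j0 : 'I_r.

Let mOrb : measurable Orb. Proof. exact: (measurable_orbit hO hT hA he' j0). Qed.

Lemma measurable_Ball b : measurable (Ball b).
Proof.
apply: measurable_row_of_closed.
by apply: (@preimage_closed _ _ (fun x : 'rV[R]_m => `|x|) [set y | y <= b]) => [x _|];
  [exact: norm_continuous|exact: closed_le].
Qed.

Lemma leb_Ball_lty b : 0 <= b -> (leb R m (Ball b) < +oo)%E.
Proof.
move=> b0; have -> : Ball b = [set x | forall i, `[-b, b]%classic (tnth x i)].
  apply/seteqP; split=> x /=.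
    move=> H i; rewrite /= in_itv/= -ler_norml; have := ler_coord_norm (row x) 0 i.
    by rewrite /row mxE => /le_trans; apply.
  move=> H; apply: ler_norm_coord => // i j; have := H j.
  by rewrite (ord1 i) /row mxE /= in_itv/= -ler_norml.
rewrite (@leb_box R m (fun=> `[-b, b]%classic)) => [|i]; last exact: measurable_itv.
rewrite big_const_ord lebesgue_measure_itv/=.
elim: m => [|k IH] /=; first exact: ltry.
by apply: lte_mul_pinfty => //; case: ifP => // _; rewrite -EFinB ?lee_fin ?ltry// subr_ge0; lra.
Qed.

Definition orbit_mass (e : 'I_r -> R) b : \bar R :=
  (\int[leb R m]_(x in Orb `&` Ball b) (Delta_Omega' D e (row x))%:E)%E.

Lemma orbit_mass_lty e b : 0 <= b ->
  extends_to_radon row O' (Delta_Omega' D e) -> (orbit_mass e b < +oo)%E.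
Proof.
move=> b0 [mu [muK muA]].
pose A := orbit_of D `&` [set lam | `|lam| <= b].
have mA : measurable (row @^-1` A).
  by rewrite preimage_setI; apply: measurableI => //; exact: measurable_Ball.
rewrite /orbit_mass -preimage_setI -[X in (X < _)%E]muA//; last first.
  by move=> lam [Ol _]; exact: (orbit_dual hT he').
pose K := closure O' `&` [set lam | `|lam| <= b].
have clK : closed K.
  apply: closedI; first exact: closed_closure.
  by apply: (@preimage_closed _ _ (fun x : 'rV[R]_m => `|x|) [set y | y <= b]) => [x _|];
    [exact: norm_continuous|exact: closed_le].
apply: (@le_lt_trans _ _ (mu (row @^-1` K))).
  have mK : measurable (row @^-1` K) by apply: (@measurable_row_of_closed R m K).
  apply: le_measure; [exact: mem_set|exact: mem_set|].
  by move=> x [Ox bx]; split => //; apply: subset_closure; exact: (orbit_dual hT he').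
apply: muK; last by move=> lam [].
by apply: (@compact_mx R _ _ _ b) => // lam [].
Qed.

Lemma orbit_mass_ge0 e b : (0 <= orbit_mass e b)%E.
Proof.
apply: integral_ge0 => x _; rewrite lee_fin; apply: prodr_ge0 => j _; exact: powR_ge0.
Qed.

Let mDelta e : measurable_fun Orb (fun x => (Delta_Omega' D e (row x))%:E).
Proof. by apply/measurable_EFinP; exact: (measurable_Delta_Omega' hO hT hA he'). Qed.

Let Delta_ge0 e lam : 0 <= Delta_Omega' D e lam.
Proof. by apply: prodr_ge0 => j _; exact: powR_ge0. Qed.

Lemma orbit_mass_scale e rho b : 0 < rho ->
  orbit_mass e (rho * b) = ((rho `^ (\sum_j e j) * rho ^+ m)%:E * orbit_mass e b)%E.
Proof.
move=> r0; pose Tm (x : tup) : tup := tup_of (rho *: row x).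
have rowT x : row (Tm x) = rho *: row x by rewrite /row /Tm row_ofK.
have mT : measurable_fun setT Tm.
  apply/measurable_fun_tnthP => i /=.
  rewrite (_ : _ \o _ = fun x : tup => rho * (tnth x i : R)); last first.
    by apply/funext => x /=; rewrite tnth_mktuple !mxE.
  by apply: measurable_funM => //; exact: measurable_tnth.
have lebT A : measurable A -> leb R m (Tm @^-1` A) = (((rho^-1) ^+ m)%:E * leb R m A)%E.
  apply: leb_triangular => // i x y _.
  by rewrite !tnth_mktuple !mxE !subrr.
pose f := ((fun x => (Delta_Omega' D e (row x))%:E) \_ (Orb `&` Ball (rho * b)))%E.
have mOB c : measurable (Orb `&` Ball c) by apply: measurableI => //; exact: measurable_Ball.
have mf : measurable_fun setT f.
  by apply/(measurable_restrictT _ _).1 => //; apply: measurable_funS (mDelta e).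
have f0 x : (0 <= f x)%E by apply: erestrict_ge0 => y _; rewrite lee_fin.
have rm0 : 0 <= rho^-1 ^+ m by rewrite exprn_ge0// invr_ge0 ltW.
have h1 : (\int[leb R m]_x f (Tm x) = (rho^-1 ^+ m)%:E * \int[leb R m]_x f x)%E.
  have := @ge0_integral_pushforward _ _ _ _ R Tm mT (leb R m) setT f measurableT mf.
  rewrite preimage_setT => <-; last by move=> y _; exact: f0.
  rewrite -(@ge0_integral_mscale _ _ _ (leb R m) setT measurableT (NngNum rm0) f)//.
  by apply: eq_measure_integral => A mA _; exact: lebT.
have h2 x : f (Tm x) = ((rho `^ (\sum_j e j))%:E *
    ((fun x => (Delta_Omega' D e (row x))%:E) \_ (Orb `&` Ball b)) x)%E.
  rewrite /f /patch.
  have -> : (Tm x \in Orb `&` Ball (rho * b)) = (x \in Orb `&` Ball b).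
    have key : (Orb `&` Ball (rho * b)) (Tm x) <-> (Orb `&` Ball b) x.
      rewrite -[(Orb `&` _) (Tm x)]/(orbit_of D (row (Tm x)) /\ `|row (Tm x)| <= rho * b).
      rewrite -[(Orb `&` _) x]/(orbit_of D (row x) /\ `|row x| <= b).
      rewrite rowT normrZ gtr0_norm// ler_pM2l//.
      by split=> -[h3 h4]; split => //; apply/(orbit_scale hT (row x) hH r0).
    by apply/idP/idP => /set_mem h3; apply/mem_set/key.
  case: ifPn => [|_]; last by rewrite mule0.
  move=> /set_mem[Ox _].
  by rewrite rowT (Delta_Omega'_scale hO hT hA he')// EFinM.
have h3 : (\int[leb R m]_x f (Tm x) = (rho `^ (\sum_j e j))%:E * orbit_mass e b)%E.
  under eq_integral do rewrite h2.
  rewrite ge0_integralZl//.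
  - by rewrite /orbit_mass [in RHS]integral_mkcond.
  - by apply/(measurable_restrictT _ _).1 => //; apply: measurable_funS (mDelta e).
  - by move=> x _; apply: erestrict_ge0 => y _; rewrite lee_fin.
  - by rewrite lee_fin powR_ge0.
rewrite /orbit_mass integral_mkcond -/f.
move: h1; rewrite h3 => /(congr1 (fun z => (rho ^+ m)%:E * z)%E).
rewrite !muleA -!EFinM -exprMn mulfV ?gt_eqF// expr1n mul1e => <-.
by rewrite mulrC.
Qed.

End claimC.

(* FILE H8 *)
Lemma powR_exprn (R : realType) (a p : R) k : 0 <= a -> (a ^+ k) `^ p = (a `^ p) ^+ k.
Proof.
move=> a0; elim: k => [|k IH]; first by rewrite !expr0 powR1.
by rewrite !exprS powRM ?exprn_ge0// IH.
Qed.

Lemma geometric_lty (R : realType) (a x : R) : 0 <= a -> 0 < x -> x < 1 ->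
  (\sum_(k <oo) (a * x ^+ k)%:E < +oo)%E.
Proof.
move=> a0 x0 x1; apply: (@le_lt_trans _ _ (a * (1 - x)^-1)%:E); last exact: ltry.
apply: lime_le.
  by apply: is_cvg_nneseries => k _ _; rewrite lee_fin mulr_ge0// exprn_ge0// ltW.
apply: nearW => k; rewrite sumEFin lee_fin.
by apply: geometric_le_lim => //; rewrite gtr0_norm.
Qed.

Lemma dyadic_shell (R : realType) (y b : R) : 0 < y -> y <= b ->
  exists k, b * 2^-1 ^+ k.+1 < y /\ y <= b * 2^-1 ^+ k.
Proof.
move=> y0 yb; have b0 : 0 < b := lt_le_trans y0 yb.
have [k0 Hk0] : exists k, b * 2^-1 ^+ k.+1 < y.
  apply: contrapT => /forallNP no.
  have : 2 <= 1 :> R; last by rewrite leNgt ltr1n.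
  apply: (@bounded_exp_le1 _ _ (b / y)) => // k.
  have := no k; move=> /negP; rewrite -leNgt => h.
  rewrite ler_pdivlMr// mulrC -ler_pdivlMr ?exprn_gt0// -exprVn; apply: le_trans h _.
  by apply: ler_wpM2l; [exact: ltW|rewrite exprS ler_piMl ?exprn_ge0 ?invr_ge0// invf_le1// ler1n].
have [k Hk Hmin] := ex_minnP (ex_intro (fun k => b * 2^-1 ^+ k.+1 < y) k0 Hk0).
exists k; split => //; case: k Hk Hmin => [|k] Hk Hmin; first by rewrite expr0 mulr1.
by rewrite leNgt; apply/negP => /Hmin; rewrite ltnn.
Qed.

Section claimC.
Context (R : realType) (n m r : nat) (D : siegel_data R n m r).
Local Notation T := (Tplus D).
Local Notation e' := (e_Omega' D).
Local Notation O' := (dual_cone (Omega D)).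
Hypothesis m0 : (0 < m)%N.
Hypothesis hO : homogeneous_cone (Omega D).
Hypothesis hT : triangular_simply_transitive (Omega D) T.
Hypothesis hA : abelianization T (Delta D).
Hypothesis he' : O' e'.
Hypothesis hH : forall rho, 0 < rho -> T rho%:M.
Hypothesis hD : forall rho, 0 < rho -> T rho%:M ->
  forall s, Delta_pow D s rho%:M = rho `^ (\sum_j s j).
Local Notation tup := (m.-tuple (measurableTypeR R)).
Let row : tup -> 'rV[R]_m := @row_of R m.
Let Orb : set tup := row @^-1` orbit_of D.
Let Ball (b : R) : set tup := row @^-1` [set lam | `|lam| <= b].
Variable j0 : 'I_r.

Let Delta_ge0 e lam : 0 <= Delta_Omega' D e lam.
Proof. by apply: prodr_ge0 => j _; exact: powR_ge0. Qed.

Lemma Delta_Omega'_sub b s lam : orbit_of D lam ->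
  Delta_Omega' D (fun j => b j - s j) lam = Delta_Omega' D b lam / Delta_Omega' D s lam.
Proof.
move=> [t Tt <-]; rewrite !(Delta_Omega'E hO hT hA he')//.
have nz := lt0r_neq0 (Delta_pow_gt0 hA s Tt).
apply: (mulIf nz); rewrite mulfVK//.
rewrite /Delta_pow -big_split; apply: eq_bigr => j _ /=.
rewrite -powRD ?subrK//.
by apply/implyP => _; rewrite gt_eqF// (Delta_gt0 hA).
Qed.

Let mOrb : measurable Orb. Proof. exact: (measurable_orbit hO hT hA he' j0). Qed.
Let mDual : measurable (row @^-1` O').
Proof. by apply: measurable_row_of_open; exact: (dual_open hO). Qed.
Let mDelta e : measurable_fun Orb (fun x => (Delta_Omega' D e (row x))%:E).
Proof. by apply/measurable_EFinP; exact: (measurable_Delta_Omega' hO hT hA he'). Qed.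

Lemma measurable_Delta_dual e :
  measurable_fun (row @^-1` O') (fun x => (Delta_Omega' D e (row x))%:E).
Proof.
have -> : row @^-1` O' = Orb `|` (row @^-1` O' `\` Orb).
  rewrite setDUK// => x; exact: (orbit_dual hT he').
apply/measurable_funU => //; first exact: measurableD.
split; first exact: mDelta.
apply: (@eq_measurable_fun _ _ _ _ _ (fun=> 1%:E)); last exact: measurable_cst.
by move=> x /set_mem[_ nx]; rewrite (Delta_Omega'_out hT hA).
Qed.

Lemma extends_to_radon_sub b s c : 0 < c ->
  (forall lam, orbit_of D lam -> c * `|lam| `^ (\sum_j s j) <= Delta_Omega' D s lam) ->
  \sum_j s j < \sum_j b j + m%:R ->
  extends_to_radon row O' (Delta_Omega' D b) ->
  extends_to_radon row O' (Delta_Omega' D (fun j => b j - s j)).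
Proof.
move=> c0 Hc sb hb; set sg := \sum_j s j in Hc sb; set tau := \sum_j b j in sb.
pose h lam := Delta_Omega' D (fun j => b j - s j) lam.
pose g := ((fun x => (h (row x))%:E) \_ (row @^-1` O')).
have mg : measurable_fun setT g.
  by apply/(measurable_restrictT _ _).1 => //; exact: measurable_Delta_dual.
have g0 x : (0 <= g x)%E by apply: erestrict_ge0 => y _; rewrite lee_fin; exact: Delta_ge0.
have [nu nuE] := density_exists (leb R m) mg g0.
exists nu; split=> [K cK _|A mA AO]; last first.
  rewrite nuE; apply: eq_integral => x /set_mem Ax.
  by rewrite /g patchT//; apply: mem_set; exact: AO.
have [B B0 HB] : exists2 B, 0 < B & forall lam, K lam -> `|lam| <= B.
  have /compact_bounded[B [_ HB]] := cK.
  exists (`|B| + 1) => [|lam Kl]; first by rewrite ltr_wpDl.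
  by apply: (HB (`|B| + 1)) => //; apply: le_lt_trans (ler_norm _) _; rewrite ltrDl.
pose rho k : R := 2^-1 ^+ k.
have rho0 k : 0 < rho k by rewrite exprn_gt0// invr_gt0.
pose c2 := expR (- (`|sg| * ln 2)) : R; have c20 : 0 < c2 by exact: expR_gt0.
pose w k := (c * c2 * (B * rho k) `^ sg)^-1.
have w0 k : 0 < w k by rewrite invr_gt0 !mulr_gt0// powR_gt0// mulr_gt0.
pose F k : tup -> \bar R := ((fun x => (Delta_Omega' D b (row x))%:E) \_ (Orb `&` Ball (B * rho k))).
have mF k : measurable_fun setT (F k).
  apply/(measurable_restrictT _ _).1; first by apply: measurableI => //; exact: measurable_Ball.
  by apply: measurable_funS (mDelta b).
have F0 k x : (0 <= F k x)%E by apply: erestrict_ge0 => y _; rewrite lee_fin; exact: Delta_ge0.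
pose S x : \bar R := (\sum_(k <oo) ((w k)%:E * F k x))%E.
have wF0 k x : (0 <= (w k)%:E * F k x)%E by rewrite mule_ge0// lee_fin ltW.
have S0 x : (0 <= S x)%E by apply: nneseries_ge0 => k _ _.
have mwF k : measurable_fun setT (fun x => (w k)%:E * F k x)%E.
  by apply: emeasurable_funM => //; exact: measurable_cst.
have mS : measurable_fun setT S by apply: ge0_emeasurable_sum => // k x _ _; exact: wF0.
have gS x : Ball B x -> (g x <= 1 + S x)%E.
  move=> Bx; rewrite /g /patch; case: ifPn => [/set_mem Ox|_]; last by rewrite adde_ge0.
  have [Orx|nOx] := pselect (Orb x); last first.
    by rewrite /h (Delta_Omega'_out hT hA)// leeDl.
  apply: (@le_trans _ _ (S x)); last by rewrite leeDr.
  have y0 : 0 < `|row x| by exact: (dual_norm_gt0 hO m0 Ox).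
  have [k [k1 k2]] := dyadic_shell y0 Bx.
  apply: (@le_trans _ _ ((w k)%:E * F k x)%E); last first.
    apply: le_trans (nneseries_lim_ge k.+1 _); last by move=> i _ _; exact: wF0.
    by rewrite big_nat_recr//= leeDr// sume_ge0.
  rewrite /F patchT; last by apply: mem_set.
  rewrite -EFinM lee_fin /h Delta_Omega'_sub// [leRHS]mulrC; apply: ler_wpM2l => //.
  have Br : 0 < B * rho k by rewrite mulr_gt0.
  have Ds : 0 < Delta_Omega' D s (row x).
    by case: Orx => t Tt et; rewrite -[row x]et (Delta_Omega'E hO hT hA he')// (Delta_pow_gt0 hA).
  rewrite /w lef_pV2 ?posrE//; last by rewrite !mulr_gt0// powR_gt0.
  apply: le_trans (Hc _ Orx); rewrite -mulrA; apply: ler_wpM2l; first exact: ltW.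
  have q0 : 0 <= `|row x| / (B * rho k) by rewrite divr_ge0// ltW.
  rewrite -[ `|row x| ](mulfVK (lt0r_neq0 Br)) (powRM _ q0 (ltW Br)).
  apply: ler_wpM2r; first exact: powR_ge0.
  apply: powR_lower_bound => //; apply/andP; split.
    rewrite ler_pdivlMr//; apply: ltW; move: k1; rewrite exprS /rho; congr (_ < _); ring.
  by apply: (@le_trans _ _ 1); [rewrite ler_pdivrMr// mul1r|rewrite ler1n].
have mBall : measurable (Ball B) by exact: measurable_Ball.
have mK : measurable (row @^-1` K).
  by apply: (@measurable_row_of_closed R m K); exact: compact_closed (@norm_hausdorff _ _) cK.
rewrite nuE; apply: (@le_lt_trans _ _ (\int[leb R m]_(x in Ball B) g x)%E).
  apply: ge0_subset_integral => //; first exact: measurable_funTS.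
  by move=> x Kx; exact: HB.
apply: (@le_lt_trans _ _ (\int[leb R m]_(x in Ball B) (1 + S x))%E).
  apply: ge0_le_integral => //; first exact: measurable_funTS.
  by apply: emeasurable_funD; [exact: measurable_cst|exact: measurable_funTS].
rewrite ge0_integralD//; last exact: measurable_funTS.
apply: lte_add_pinfty.
  rewrite integral_cst// mul1e; apply: leb_Ball_lty => //; exact: ltW.
apply: (@le_lt_trans _ _ (\int[leb R m]_x S x)%E); first by apply: ge0_subset_integral.
rewrite /S integral_nneseries//.
have massF k : (\int[leb R m]_x ((w k)%:E * F k x) = (w k)%:E * orbit_mass D b (rho k * B))%E.
  rewrite ge0_integralZl// ?lee_fin ?(ltW (w0 k))//; congr (_ * _)%E.
  by rewrite /orbit_mass [in RHS]integral_mkcond mulrC.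
under eq_eseriesr do rewrite massF (orbit_mass_scale hO hT hA he' hH hD j0 b B (rho0 _)).
have Moo := orbit_mass_lty hO hT hA he' j0 (ltW B0) hb.
have M0 := orbit_mass_ge0 D b B.
have fM : orbit_mass D b B \is a fin_num by rewrite ge0_fin_numE.
pose x : R := 2^-1 `^ (tau + m%:R - sg).
pose a := (c * c2 * B `^ sg)^-1 * fine (orbit_mass D b B).
apply: (@le_lt_trans _ _ (\sum_(k <oo) (a * x ^+ k)%:E)%E).
  rewrite le_eqVlt; apply/orP; left; apply/eqP; apply: eq_eseriesr => k _.
  rewrite -[in LHS](fineK fM) -!EFinM; congr (_%:E).
  rewrite /a /x /w -powR_exprn// -/(rho k) powRM ?(ltW B0) ?(ltW (rho0 k))//.
  rewrite -[rho k ^+ m]powR_mulrn ?(ltW (rho0 k))//.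
  rewrite !powRD ?powRN; try by apply/implyP => _; rewrite gt_eqF.
  rewrite !invfM; move: (fine _) (rho k `^ sg)^-1 (B `^ sg)^-1 => *; ring.
apply: geometric_lty.
- apply: mulr_ge0; last exact: fine_ge0.
  by rewrite invr_ge0 !mulr_ge0 ?powR_ge0 ?(ltW c0) ?(ltW c20).
- by rewrite powR_gt0.
- rewrite /x /powR gt_eqF ?invr_gt0// expR_lt1 lnV ?posrE// mulrN oppr_lt0 mulr_gt0//.
    by rewrite subr_gt0.
  by rewrite ln_gt0// ltr1n.
Qed.

End claimC.

Theorem proposition8p5 (R : realType) (n m r : nat) (D : siegel_data R n m r)
    (hm : (0 < m)%N) (hr : (1 < r)%N) (hD : siegel_setting D)
    (s : 'I_r -> R) (p q : \bar R) (hp : (0 < p)%E) (hq : (0 < q)%E) :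
  property_D' D s p q -> forall j : 'I_r, s j <= 0.
Proof.
move=> hDp j0; rewrite leNgt; apply/negP => s0.
have [[hO [hT hA]] [[hPhi hnd hpos _] [[hOe he' _ [[mm [mm' Hext]] hhom]] _]]] := hD.
have hH rho : 0 < rho -> Tplus D rho%:M by exact: (homothety_in_T hO hT hOe he').
have [c c0 Hc] := property_D'_lower_bound hO hT hA hPhi hnd hpos he' hH hhom hm hp hq hDp.
have [j1 j10] : exists j1 : 'I_r, j1 != j0.
  have [->|h] := eqVneq j0 (Ordinal hr); first by exists (Ordinal (ltnW hr)).
  by exists (Ordinal hr); rewrite eq_sym.
set sg := \sum_j s j in Hc.
pose X := \sum_j dexp D j + m%:R - sg.
pose a j : R := (mm' j)%:R / 2 + (if j == j0 then s j0 else 1 + `|X|).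
have X0 : 0 < 1 + `|X| by rewrite ltr_pwDl.
have t0 j : 0 < (if j == j0 then s j0 else 1 + `|X|) by case: ifP.
have [_ [_ Hb]] := Hext a.
have {}Hb := Hb (fun j => _).
have ext : extends_to_radon (@row_of R m) (dual_cone (Omega D))
    (Delta_Omega' D (fun j => a j + dexp D j)).
  by apply: Hb => j; rewrite /a ltrDl.
have sum_ge : 1 + `|X| <= \sum_j a j.
  have u0 : 0 <= (mm' j1)%:R / 2 :> R by rewrite divr_ge0.
  have v0 : 0 <= \sum_(j | j != j1) a j.
    by apply: sumr_ge0 => j _; rewrite addr_ge0 ?(ltW (t0 j))// divr_ge0.
  rewrite (bigD1 j1)//= {1}/a (negPf j10).
  by move: (\sum_(_ | _) _) v0 => v v0; lra.
have lt : sg < \sum_j (a j + dexp D j) + m%:R.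
  rewrite big_split /=; have hx : - `|X| <= X := lerNnormlW (lexx `|X|).
  have F (x y u v : R) : x = v + m%:R - sg -> - y <= x -> 1 + y <= u -> sg < u + v + m%:R.
    by move=> -> h1 h2; lra.
  exact: (F X `|X|).
have ext2 := extends_to_radon_sub hm hO hT hA he' hH hhom j0 c0 Hc lt ext.
have [_ [Hs _]] := Hext (fun j => a j - s j).
have /Hs/(_ j0) : extends_to_radon (@row_of R m) (dual_cone (Omega D))
    (Delta_Omega' D (fun j => a j - s j + dexp D j)).
  have <- : (fun j => a j + dexp D j - s j) = (fun j => a j - s j + dexp D j).
    by apply/funext => j; rewrite addrAC.
  exact: ext2.
by rewrite /a eqxx addrK ltxx.
Qed.
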